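(* For any closed scheme $\Phi$, the predicate formula $\Phi^*$ is absolutely realizable if and only if the scheme $\Phi$ is absolutely realizable.
   Context: **Computability.** $\{x\}$ is the unary partial recursive function with Gödel number $x$ (standard Kleene numbering, every natural number is a Gödel number); $!\{x\}(y)$ means that $\{x\}(y)$ is defined. $(a)_i$ is the exponent of the $i$-th prime $\pi_i$ ($\pi_0=2,\pi_1=3,\dots$) in the factorization of $a$ (with $(0)_i=0$). **Schemes and predicate formulas.** $Ar$ is the first-order language (connectives $\&,\lor,\to,\neg$, quantifiers; no function symbols or constants) with predicate symbols $Z$ (unary), $E,S$ (binary), $A,M$ (ternary), meaning over $\mathbb N$: $x=0$; $x=y$; $x+1=y$; $x+y=z$; $x\cdot y=z$. Predicate variables are $P^n_i$ ($n,i\in\mathbb N$, arity $n$). A scheme is a formula built from $Z,E,S,A,M$ (as predicate constants) and predicate variables; the scheme $\Phi(P_1,\dots,P_m)$ has no predicate variables other than $P_1,\dots,P_m$, which are different from the predicate variables used below for $Z,E,S,A,M$. A predicate formula is a formula built from predicate variables only. Adding a starred superscript to the language ($Ar^*$, etc.) means adding an individual constant for every natural number; $\bot$ is allowed as an atomic formula; $\Phi\leftrightarrow\Psi$ abbreviates $(\Phi\to\Psi)\,\&\,(\Psi\to\Phi)$. When a formula is regarded as a *predicate formula*, the symbols $Z,E,S,A,M$ in it are identified with the predicate variables $P^1_0,P^2_0,P^2_1,P^3_0,P^3_1$ and interpreted like any other predicate variables. **Realizability.** An $n$-ary generalized predicate is a function $\mathbb N^n\to2^{\mathbb N}$. An interpretation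 $f$ is a partial map assigning an $n$-ary generalized predicate $f(P^n_i)$ to each $P^n_i$ in its domain; it is an interpretation of a scheme (or predicate formula) if defined on all its predicate variables. For closed schemes with constants, $e\,\mathsf r^f\,\Phi$ is defined by: never $e\,\mathsf r^f\bot$; for $\Phi$ an atomic $Ar^*$-formula with $Z,E,S,A,M$ as constants, $e\,\mathsf r^f\Phi$ iff $e=0$ and $\Phi$ is true in $\mathbb N$; $e\,\mathsf r^f P(a_1,\dots,a_n)$ iff $e\in f(P)(a_1,\dots,a_n)$ for a predicate variable $P$; $e\,\mathsf r^f(\Phi\,\&\,\Psi)$ iff $(e)_0\,\mathsf r^f\Phi$ and $(e)_1\,\mathsf r^f\Psi$; $e\,\mathsf r^f(\Phi\lor\Psi)$ iff $(e)_0=0$ and $(e)_1\,\mathsf r^f\Phi$, or $(e)_0=1$ and $(e)_1\,\mathsf r^f\Psi$; $e\,\mathsf r^f(\Phi\to\Psi)$ iff for all $a$, $a\,\mathsf r^f\Phi$ implies $!\{e\}(a)$ and $\{e\}(a)\,\mathsf r^f\Psi$; $e\,\mathsf r^f\neg\Phi$ iff $e\,\mathsf r^f(\Phi\to\bot)$; $e\,\mathsf r^f\exists x\,\Phi(x)$ iff $(e)_1\,\mathsf r^f\Phi((e)_0)$; $e\,\mathsf r^f\forall x\,\Phi(x)$ iff for all $a$, $!\{e\}(a)$ and $\{e\}(a)\,\mathsf r^f\Phi(a)$. A closed scheme (or predicate formula) is *absolutely realizable* if there is one number $e$ with $e\,\mathsf r^f\,\Phi$ for every interpretation $f$ of it.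 **The formula $\Phi^*$.** For a closed scheme $\Phi(P_1,\dots,P_m)$, $\Phi^*$ is the predicate formula $$Q(Z,E,S,A,M)\,\&\,Eq(E,P_1,\dots,P_m)\to\Phi(Z,E,S,A,M,P_1,\dots,P_m),$$ in which $Z,E,S,A,M$ are treated as predicate variables. Here $Eq(E,P_1,\dots,P_m)$ is the conjunction, over $i$, of the equality axioms $\forall\vec x\forall\vec y(E(x_1,y_1)\,\&\dots\&\,E(x_n,y_n)\to(P_i(\vec x)\to P_i(\vec y)))$ ($n$ the arity of $P_i$; omitted if $m=0$), and $Q$ is as follows. $x\le y$ abbreviates $\exists z\,A(z,x,y)$. $\Delta_0$-formulas are built from atomic $Ar$-formulas by $\neg,\lor,\&,\to$ and bounded quantifiers $(\exists x\le t),(\forall x\le t)$ ($t\neq x$), i.e. $\exists x(x\le t\,\&\,\cdot)$, $\forall x(x\le t\to\cdot)$; $\Sigma$-formulas are built from $\Delta_0$-formulas by $\lor,\&$, bounded quantifiers and $\exists x$. $G(x,y,z)$ is a fixed $\Sigma$-formula of $Ar$ defining $\{x\}(y)=z$ in the standard model such that intuitionistic (Heyting) arithmetic $\mathsf{HA}$ proves $\forall x,y,z_1,z_2(G(x,y,z_1)\,\&\,G(x,y,z_2)\to z_1=z_2)$. $H(x,y)$ is $\exists z(Z(z)\,\&\,G(x,y,z))$. Let $\mathsf c(x,y)=\frac{(x+y)(x+y+1)}2+x$ be the pairing function with projections $\mathsf l,\mathsf r$ ($\mathsf c(\mathsf l(x),\mathsf r(x))=x$), $\mathsf l_*(x,0)=x$,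 $\mathsf l_*(x,y+1)=\mathsf l(\mathsf l_*(x,y))$, $\mathsf g(x,y)=\mathsf r(\mathsf l_*(x,y))$; $B(u,v)$ is the $Ar$-formula obtained from $\mathsf g(u,v)=1$ by the standard elimination of primitive recursive function symbols via $\Sigma$-formulas provably representing them in $\mathsf{HA}$. $Q$ is the conjunction of: $A_1$: $\forall x,y,z(S(x,z)\,\&\,S(y,z)\to E(x,y))$; $A_2$: $\forall x,y(S(x,y)\to\neg Z(y))$; $A_3$: $\forall x,y,z(E(x,y)\,\&\,E(x,z)\to E(y,z))$; $A_4$: $\forall x,y,z(E(x,y)\,\&\,S(x,z)\to S(y,z))$; $A_5$: $\forall x,y(Z(y)\to A(x,y,x))$; $A_6$: $\forall x,y,z,u,v(S(y,z)\,\&\,A(x,y,u)\,\&\,S(u,v)\to A(x,z,v))$; $A_7$: $\forall x,y(Z(y)\to M(x,y,y))$; $A_8$: $\forall x,y,z,u,v(S(y,z)\,\&\,M(x,y,u)\,\&\,A(u,x,v)\to M(x,z,v))$; $A_9$: $\forall x_1,x_2,y,z(E(x_1,x_2)\,\&\,A(x_1,y,z)\to A(x_2,y,z))$; $A_{10}$: $\forall x,y_1,y_2,z(E(y_1,y_2)\,\&\,A(x,y_1,z)\to A(x,y_2,z))$; $A_{11}$: $\forall x_1,x_2,y,z(E(x_1,x_2)\,\&\,M(x_1,y,z)\to M(x_2,y,z))$; $A_{12}$: $\forall x,y_1,y_2,z(E(y_1,y_2)\,\&\,M(x,y_1,z)\to M(x,y_2,z))$; $A_{13}$: $\forall x(Z(x)\lor\exists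 y\,S(y,x))$; $A_{14}$: $\exists x\,Z(x)$; $A_{15}$: $\forall x,y(Z(x)\,\&\,Z(y)\to E(x,y))$; $A_{16}$: $\forall x,y(E(x,y)\,\&\,Z(x)\to Z(y))$; $A_{17}$: $\forall x\exists y\,S(x,y)$; $A_{18}$: $\forall x,y,z(S(x,y)\,\&\,S(x,z)\to E(y,z))$; $A_{19}$: $\forall x,y,z(S(x,y)\,\&\,E(y,z)\to S(x,z))$; $A_{20}$: $\forall x,y\exists z\,A(x,y,z)$; $A_{21}$: $\forall x,y,z_1,z_2(A(x,y,z_1)\,\&\,A(x,y,z_2)\to E(z_1,z_2))$; $A_{22}$: $\forall x,y,z_1,z_2(A(x,y,z_1)\,\&\,E(z_1,z_2)\to A(x,y,z_2))$; $A_{23}$: $\forall x,y\exists z\,M(x,y,z)$; $A_{24}$: $\forall x,y,z_1,z_2(M(x,y,z_1)\,\&\,M(x,y,z_2)\to E(z_1,z_2))$; $A_{25}$: $\forall x,y,z_1,z_2(M(x,y,z_1)\,\&\,E(z_1,z_2)\to M(x,y,z_2))$; $A_{26}$: $\forall x,y,z_1,z_2(G(x,y,z_1)\,\&\,G(x,y,z_2)\to E(z_1,z_2))$; $A_{27}$: $\forall y,z\,\neg\neg\exists v\forall x(x\le z\to(B(v,x)\leftrightarrow H(y,x)))$; $A_{28}$: $\forall x\forall y(B(x,y)\lor\neg B(x,y))$. *)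

(* Defs.v *)
From Stdlib Require List.
From mathcomp Require Import all_boot.

Set Implicit Arguments.
Unset Strict Implicit.
Unset Printing Implicit Defensive.

(** Exponents of the first primes; [logn p 0 = 0], so they vanish at [0]. *)
Definition expo0 (a : nat) := logn 2 a.
Definition expo1 (a : nat) := logn 3 a.
Definition expo2 (a : nat) := logn 5 a.

(** [keval e xs z]: the recursive function with Goedel number [e] takes the
    value [z] on the argument list [xs].  The exponent of 2 in [e] is the tag
    of a scheme (zero, successor, projection, composition, primitive recursion,
    minimization), the exponents of 3 and 5 are its parameters.  A number with
    any other tag is a Goedel number of the nowhere defined function.
    [kevals] evaluates the list of inner functions of a composition: [0] codes
    the empty list and [c > 0] has head [expo0 c] and tail [expo1 c]. *)
Inductive keval : nat -> seq nat -> nat -> Prop :=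
| keval_zero e xs :
    expo0 e = 0 -> keval e xs 0
| keval_succ e x xs :
    expo0 e = 1 -> keval e (x :: xs) x.+1
| keval_proj e xs :
    expo0 e = 2 -> expo1 e < size xs -> keval e xs (nth 0 xs (expo1 e))
| keval_comp e xs ys z :
    expo0 e = 3 -> kevals (expo2 e) xs ys -> keval (expo1 e) ys z ->
    keval e xs z
| keval_prec0 e xs z :
    expo0 e = 4 -> keval (expo1 e) xs z -> keval e (0 :: xs) z
| keval_precS e k xs y z :
    expo0 e = 4 -> keval e (k :: xs) y -> keval (expo2 e) [:: k, y & xs] z ->
    keval e (k.+1 :: xs) z
| keval_mu e xs z (w : nat -> nat) :
    expo0 e = 5 -> keval (expo1 e) (z :: xs) 0 ->
    (forall y, y < z -> keval (expo1 e) (y :: xs) (w y).+1) ->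
    keval e xs z
with kevals : nat -> seq nat -> seq nat -> Prop :=
| kevals_nil xs :
    kevals 0 xs [::]
| kevals_cons c xs y ys :
    0 < c -> keval (expo0 c) xs y -> kevals (expo1 c) xs ys ->
    kevals c xs (y :: ys).

Definition kleene (e y z : nat) : Prop := keval e [:: y] z.

Inductive arsym := symZ | symE | symS | symA | symM.

Definition arity (s : arsym) : nat :=
  match s with symZ => 1 | symE | symS => 2 | symA | symM => 3 end.

(** Formulas in de Bruijn notation: the only terms are variables, and the
    variable [k] refers to the [k]-th enclosing quantifier, counted outwards
    from 0.  [Ar] is an atom with a predicate constant, [PV n i] one with the
    predicate variable P^n_i; elsewhere P^n_i is the pair [(n, i)]. *)
Inductive form : Type :=
| Bot
| Ar (s : arsym) (t : (arity s).-tuple nat)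
| PV (n i : nat) (t : n.-tuple nat)
| And (p q : form)
| Or (p q : form)
| Imp (p q : form)
| Neg (p : form)
| All (p : form)
| Ex (p : form).

Definition Iff (p q : form) := And (Imp p q) (Imp q p).

Declare Scope form_scope.
Delimit Scope form_scope with form.
Bind Scope form_scope with form.
Notation "p ∧ q" := (And p q) (at level 80, right associativity) : form_scope.
Notation "p ∨ q" := (Or p q) (at level 85, right associativity) : form_scope.
Notation "p ⟶ q" := (Imp p q) (at level 90, right associativity) : form_scope.
Notation "p ⟷ q" := (Iff p q) (at level 90, no associativity) : form_scope.
Notation "¬ p" := (Neg p) (at level 75, right associativity) : form_scope.
Local Open Scope form_scope.

Definition fZ x : form := Ar (s := symZ) [tuple x].
Definition fE x y : form := Ar (s := symE) [tuple x; y].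
Definition fS x y : form := Ar (s := symS) [tuple x; y].
Definition fA x y z : form := Ar (s := symA) [tuple x; y; z].
Definition fM x y z : form := Ar (s := symM) [tuple x; y; z].

Definition scons (T : Type) (a : T) (r : nat -> T) (k : nat) : T :=
  if k is k'.+1 then r k' else a.

Fixpoint ren (r : nat -> nat) (p : form) : form :=
  match p with
  | Bot => Bot
  | Ar s t => Ar (map_tuple r t)
  | PV n i t => PV i (map_tuple r t)
  | And p q => And (ren r p) (ren r q)
  | Or p q => Or (ren r p) (ren r q)
  | Imp p q => Imp (ren r p) (ren r q)
  | Neg p => Neg (ren r p)
  | All p => All (ren (scons 0 (succn \o r)) p)
  | Ex p => Ex (ren (scons 0 (succn \o r)) p)
  end.

(** A formula written F(x_0, ..., x_(k-1)) has the variables 0, ..., k-1 as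
    parameters, in this order; [inst F [:: y_0; ...; y_(k-1)]] is
    F(y_0, ..., y_(k-1)). *)
Definition inst (p : form) (s : seq nat) : form := ren (nth 0 s) p.

Fixpoint scoped (n : nat) (p : form) : bool :=
  match p with
  | Bot => true
  | Ar _ t => all (ltn^~ n) t
  | PV _ _ t => all (ltn^~ n) t
  | And p q | Or p q | Imp p q => scoped n p && scoped n q
  | Neg p => scoped n p
  | All p | Ex p => scoped n.+1 p
  end.

Definition is_closed (p : form) : bool := scoped 0 p.

Fixpoint pvars (p : form) : seq (nat * nat) :=
  match p with
  | Bot | Ar _ _ => [::]
  | PV n i _ => [:: (n, i)]
  | And p q | Or p q | Imp p q => pvars p ++ pvars q
  | Neg p | All p | Ex p => pvars p
  end.

(** [alls n (fun x1 ... xn => p)] is the closure of [p] under n universal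
    quantifiers, [x1] being bound by the outermost one. *)
Fixpoint nform (n : nat) : Type :=
  if n is n'.+1 then nat -> nform n' else form.
Fixpoint nform_app (n : nat) : nform n -> form :=
  if n is n'.+1 then fun F => nform_app (F n') else fun F => F.
Definition alls (n : nat) (F : nform n) : form := iter n All (nform_app F).
Arguments alls n F : clear implicits.

Fixpoint bigconj (p : form) (ps : seq form) : form :=
  if ps is q :: qs then p ∧ bigconj q qs else p.

Definition ar_true (s : arsym) (t : (arity s).-tuple nat) : Prop :=
  let a := nth 0 t in
  match s with
  | symZ => a 0 = 0
  | symE => a 0 = a 1
  | symS => (a 0).+1 = a 1
  | symA => a 0 + a 1 = a 2
  | symM => a 0 * a 1 = a 2
  end.

Definition gpred (n : nat) : Type := n.-tuple nat -> nat -> Prop.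

(** [f n i] is the value of the interpretation at P^n_i, [None] if undefined. *)
Definition interpretation : Type := forall n i : nat, option (gpred n).

Definition interprets (f : interpretation) (p : form) : Prop :=
  forall n i, (n, i) \in pvars p -> f n i <> None.

(** The valuation [v] stands for the substitution of the constants [v k] for
    the free variables [k] of [p]. *)
Fixpoint realizes (f : interpretation) (v : nat -> nat) (p : form) (e : nat)
    : Prop :=
  match p with
  | Bot => False
  | Ar s t => e = 0 /\ ar_true (map_tuple v t)
  | PV n i t => if f n i is Some P then P (map_tuple v t) e else False
  | And p q => realizes f v p (expo0 e) /\ realizes f v q (expo1 e)
  | Or p q => expo0 e = 0 /\ realizes f v p (expo1 e) \/
              expo0 e = 1 /\ realizes f v q (expo1 e)
  | Imp p q => forall a, realizes f v p a ->
                 exists b, kleene e a b /\ realizes f v q b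
  | Neg p => forall a, realizes f v p a -> exists b, kleene e a b /\ False
  | All p => forall a, exists b, kleene e a b /\ realizes f (scons a v) p b
  | Ex p => realizes f (scons (expo0 e) v) p (expo1 e)
  end.

Definition absolutely_realizable (p : form) : Prop :=
  exists e, forall f, interprets f p -> realizes f (fun=> 0) p e.

(** Only meant for formulas without predicate
    variables. *)
Fixpoint sat (v : nat -> nat) (p : form) : Prop :=
  match p with
  | Bot => False
  | Ar s t => ar_true (map_tuple v t)
  | PV _ _ _ => False
  | And p q => sat v p /\ sat v q
  | Or p q => sat v p \/ sat v q
  | Imp p q => sat v p -> sat v q
  | Neg p => ~ sat v p
  | All p => forall a, sat (scons a v) p
  | Ex p => exists a, sat (scons a v) p
  end.

Definition fle x y : form := Ex (fA 0 x.+1 y.+1).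

(** In the bounded quantifiers the bound is [t.+1] since [t] is taken outside
    of the scope of the quantifier. *)
Definition bEx t (p : form) : form := Ex (fle 0 t.+1 ∧ p).
Definition bAll t (p : form) : form := All (fle 0 t.+1 ⟶ p).

Inductive Delta0 : form -> Prop :=
| Delta0_Bot : Delta0 Bot
| Delta0_Ar s t : Delta0 (@Ar s t)
| Delta0_Neg p : Delta0 p -> Delta0 (¬ p)
| Delta0_Or p q : Delta0 p -> Delta0 q -> Delta0 (p ∨ q)
| Delta0_And p q : Delta0 p -> Delta0 q -> Delta0 (p ∧ q)
| Delta0_Imp p q : Delta0 p -> Delta0 q -> Delta0 (p ⟶ q)
| Delta0_bEx t p : Delta0 p -> Delta0 (bEx t p)
| Delta0_bAll t p : Delta0 p -> Delta0 (bAll t p).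

Inductive Sigma : form -> Prop :=
| Sigma_Delta0 p : Delta0 p -> Sigma p
| Sigma_Or p q : Sigma p -> Sigma q -> Sigma (p ∨ q)
| Sigma_And p q : Sigma p -> Sigma q -> Sigma (p ∧ q)
| Sigma_bEx t p : Sigma p -> Sigma (bEx t p)
| Sigma_bAll t p : Sigma p -> Sigma (bAll t p)
| Sigma_Ex p : Sigma p -> Sigma (Ex p).

Definition axA1 := alls 3 (fun x y z => fS x z ∧ fS y z ⟶ fE x y).
Definition axA2 := alls 2 (fun x y => fS x y ⟶ ¬ fZ y).
Definition axA3 := alls 3 (fun x y z => fE x y ∧ fE x z ⟶ fE y z).
Definition axA4 := alls 3 (fun x y z => fE x y ∧ fS x z ⟶ fS y z).
Definition axA5 := alls 2 (fun x y => fZ y ⟶ fA x y x).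
Definition axA6 := alls 5 (fun x y z u v =>
  fS y z ∧ fA x y u ∧ fS u v ⟶ fA x z v).
Definition axA7 := alls 2 (fun x y => fZ y ⟶ fM x y y).
Definition axA8 := alls 5 (fun x y z u v =>
  fS y z ∧ fM x y u ∧ fA u x v ⟶ fM x z v).
Definition axA9 := alls 4 (fun x1 x2 y z => fE x1 x2 ∧ fA x1 y z ⟶ fA x2 y z).
Definition axA10 := alls 4 (fun x y1 y2 z => fE y1 y2 ∧ fA x y1 z ⟶ fA x y2 z).
Definition axA11 := alls 4 (fun x1 x2 y z => fE x1 x2 ∧ fM x1 y z ⟶ fM x2 y z).
Definition axA12 := alls 4 (fun x y1 y2 z => fE y1 y2 ∧ fM x y1 z ⟶ fM x y2 z).
Definition axA13 := alls 1 (fun x => fZ x ∨ Ex (fS 0 x.+1)).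
Definition axA14 := Ex (fZ 0).
Definition axA15 := alls 2 (fun x y => fZ x ∧ fZ y ⟶ fE x y).
Definition axA16 := alls 2 (fun x y => fE x y ∧ fZ x ⟶ fZ y).
Definition axA17 := alls 1 (fun x => Ex (fS x.+1 0)).
Definition axA18 := alls 3 (fun x y z => fS x y ∧ fS x z ⟶ fE y z).
Definition axA19 := alls 3 (fun x y z => fS x y ∧ fE y z ⟶ fS x z).
Definition axA20 := alls 2 (fun x y => Ex (fA x.+1 y.+1 0)).
Definition axA21 := alls 4 (fun x y z1 z2 => fA x y z1 ∧ fA x y z2 ⟶ fE z1 z2).
Definition axA22 := alls 4 (fun x y z1 z2 => fA x y z1 ∧ fE z1 z2 ⟶ fA x y z2).
Definition axA23 := alls 2 (fun x y => Ex (fM x.+1 y.+1 0)).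
Definition axA24 := alls 4 (fun x y z1 z2 => fM x y z1 ∧ fM x y z2 ⟶ fE z1 z2).
Definition axA25 := alls 4 (fun x y z1 z2 => fM x y z1 ∧ fE z1 z2 ⟶ fM x y z2).

(** The equality axioms and the axioms of zero, successor, addition and
    multiplication, in the relational language. *)
Definition basic_axioms : seq form :=
  [:: axA1; axA2; axA3; axA4; axA5; axA6; axA7; axA8; axA9; axA10; axA11; axA12;
      axA13; axA14; axA15; axA16; axA17; axA18; axA19; axA20; axA21; axA22;
      axA23; axA24; axA25].

(** Induction on the variable 0 of [p]; in the induction step, [ren succn p]
    is p(x) and [ren (scons 0 (succn \o succn)) p] is p(y), where x and y are
    the variables 1 and 0. *)
Definition induction (p : form) : form :=
  All (fZ 0 ⟶ p) ∧
  All (All (ren succn p ∧ fS 1 0 ⟶ ren (scons 0 (succn \o succn)) p)) ⟶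
  All p.

(** Natural deduction for intuitionistic arithmetic, formulated in Ar. *)
Inductive HA : seq form -> form -> Prop :=
| HA_basic H p : List.In p basic_axioms -> HA H p
| HA_induction H p : pvars p = [::] -> HA H (induction p)
| HA_hyp H p : List.In p H -> HA H p
| HA_BotE H p : HA H Bot -> HA H p
| HA_AndI H p q : HA H p -> HA H q -> HA H (p ∧ q)
| HA_AndE1 H p q : HA H (p ∧ q) -> HA H p
| HA_AndE2 H p q : HA H (p ∧ q) -> HA H q
| HA_OrI1 H p q : HA H p -> HA H (p ∨ q)
| HA_OrI2 H p q : HA H q -> HA H (p ∨ q)
| HA_OrE H p q r : HA H (p ∨ q) -> HA (p :: H) r -> HA (q :: H) r -> HA H r
| HA_ImpI H p q : HA (p :: H) q -> HA H (p ⟶ q)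
| HA_ImpE H p q : HA H (p ⟶ q) -> HA H p -> HA H q
| HA_NegI H p : HA (p :: H) Bot -> HA H (¬ p)
| HA_NegE H p : HA H (¬ p) -> HA H p -> HA H Bot
| HA_AllI H p : HA (map (ren succn) H) p -> HA H (All p)
| HA_AllE H p x : HA H (All p) -> HA H (ren (scons x id) p)
| HA_ExI H p x : HA H (ren (scons x id) p) -> HA H (Ex p)
| HA_ExE H p q :
    HA H (Ex p) -> HA (p :: map (ren succn) H) (ren succn q) -> HA H q.

Definition HA_proves (p : form) : Prop := HA [::] p.

Definition functional2 (F : form) : form := alls 4 (fun x y z1 z2 =>
  inst F [:: x; y; z1] ∧ inst F [:: x; y; z2] ⟶ fE z1 z2).
Definition total2 (F : form) : form := alls 2 (fun x y =>
  Ex (inst F [:: x.+1; y.+1; 0])).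
Definition functional1 (F : form) : form := alls 3 (fun x z1 z2 =>
  inst F [:: x; z1] ∧ inst F [:: x; z2] ⟶ fE z1 z2).
Definition total1 (F : form) : form := alls 1 (fun x =>
  Ex (inst F [:: x.+1; 0])).

Record kleene_formula (G : form) : Prop := KleeneFormula {
  kleene_Sigma : Sigma G;
  kleene_scoped : scoped 3 G;
  kleene_defines : forall x y z, sat (nth 0 [:: x; y; z]) G <-> kleene x y z;
  kleene_functional : HA_proves (functional2 G)
}.

Definition formH (G : form) x y : form :=
  Ex (fZ 0 ∧ inst G [:: x.+1; y.+1; 0]).

Definition cpair (x y : nat) : nat := ((x + y) * (x + y + 1)) %/ 2 + x.

(** The bound is sufficient since x, y <= cpair x y. *)
Definition cunpair (n : nat) : nat * nat :=
  if [pick p : 'I_n.+1 * 'I_n.+1 | cpair p.1 p.2 == n] is Some p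
  then (p.1 : nat, p.2 : nat) else (0, 0).
Definition cleft (n : nat) : nat := (cunpair n).1.
Definition cright (n : nat) : nat := (cunpair n).2.
Definition lstar (x y : nat) : nat := iter y cleft x.
Definition gseq (x y : nat) : nat := cright (lstar x y).

Record represents1 (F : form) (h : nat -> nat) : Prop := Represents1 {
  rep1_Sigma : Sigma F;
  rep1_scoped : scoped 2 F;
  rep1_defines : forall x z, sat (nth 0 [:: x; z]) F <-> h x = z;
  rep1_total : HA_proves (total1 F);
  rep1_functional : HA_proves (functional1 F)
}.

Record represents2 (F : form) (h : nat -> nat -> nat) : Prop := Represents2 {
  rep2_Sigma : Sigma F;
  rep2_scoped : scoped 3 F;
  rep2_defines : forall x y z, sat (nth 0 [:: x; y; z]) F <-> h x y = z;
  rep2_total : HA_proves (total2 F);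
  rep2_functional : HA_proves (functional2 F)
}.

(** Sigma-formulas that represent the functions c, l, r, l_* and g in HA, their
    defining equations being provable. *)
Record pairing_formulas (Fc Fl Fr Fls Fg : form) : Prop := PairingFormulas {
  pairing_c : represents2 Fc cpair;
  pairing_l : represents1 Fl cleft;
  pairing_r : represents1 Fr cright;
  pairing_ls : represents2 Fls lstar;
  pairing_g : represents2 Fg gseq;
  (* c(x, y) = h + x where h + h = (x + y)(x + y + 1) *)
  pairing_c_eq : HA_proves (alls 7 (fun x y s s' m h z =>
    fA x y s ∧ fS s s' ∧ fM s s' m ∧ fA h h m ∧ fA h x z ⟶
    inst Fc [:: x; y; z]));
  pairing_lr_eq : HA_proves (alls 3 (fun x a b =>
    inst Fl [:: x; a] ∧ inst Fr [:: x; b] ⟶ inst Fc [:: a; b; x]));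
  pairing_ls0_eq : HA_proves (alls 2 (fun x y => fZ y ⟶ inst Fls [:: x; y; x]));
  pairing_lsS_eq : HA_proves (alls 5 (fun x y y' t w =>
    fS y y' ∧ inst Fls [:: x; y; t] ∧ inst Fl [:: t; w] ⟶
    inst Fls [:: x; y'; w]));
  pairing_g_eq : HA_proves (alls 4 (fun x y t w =>
    inst Fls [:: x; y; t] ∧ inst Fr [:: t; w] ⟶ inst Fg [:: x; y; w]))
}.

(** B(u, v), i.e. g(u, v) = 1, where [Fg] represents g. *)
Definition formB (Fg : form) u v : form :=
  Ex (inst Fg [:: u.+1; v.+1; 0] ∧ Ex (fZ 0 ∧ fS 0 1)).

Definition axA26 (G : form) := functional2 G.
Definition axA27 (G Fg : form) := alls 2 (fun y z =>
  ¬ ¬ Ex (bAll z.+1 (formB Fg 1 0 ⟷ formH G y.+2 0))).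
Definition axA28 (Fg : form) := alls 2 (fun x y =>
  formB Fg x y ∨ ¬ formB Fg x y).

Definition formQ (G Fg : form) : form :=
  bigconj axA1 (behead basic_axioms ++ [:: axA26 G; axA27 G Fg; axA28 Fg]).

(** The equality axiom of P^n_i.  Of the 2n quantified variables the first n
    are x_1, ..., x_n and the last n are y_1, ..., y_n.  There is no premise
    if n = 0. *)
Definition equality_axiom (P : nat * nat) : form :=
  let: (n, i) := P in
  let x j := n + n - j.+1 in
  let y j := n - j.+1 in
  let p := PV i [tuple x (val j) | j < n] ⟶ PV i [tuple y (val j) | j < n] in
  iter (n + n) All
    (if [seq fE (x j) (y j) | j <- iota 0 n] is q :: qs then bigconj q qs ⟶ p
     else p).

(** Index of the predicate variable with which a predicate constant is
    identified in predicate formulas. *)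
Definition arindex (s : arsym) : nat :=
  match s with symZ | symE | symA => 0 | symS | symM => 1 end.

Definition reserved : seq (nat * nat) :=
  [seq (arity s, arindex s) | s <- [:: symZ; symE; symS; symA; symM]].

Fixpoint as_predicate (p : form) : form :=
  match p with
  | Bot => Bot
  | Ar s t => PV (arindex s) t
  | PV n i t => PV i t
  | And p q => And (as_predicate p) (as_predicate q)
  | Or p q => Or (as_predicate p) (as_predicate q)
  | Imp p q => Imp (as_predicate p) (as_predicate q)
  | Neg p => Neg (as_predicate p)
  | All p => All (as_predicate p)
  | Ex p => Ex (as_predicate p)
  end.

Definition star (G Fg : form) (Ps : seq (nat * nat)) (Phi : form) : form :=
  let Q := formQ G Fg in
  as_predicate
    (if [seq equality_axiom P | P <- Ps] is q :: qs then Q ∧ bigconj q qs ⟶ Phi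
     else Q ⟶ Phi).

(* Main.v *)
Require Import Defs.
From mathcomp Require Import all_boot zify.
From Stdlib Require Import Classical ClassicalEpsilon FunctionalExtensionality.

(** Why the theorem is true.

    Suppose that Phi* is absolutely realizable.  Let the arithmetical predicate
    variables have their standard meaning, with 0 as the only realizer of a
    true atom; then every interpretation of Phi extends to one of Phi*, and
    Phi means the same as before.  It remains to find one number that realizes
    the premise of Phi* under all these interpretations ([std_premise]).  The
    equality axioms hold since E is equality, and A1, ..., A25 have obvious
    realizers.  A26 holds since a realizable Sigma-formula is true, and A27
    since a true Sigma-formula is realizable and a realizer of a double negation
    carries no information.  Only A28 asks for a decision: since HA proves
    that g is total, the soundness of realizability for HA ([HA_sound]) yields
    a program for g together with realizers.

    Conversely let Phi be absolutely realizable, and let [q] realize the premise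
    of Phi* under an interpretation f.  The realizers in [q] make successor,
    addition and multiplication computable on the elements, so that each
    number n has a numeral [num J q n] and true atoms about numbers are
    realized for their numerals ([atom_up]).  As in Tennenbaum's theorem, every
    element equals a numeral ([all_standard]).  Otherwise take an element x
    that equals none; all numerals lie below x, so A27 gives a code v whose
    members among the numerals n are those for which H(y, n) is realizable, and
    A28 decides membership.  Let y compute {y}(n) = {n}(n).  By
    Sigma-completeness ([Sigma_complete]) {n}(n) = 0 makes H(y, n) realizable,
    and by A26 {n}(n) = 1 excludes it.  So there is a total program with values
    0 and 1 whose value at n differs from {n}(n) whenever {n}(n) is 0 or 1,
    and its value at its own code is contradictory.

    Every element x now has a standard part, computed by taking predecessors
    until A13 yields zero ([standard_part]).  Let f' give to P(n_1, ..., n_k)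
    the realizers that f gives to P at the numerals of n_1, ..., n_k.  Since Phi
    is absolutely realizable, a number realizes it under f' as well.  By
    induction on subformulas, realizers for f' at numbers and realizers for f at
    equal elements are computed from each other ([translation]): the equality
    axioms serve for atoms, numerals and standard parts for the quantifiers.

    All realizers must be uniform in the interpretation, the elements and other
    realizers.  The predicate [solvable] expresses this without naming a
    program: one program solves all instances of a problem, indexed by a type
    whose members can comprise interpretations and valuations as well as
    numbers.  Its closure properties are the rules of intuitionistic logic, and
    they rest on a universal program ([universal]), on the s-m-n theorem
    ([section_code]) and on the recursion theorem ([sol_fix]). *)

Set Implicit Arguments.
Unset Strict Implicit.
Unset Printing Implicit Defensive.

(** * Recursive functions on lists of arguments *)

Scheme keval_mut := Induction for keval Sort Prop
with kevals_mut := Induction for kevals Sort Prop.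

Lemma keval_det e xs z : keval e xs z -> forall z', keval e xs z' -> z' = z.
Proof.
pose P e xs z & keval e xs z := forall z', keval e xs z' -> z' = z.
pose Ps c xs ys & kevals c xs ys := forall ys', kevals c xs ys' -> ys' = ys.
move: e xs z; apply: (keval_mut (P := P) (P0 := Ps)); rewrite /P /Ps.
- by move=> e xs E z' H; inversion H; subst; congruence.
- by move=> e x xs E z' H; inversion H; subst; congruence.
- by move=> e xs E L z' H; inversion H; subst; congruence.
- move=> e xs ys z E _ IH1 _ IH2 z' H; inversion H; subst; try congruence.
  apply: IH2.
  by match goal with H : kevals _ _ _ |- _ => rewrite -(IH1 _ H) end.
- by move=> e xs z E _ IH z' H; inversion H; subst; try congruence; apply: IH.
- move=> e k xs y z E _ IH1 _ IH2 z' H; inversion H; subst; try congruence.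
  apply: IH2.
  by match goal with H : keval e (k :: xs) _ |- _ => rewrite -(IH1 _ H) end.
- move=> e xs z w E _ IH1 _ IH2 z' H.
  inversion H as [| | | | | | e' xs' z'' w' E' H0 Hw]; subst; try congruence.
  case: (ltngtP z' z) => // L; first by have := IH2 _ L _ H0.
  by have := IH1 _ (Hw _ L).
- by move=> xs ys' H; inversion H.
- move=> c xs y ys L _ IH1 _ IH2 ys' H.
  inversion H as [|c' xs' y' ys'' L' H1 H2]; subst; first by [].
  by rewrite (IH1 _ H1) (IH2 _ H2).
Qed.

(** Goedel numbers with a given tag and given parameters. *)
Definition mk (t a b : nat) := 2 ^ t * 3 ^ a * 5 ^ b.
(** Used for lists of programs, whose cells have this form, and for all other
    data. *)
Definition pair (a b : nat) := 2 ^ a * 3 ^ b.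

Ltac logn_powers :=
  rewrite !lognM ?muln_gt0 ?expn_gt0 // !lognX !logn_prime //=; lia.

Lemma expo0_mk t a b : expo0 (mk t a b) = t.
Proof. by rewrite /expo0 /mk; logn_powers. Qed.
Lemma expo1_mk t a b : expo1 (mk t a b) = a.
Proof. by rewrite /expo1 /mk; logn_powers. Qed.
Lemma expo2_mk t a b : expo2 (mk t a b) = b.
Proof. by rewrite /expo2 /mk; logn_powers. Qed.
Lemma expo0_pair a b : expo0 (pair a b) = a.
Proof. by rewrite /expo0 /pair; logn_powers. Qed.
Lemma expo1_pair a b : expo1 (pair a b) = b.
Proof. by rewrite /expo1 /pair; logn_powers. Qed.
Lemma pair_gt0 a b : 0 < pair a b.
Proof. by rewrite /pair muln_gt0 !expn_gt0. Qed.

Definition expE := (expo0_mk, expo1_mk, expo2_mk, expo0_pair, expo1_pair).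

Section ListPrograms.

Variables (I : Type) (xs : I -> seq nat).

Definition lcomputable (F : I -> nat) :=
  exists e, forall i, keval e (xs i) (F i).
Definition lcomputables (ys : I -> seq nat) :=
  exists c, forall i, kevals c (xs i) (ys i).

Lemma cmls_nil : lcomputables (fun=> [::]).
Proof. by exists 0 => i; constructor. Qed.

Lemma cmls_cons F ys : lcomputable F -> lcomputables ys ->
  lcomputables (fun i => F i :: ys i).
Proof.
move=> [e He] [c Hc]; exists (pair e c) => i.
by constructor; rewrite ?pair_gt0 // expE.
Qed.

Lemma cml_sub ys F :
  lcomputables ys -> (exists e, forall i, keval e (ys i) (F i)) ->
    lcomputable F.
Proof.
move=> [c Hc] [e He]; exists (mk 3 e c) => i.
by apply: (@keval_comp _ _ (ys i)); rewrite expE.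
Qed.

Lemma cml_var k F :
  (forall i, k < size (xs i)) -> (forall i, F i = nth 0 (xs i) k) ->
    lcomputable F.
Proof.
move=> L E; exists (mk 2 k 0) => i; rewrite E.
by rewrite -{2}(expo1_mk 2 k 0); apply: keval_proj; rewrite expE.
Qed.

Lemma cml_zero : lcomputable (fun=> 0).
Proof. by exists (mk 0 0 0) => i; apply: keval_zero; rewrite expE. Qed.

End ListPrograms.

Definition recursive1 (h : nat -> nat) :=
  exists e, forall a, keval e [:: a] (h a).
Definition recursive2 (h : nat -> nat -> nat) :=
  exists e, forall a b, keval e [:: a; b] (h a b).
Definition recursive3 (h : nat -> nat -> nat -> nat) :=
  exists e, forall a b c, keval e [:: a; b; c] (h a b c).

Lemma cml_rec1 h I (xs : I -> seq nat) F : recursive1 h ->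
  lcomputable xs F -> lcomputable xs (fun i => h (F i)).
Proof.
move=> [e He] HF; apply: (@cml_sub _ _ (fun i => [:: F i])); last by exists e.
by apply: cmls_cons => //; apply: cmls_nil.
Qed.

Lemma cml_rec2 h I (xs : I -> seq nat) F G : recursive2 h ->
  lcomputable xs F -> lcomputable xs G ->
    lcomputable xs (fun i => h (F i) (G i)).
Proof.
move=> [e He] HF HG; apply: (@cml_sub _ _ (fun i => [:: F i; G i]));
  last by exists e.
by do !apply: cmls_cons => //; apply: cmls_nil.
Qed.

Lemma cml_rec3 h I (xs : I -> seq nat) F G H : recursive3 h ->
  lcomputable xs F -> lcomputable xs G -> lcomputable xs H ->
    lcomputable xs (fun i => h (F i) (G i) (H i)).
Proof.
move=> [e He] HF HG HH; apply: (@cml_sub _ _ (fun i => [:: F i; G i; H i]));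
  last by exists e.
by do !apply: cmls_cons => //; apply: cmls_nil.
Qed.

Lemma rec1_cml h : lcomputable (fun a => [:: a]) h -> recursive1 h.
Proof. by []. Qed.
Lemma rec2_cml h :
  lcomputable (fun p : nat * nat => [:: p.1; p.2]) (fun p => h p.1 p.2) ->
    recursive2 h.
Proof. by move=> [e He]; exists e => a b; apply: (He (a, b)). Qed.

Lemma cml_prec I (xs : I -> seq nat) (h : I -> nat -> nat) :
  lcomputable xs (fun i => h i 0) ->
  lcomputable (fun j : I * nat => [:: j.2, h j.1 j.2 & xs j.1])
    (fun j => h j.1 j.2.+1) ->
  lcomputable (fun j : I * nat => j.2 :: xs j.1) (fun j => h j.1 j.2).
Proof.
move=> [e0 H0] [e1 H1]; exists (mk 4 e0 e1) => -[i n] /=.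
elim: n => [|n IH]; first by apply: keval_prec0; rewrite expE.
by apply: (keval_precS _ IH); rewrite expE //; apply: (H1 (i, n)).
Qed.

Lemma rec1_prec (h : nat -> nat) :
  lcomputable (fun n => [:: n; h n]) (fun n => h n.+1) ->
  lcomputable (fun _ : unit => [::]) (fun=> h 0) -> recursive1 h.
Proof.
move=> [e1 H1] H0.
have [|e He] := @cml_prec unit (fun=> [::]) (fun=> h) H0.
  by exists e1 => -[? n]; apply: H1.
by exists e => a; apply: (He (tt, a)).
Qed.

Lemma rec2_prec (h : nat -> nat -> nat) :
  lcomputable (fun n => [:: n]) (h^~ 0) ->
  lcomputable (fun j : nat * nat => [:: j.2; h j.1 j.2; j.1])
    (fun j => h j.1 j.2.+1) ->
  recursive2 (fun m n => h n m).
Proof.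
move=> H0 H1; have [e He] := cml_prec H0 H1.
by exists e => a b; apply: (He (b, a)).
Qed.

Lemma rec2_swap h : recursive2 h -> recursive2 (fun a b => h b a).
Proof.
move=> H; apply: rec2_cml; apply: cml_rec2 => //.
  by apply: (cml_var (k := 1)).
by apply: (cml_var (k := 0)).
Qed.

Lemma rec1_succ : recursive1 succn.
Proof. by exists (mk 1 0 0) => a; apply: keval_succ; rewrite expE. Qed.

Lemma rec1_pred : recursive1 predn.
Proof. by apply: rec1_prec; [apply: (cml_var (k := 0)) | apply: cml_zero]. Qed.

Lemma rec2_add : recursive2 addn.
Proof.
apply: (@rec2_prec (fun n m => m + n)); first exact: (cml_var (k := 0)).
apply: (cml_rec1 (F := fun j => j.2 + j.1) rec1_succ);
  exact: (cml_var (k := 1)).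
Qed.

Lemma rec2_mul : recursive2 muln.
Proof.
apply: (@rec2_prec (fun n m => m * n)); first exact: cml_zero.
apply: (cml_rec2 (F := fun j => j.1) (G := fun j => j.2 * j.1) rec2_add).
  exact: (cml_var (k := 2)).
exact: (cml_var (k := 1)).
Qed.

Lemma cml_const I (xs : I -> seq nat) n : lcomputable xs (fun=> n).
Proof.
elim: n => [|n IH]; first exact: cml_zero.
exact: (cml_rec1 rec1_succ IH).
Qed.

Lemma rec2_exp : recursive2 expn.
Proof.
apply: (rec2_swap (h := fun n m => m ^ n)).
apply: (@rec2_prec expn); first exact: cml_const.
set xs := (X in lcomputable X _).
have v1 : lcomputable xs (fun j => j.1 ^ j.2) by exact: (cml_var (k := 1)).
have v2 : lcomputable xs fst by exact: (cml_var (k := 2)).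
have [e He] := cml_rec2 rec2_mul v2 v1.
by exists e => i; rewrite expnS.
Qed.

Lemma rec2_sub : recursive2 subn.
Proof.
apply: (rec2_swap (h := fun n m => m - n)).
apply: (@rec2_prec subn).
  by apply: (cml_var (k := 0)) => // i; rewrite subn0.
set xs := (X in lcomputable X _).
have v1 : lcomputable xs (fun j => j.1 - j.2) by exact: (cml_var (k := 1)).
have [e He] := cml_rec1 rec1_pred v1.
by exists e => i; rewrite subnS.
Qed.

Definition ifz (c a b : nat) := if c is 0 then a else b.

Lemma rec3_ifz : recursive3 ifz.
Proof.
have [||e He] := @cml_prec (nat * nat) (fun p => [:: p.1; p.2])
  (fun p c => ifz c p.1 p.2).
- exact: (cml_var (k := 0)).
- exact: (cml_var (k := 3)).
by exists e => c a b; apply: (He ((a, b), c)).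
Qed.

(** Zero exactly on the diagonal, so that [ifz] can test for equality. *)
Definition neqn (a b : nat) := (a - b) + (b - a).

Lemma rec2_neqn : recursive2 neqn.
Proof.
have v0 : lcomputable (fun p : nat * nat => [:: p.1; p.2]) fst
  by exact: (cml_var (k := 0)).
have v1 : lcomputable (fun p : nat * nat => [:: p.1; p.2]) snd
  by exact: (cml_var (k := 1)).
apply: rec2_cml; apply: (cml_rec2 rec2_add); exact: cml_rec2 rec2_sub _ _.
Qed.

Lemma ifz_neqn a b x y : ifz (neqn a b) x y = if a == b then x else y.
Proof.
by case: eqP => [->|ne]; rewrite /neqn ?subnn // /ifz; case E: (_ + _) => //;
  lia.
Qed.

Lemma rec2_mod : recursive2 modn.
Proof.
apply: (@rec2_prec (fun d n => n %% d)).
  by have [e He] := cml_zero (fun n : nat => [:: n]); exists e => i;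
    rewrite mod0n.
set xs := (X in lcomputable X _).
have v1 : lcomputable xs (fun j => j.2 %% j.1) by exact: (cml_var (k := 1)).
have v2 : lcomputable xs fst by exact: (cml_var (k := 2)).
have s1 := cml_rec1 rec1_succ v1.
have [e He] := cml_rec3 rec3_ifz (cml_rec2 rec2_neqn s1 v2) (cml_zero xs) s1.
exists e => -[d n] /=; have := He (d, n); rewrite ifz_neqn /=.
suff -> : (if (n %% d).+1 == d then 0 else (n %% d).+1) = n.+1 %% d by [].
case: d {He} => [|d]; first by rewrite !modn0.
rewrite modnS; have := ltn_pmod n (ltn0Sn d); have := divn_eq n d.+1.
set r := n %% d.+1; set k := n %/ d.+1 => En Lr.
have -> : (d.+1 %| n.+1) = (r.+1 == d.+1) => //.
rewrite En -addnS /dvdn modnMDl.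
case: (eqVneq r.+1 d.+1) => [->|ne]; first by rewrite modnn.
by rewrite modn_small //; lia.
Qed.

(** The exponent counts the k < n such that p^(k+1) divides n.  This is a
    bounded sum, and it is right at 0 as well, where a search would not end. *)
Lemma rec1_logn p : prime p -> recursive1 (logn p).
Proof.
move=> pp.
have H : recursive2 (fun m n => \sum_(0 <= k < m) (p ^ k.+1 %| n)).
  apply: (@rec2_prec (fun n m => \sum_(0 <= k < m) (p ^ k.+1 %| n))).
    have [e He] := cml_zero (fun n : nat => [:: n]).
    by exists e => i; rewrite big_geq.
  set xs := (X in lcomputable X _).
  have v0 : lcomputable xs snd by exact: (cml_var (k := 0)).
  have v1 : lcomputable xs (fun j => \sum_(0 <= k < j.2) (p ^ k.+1 %| j.1)).
    exact: (cml_var (k := 1)).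
  have v2 : lcomputable xs fst by exact: (cml_var (k := 2)).
  have m := cml_rec2 rec2_mod v2
    (cml_rec2 rec2_exp (cml_const xs p) (cml_rec1 rec1_succ v0)).
  have [e He] := cml_rec2 rec2_add v1
    (cml_rec3 rec3_ifz m (cml_const xs 1) (cml_const xs 0)).
  exists e => j; rewrite big_nat_recr //=; have := He j.
  by rewrite /dvdn; case: (_ %% _).
apply: rec1_cml.
have v0 : lcomputable (fun a : nat => [:: a]) id by exact: (cml_var (k := 0)).
have [e He] := cml_rec2 H (cml_rec1 rec1_pred v0) v0.
exists e => -[|n]; have := He _; first by move=> /(_ 0); rewrite big_geq ?logn0.
by move=> /(_ n.+1); rewrite /= logn_count_dvd // big_add1.
Qed.

Lemma rec1_expo0 : recursive1 expo0. Proof. exact: rec1_logn. Qed.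
Lemma rec1_expo1 : recursive1 expo1. Proof. exact: rec1_logn. Qed.
Lemma rec1_expo2 : recursive1 expo2. Proof. exact: rec1_logn. Qed.

Lemma rec2_pair : recursive2 pair.
Proof.
have v0 : lcomputable (fun p : nat * nat => [:: p.1; p.2]) fst
  by exact: (cml_var (k := 0)).
have v1 : lcomputable (fun p : nat * nat => [:: p.1; p.2]) snd
  by exact: (cml_var (k := 1)).
apply: rec2_cml; apply: (cml_rec2 rec2_mul);
  exact: cml_rec2 rec2_exp (cml_const _ _) _.
Qed.

Lemma rec3_mk : recursive3 mk.
Proof.
pose xs (p : nat * nat * nat) := [:: p.1.1; p.1.2; p.2].
have v0 : lcomputable xs (fun p => p.1.1) by exact: (cml_var (k := 0)).
have v1 : lcomputable xs (fun p => p.1.2) by exact: (cml_var (k := 1)).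
have v2 : lcomputable xs (fun p => p.2) by exact: (cml_var (k := 2)).
have [e He] := cml_rec2 rec2_mul
  (cml_rec2 rec2_mul (cml_rec2 rec2_exp (cml_const _ 2) v0)
  (cml_rec2 rec2_exp (cml_const _ 3) v1))
    (cml_rec2 rec2_exp (cml_const _ 5) v2).
by exists e => a b c; apply: (He (a, b, c)).
Qed.

(** * Uniformly solvable problems *)

(* These powers are far too large to be evaluated in unary notation. *)
Opaque pair mk.

(** One program solves the problem [P] for every instance [i] that satisfies
    [D], given only the number [d i].  Instances may contain data that no
    program can read, such as an interpretation, and the solution is uniform in
    these. *)
Definition solvable (I : Type) (D : I -> Prop) (d : I -> nat)
  (P : I -> nat -> Prop) :=
  exists e, forall i, D i -> exists b, kleene e (d i) b /\ P i b.

Definition computable (I : Type) (D : I -> Prop) (d : I -> nat)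
  (F : I -> nat) :=
  exists e, forall i, D i -> kleene e (d i) (F i).

(** The instances of a problem under a further hypothesis, as in the proof of
    an implication or of a universal statement: an instance gains a number that
    satisfies [X], and [dex] adds it to the data. *)
Definition ext I (D : I -> Prop) (X : I -> nat -> Prop) (j : I * nat) :=
  D j.1 /\ X j.1 j.2.
Definition dex I (d : I -> nat) (j : I * nat) := pair j.2 (d j.1).

Section Uniform.

Variables (I : Type) (D : I -> Prop) (d : I -> nat).

Lemma cmp_id : computable D d d.
Proof.
have [e He] : lcomputable (fun a : nat => [:: a]) id
  by exact: (cml_var (k := 0)).
by exists e => i _; apply: He.
Qed.

Lemma cmp_const n : computable D d (fun=> n).
Proof. by have [e He] := cml_const (fun i => [:: d i]) n; exists e => i _;
  apply: He. Qed.

Let xs (j : {i | D i}) := [:: d (sval j)].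

Lemma cmp_cml F : computable D d F <-> lcomputable xs (fun j => F (sval j)).
Proof.
split=> -[e He]; exists e; first by move=> [i Hi]; apply: He.
by move=> i Hi; apply: (He (exist _ i Hi)).
Qed.

Lemma cmp_rec1 h F : recursive1 h -> computable D d F ->
  computable D d (fun i => h (F i)).
Proof. by move=> H /cmp_cml HF; apply/cmp_cml; apply: cml_rec1. Qed.

Lemma cmp_rec2 h F G : recursive2 h -> computable D d F -> computable D d G ->
  computable D d (fun i => h (F i) (G i)).
Proof. by move=> H /cmp_cml HF /cmp_cml HG; apply/cmp_cml; apply: cml_rec2. Qed.

Lemma cmp_rec3 h F G H : recursive3 h -> computable D d F -> computable D d G ->
  computable D d H ->
  computable D d (fun i => h (F i) (G i) (H i)).
Proof.
by move=> h3 /cmp_cml HF /cmp_cml HG /cmp_cml HH; apply/cmp_cml;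
  apply: cml_rec3.
Qed.

Lemma cmp_pair F G : computable D d F -> computable D d G ->
  computable D d (fun i => pair (F i) (G i)).
Proof. exact: cmp_rec2 rec2_pair. Qed.
Lemma cmp_expo0 F : computable D d F -> computable D d (fun i => expo0 (F i)).
Proof. exact: cmp_rec1 rec1_expo0. Qed.
Lemma cmp_expo1 F : computable D d F -> computable D d (fun i => expo1 (F i)).
Proof. exact: cmp_rec1 rec1_expo1. Qed.
Lemma cmp_expo2 F : computable D d F -> computable D d (fun i => expo2 (F i)).
Proof. exact: cmp_rec1 rec1_expo2. Qed.
Lemma cmp_succ F : computable D d F -> computable D d (fun i => (F i).+1).
Proof. exact: cmp_rec1 rec1_succ. Qed.
Lemma cmp_pred F : computable D d F -> computable D d (fun i => (F i).-1).
Proof. exact: cmp_rec1 rec1_pred. Qed.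
Lemma cmp_ifz F G H : computable D d F -> computable D d G ->
  computable D d H ->
  computable D d (fun i => ifz (F i) (G i) (H i)).
Proof. exact: cmp_rec3 rec3_ifz. Qed.

Lemma cmp_sol F (P : I -> nat -> Prop) :
  computable D d F -> (forall i, D i -> P i (F i)) -> solvable D d P.
Proof. by move=> [e He] H; exists e => i Hi; exists (F i); split; auto. Qed.

(** Naming the solutions: a function of the instance can be used in the
    statement of later problems. *)
Lemma sol_cmp (P : I -> nat -> Prop) : solvable D d P ->
  exists F, computable D d F /\ forall i, D i -> P i (F i).
Proof.
move=> [e He].
have [F HF] : exists F : I -> nat, forall i, D i -> kleene e (d i) (F i) /\
  P i (F i).
  exists (fun i => epsilon (inhabits 0)
    (fun b => kleene e (d i) b /\ P i b)) => i Hi.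
  exact: (epsilon_spec (inhabits 0) (fun b => kleene e (d i) b /\ P i b)
    (He i Hi)).
by exists F; split; [exists e|] => i /HF [].
Qed.

Lemma sol_imp (P R : I -> nat -> Prop) :
  solvable D d P -> (forall i b, D i -> P i b -> R i b) -> solvable D d R.
Proof. by move=> /sol_cmp [F [HF HP]] H; apply: (cmp_sol HF) => i Hi; auto. Qed.

(** Primitive recursion: any solution of the problem at [n] must lead to one at
    [n + 1]. *)
Lemma sol_nat (P : I -> nat -> nat -> Prop) N :
  solvable D d (P^~ 0) ->
  solvable (fun j : I * nat * nat => D j.1.1 /\ P j.1.1 j.1.2 j.2)
    (fun j => pair j.2 (pair j.1.2 (d j.1.1))) (fun j => P j.1.1 j.1.2.+1) ->
  computable D d N -> solvable D d (fun i => P i (N i)).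
Proof.
move=> [e0 H0] [e1 H1] [eN HN].
pose ys (j : I * nat * nat) := [:: j.1.2; j.2; d j.1.1].
have v0 : lcomputable ys (fun j => j.1.2) by exact: (cml_var (k := 0)).
have v1 : lcomputable ys (fun j => j.2) by exact: (cml_var (k := 1)).
have v2 : lcomputable ys (fun j => d j.1.1) by exact: (cml_var (k := 2)).
have [c Hc] := cmls_cons (cml_rec2 rec2_pair v1 (cml_rec2 rec2_pair v0 v2))
  (cmls_nil ys).
pose zs (i : {i | D i}) := [:: d (sval i)].
have [c' Hc'] : lcomputables zs (fun i => [:: N (sval i); d (sval i)]).
  apply: cmls_cons; first by exists eN => -[i Hi]; apply: HN.
  apply: cmls_cons; last exact: cmls_nil.
  exact: (cml_var (k := 0)).
pose p := mk 4 e0 (mk 3 e1 c).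
exists (mk 3 p c') => i Hi.
suff [b [Hb HP]] : exists b, keval p [:: N i; d i] b /\ P i (N i) b.
  exists b; split=> //; apply: (@keval_comp _ _ [:: N i; d i]);
    rewrite ?expE //.
  exact: Hc' (exist _ i Hi).
elim: (N i) => [|n [b [Hb HP]]].
  have [b [Hb HP]] := H0 i Hi; exists b; split=> //.
  by apply: keval_prec0; rewrite expE.
have [b' [Hb' HP']] := H1 (i, n, b) (conj Hi HP).
exists b'; split=> //; apply: (keval_precS _ Hb); rewrite expE //.
apply: (@keval_comp _ _ [:: pair b (pair n (d i))]); rewrite ?expE //.
exact: Hc (i, n, b).
Qed.

End Uniform.

Lemma kleene_comp e I (D : I -> Prop) d F : computable D d F ->
  exists h, forall i b, D i -> kleene e (F i) b -> kleene h (d i) b.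
Proof.
move=> [eF HF].
have [c Hc] : lcomputables (fun i : {i | D i} => [:: d (sval i)])
  (fun i => [:: F (sval i)]).
  apply: cmls_cons; last exact: cmls_nil.
  by exists eF => -[i Hi]; apply: HF.
exists (mk 3 e c) => i b Hi Hb.
apply: (@keval_comp _ _ [:: F i]); rewrite ?expE //.
exact: Hc (exist _ i Hi).
Qed.

(** Substitution: an instance over [I] can be read as the instance [phi i] over
    [J], provided that the data of the latter are computable. *)
Lemma sol_pull I J (D : I -> Prop) d (D' : J -> Prop) d' P (phi : I -> J) :
  computable D d (fun i => d' (phi i)) -> (forall i, D i -> D' (phi i)) ->
  solvable D' d' P -> solvable D d (fun i => P (phi i)).
Proof.
move=> Hphi HD [e He]; have [h Hh] := kleene_comp e Hphi.
by exists h => i Hi; have [b [Hb HP]] := He _ (HD _ Hi); exists b; auto.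
Qed.

Lemma cmp_solE I (D : I -> Prop) d F : computable D d F <->
  solvable D d (fun i b => b = F i).
Proof.
split=> [HF|[e He]]; first by apply: (cmp_sol HF).
by exists e => i /He [b [Hb <-]].
Qed.

Lemma cmp_pull I J (D : I -> Prop) d (D' : J -> Prop) d' F (phi : I -> J) :
  computable D d (fun i => d' (phi i)) -> (forall i, D i -> D' (phi i)) ->
  computable D' d' F -> computable D d (fun i => F (phi i)).
Proof. by move=> Hd HD /cmp_solE HF; apply/cmp_solE;
  apply: sol_pull Hd HD HF. Qed.

Lemma sol_sub I (D D' : I -> Prop) d P :
  (forall i, D' i -> D i) -> solvable D d P -> solvable D' d P.
Proof. by move=> H [e He]; exists e => i /H /He. Qed.

Lemma cmp_sub I (D D' : I -> Prop) d F :
  (forall i, D' i -> D i) -> computable D d F -> computable D' d F.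
Proof. by move=> H [e He]; exists e => i /H /He. Qed.

Lemma cmp_iter I (D : I -> Prop) d h N F :
  recursive1 h -> computable D d N -> computable D d F ->
    computable D d (fun i => iter (N i) h (F i)).
Proof.
move=> H HN HF; apply/cmp_solE.
apply: (sol_nat (P := fun i n b => b = iter n h (F i)) _ _ HN).
  by apply: (cmp_sol HF).
apply: (cmp_sol (F := fun j => h j.2)); last by move=> j [_ ->].
apply: cmp_rec1 H _.
set D' := (X in computable X _ _); set d' := (X in computable _ X _).
by have [e He] := cmp_expo0 (cmp_id D' d'); exists e => j /He; rewrite expE.
Qed.

Section Extension.

Variables (I : Type) (D : I -> Prop) (d : I -> nat) (X : I -> nat -> Prop).

Lemma cmp_snd : computable (ext D X) (dex d) snd.
Proof.
have [e He] := cmp_expo0 (cmp_id (ext D X) (dex d)).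
by exists e => j /He; rewrite /dex expE.
Qed.

Lemma cmp_dfst : computable (ext D X) (dex d) (fun j => d j.1).
Proof.
have [e He] := cmp_expo1 (cmp_id (ext D X) (dex d)).
by exists e => j /He; rewrite /dex expE.
Qed.

Lemma cmp_ext F : computable D d F ->
  computable (ext D X) (dex d) (fun j => F j.1).
Proof. by apply: cmp_pull cmp_dfst _ => j []. Qed.

Lemma sol_ext P : solvable D d P -> solvable (ext D X) (dex d) (fun j => P j.1).
Proof. by apply: sol_pull cmp_dfst _ => j []. Qed.

End Extension.

Fixpoint constcode (n : nat) :=
  if n is n'.+1 then mk 3 (mk 1 0 0) (pair (constcode n') 0) else mk 0 0 0.

Lemma constcodeP n xs : keval (constcode n) xs n.
Proof.
elim: n => [|n IH] /=; first by apply: keval_zero; rewrite expE.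
apply: (@keval_comp _ _ [:: n]); rewrite ?expE //.
  by constructor; rewrite ?pair_gt0 // expE //; constructor.
by apply: keval_succ; rewrite expE.
Qed.

Lemma cmp_constcode I (D : I -> Prop) d N :
  computable D d N -> computable D d (fun i => constcode (N i)).
Proof.
move=> HN; apply/cmp_solE.
apply: (sol_nat (P := fun i n b => b = constcode n) _ _ HN).
  by apply: (cmp_sol (cmp_const _ _ (constcode 0))).
set D' := (X in solvable X _ _); set d' := (X in solvable _ X _).
have [e He] := cmp_expo0 (cmp_id D' d').
have H2 : computable D' d' (fun j => j.2) by exists e => j /He; rewrite expE.
apply: (cmp_sol (F := fun j => mk 3 (mk 1 0 0) (pair j.2 0)));
  last by move=> j [_ ->].
apply: (cmp_rec3 rec3_mk); [exact: cmp_const | exact: cmp_const |].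
by apply: cmp_pair => //; apply: cmp_const.
Qed.

(** The s-m-n theorem: [s e x] is a code of the section at [x] of the function
    of pairs with code [e]. *)
Lemma section_code : exists s : nat -> nat -> nat,
  (forall I (D : I -> Prop) d E X,
     computable D d E -> computable D d X ->
       computable D d (fun i => s (E i) (X i))) /\
  (forall e x a b, kleene e (pair a x) b -> kleene (s e x) a b).
Proof.
have [p Hp] := rec2_pair; pose v := mk 2 0 0.
exists (fun e x => mk 3 e (pair (mk 3 p (pair v (pair (constcode x) 0))) 0)).
split=> [I D d E X HE HX|e x a b H].
  apply: (cmp_rec3 rec3_mk); [exact: cmp_const | exact: HE |].
  apply: cmp_pair; last exact: cmp_const.
  apply: (cmp_rec3 rec3_mk); [exact: cmp_const | exact: cmp_const |].
  apply: cmp_pair; first exact: cmp_const.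
  by apply: cmp_pair; [exact: cmp_constcode | exact: cmp_const].
apply: (@keval_comp _ _ [:: pair a x]); rewrite ?expE //.
constructor; rewrite ?pair_gt0 // expE; last by constructor.
apply: (@keval_comp _ _ [:: a; x]); rewrite ?expE //.
constructor; rewrite ?pair_gt0 // expE.
  rewrite -[a in X in keval _ _ X]/(nth 0 [:: a] 0) -(expo1_mk 2 0 0).
  by apply: keval_proj; rewrite expE.
constructor; rewrite ?pair_gt0 // expE; last by constructor.
exact: constcodeP.
Qed.

Lemma sol_lam I (D : I -> Prop) d X (P : I * nat -> nat -> Prop) :
  solvable (ext D X) (dex d) P ->
  solvable D d (fun i b => forall a, X i a -> exists c, kleene b a c /\
    P (i, a) c).
Proof.
move=> [e He]; have [s [Hs sP]] := section_code.
apply: (cmp_sol (F := fun i => s e (d i))).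
  by apply: Hs; [apply: cmp_const | apply: cmp_id].
move=> i Hi a Ha; have [c [Hc HP]] := He (i, a) (conj Hi Ha).
by exists c; split=> //; apply: sP.
Qed.

(** The recursion theorem, for a program that may call itself on instances of
    smaller measure.  The measure [m] only serves to prove termination and does
    not have to be computable.  For the code [h] of the function that maps
    [pair x t] to {e0}(pair (s t t) x), the code [s h h] calls itself. *)
Lemma sol_fix I (D : I -> Prop) d (m : I -> nat) (P : I -> nat -> Prop) :
  solvable (ext D (fun i r => forall j, D j -> m j < m i ->
         exists b, kleene r (d j) b /\ P j b)) (dex d) (fun j => P j.1) ->
  solvable D d P.
Proof.
move=> [e0 He0]; have [s [Hs sP]] := section_code.
have [h Hh] : exists h, forall (j : nat * nat) b, True ->
    kleene e0 (pair (s j.2 j.2) j.1) b -> kleene h (pair j.1 j.2) b.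
  apply: kleene_comp.
  have id := cmp_id (fun j : nat * nat => True) (fun j => pair j.1 j.2).
  have [e1 H1] := cmp_expo0 id; have [e2 H2] := cmp_expo1 id.
  apply: cmp_pair; last by exists e1 => j T; have := H1 j T; rewrite expE.
  by apply: Hs; exists e2 => j T; have := H2 j T; rewrite expE.
exists (s h h) => i; have [n] := ubnP (m i); elim: n i => // n IH i Hm Hi.
have [|b [Hb HP]] := He0 (i, s h h).
  by split=> //= j Hj Hji; apply: IH => //; apply: leq_trans Hji _.
by exists b; split=> //; apply: sP; apply: (Hh (d i, h)).
Qed.

(** * A universal program *)

(** The states of a stack machine that evaluates programs are [quad m a b k].
    The mode [m] is 0 for evaluating the program [a] on the coded list [b], 1
    for evaluating the coded list [a] of programs on [b], and 2 for returning
    the value [a]; [k] is the stack.  Its frames are again quadruples, whose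
    tag tells what remains to be done with the value returned: to apply a
    program to it (0), to continue a primitive recursion (1) or a minimization
    (2), to evaluate the rest of a list of programs (3), to put a value in
    front of it (4). *)
Definition quad a b c k := pair a (pair b (pair c k)).
Definition q0 s := expo0 s.
Definition q1 s := expo0 (expo1 s).
Definition q2 s := expo0 (expo1 (expo1 s)).
Definition q3 s := expo1 (expo1 (expo1 s)).

Definition seqcode (xs : seq nat) := foldr pair 0 xs.

Definition ret_state v k := quad 2 v 0 k.

Definition eval_step e xs k :=
  let t := expo0 e in
  ifz t (ret_state 0 k)
  (ifz t.-1 (ret_state (expo0 xs).+1 k)
  (ifz t.-2 (ret_state (expo0 (iter (expo1 e) expo1 xs)) k)
  (ifz t.-2.-1 (quad 1 (expo2 e) xs (pair (quad 0 (expo1 e) 0 0) k))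
  (ifz t.-2.-2
    (ifz (expo0 xs) (quad 0 (expo1 e) (expo1 xs) k)
      (quad 0 e (pair (expo0 xs).-1 (expo1 xs))
        (pair (quad 1 e (expo0 xs).-1 (expo1 xs)) k)))
    (quad 0 (expo1 e) (pair 0 xs) (pair (quad 2 e 0 xs) k)))))).

Definition evals_step c xs k :=
  ifz c (ret_state 0 k) (quad 0 (expo0 c) xs (pair (quad 3 c xs 0) k)).

Definition ret_step v k :=
  let f := expo0 k in
  let t := q0 f in let x := q1 f in let y := q2 f in let z := q3 f in
  let k' := expo1 k in
  ifz k (ret_state v k)
  (ifz t (quad 0 x v k')
  (ifz t.-1 (quad 0 (expo2 x) (pair y (pair v z)) k')
  (ifz t.-2
    (ifz v (ret_state y k')
      (quad 0 (expo1 x) (pair y.+1 z) (pair (quad 2 x y.+1 z) k')))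
  (ifz t.-2.-1 (quad 1 (expo1 x) y (pair (quad 4 v 0 0) k'))
    (ret_state (pair x v) k'))))).

Definition mstep s :=
  ifz (q0 s) (eval_step (q1 s) (q2 s) (q3 s))
  (ifz (q0 s).-1 (evals_step (q1 s) (q2 s) (q3 s)) (ret_step (q1 s) (q3 s))).

Ltac cmp_auto := repeat first
  [ assumption | exact: cmp_const | exact: cmp_id | apply: cmp_ifz
  | apply: cmp_pair | apply: cmp_expo0 | apply: cmp_expo1 | apply: cmp_expo2
  | apply: cmp_succ | apply: cmp_pred | apply: (cmp_iter rec1_expo1) ].

Lemma rec1_mstep : recursive1 mstep.
Proof.
have [e He] : computable (fun _ => True) id mstep.
  rewrite /mstep /eval_step /evals_step /ret_step /ret_state /quad /q0 /q1 /q2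
    /q3.
  by cmp_auto.
by exists e => a; apply: He.
Qed.

Lemma q0_quad a b c k : q0 (quad a b c k) = a.
Proof. by rewrite /q0 /quad !expE. Qed.
Lemma q1_quad a b c k : q1 (quad a b c k) = b.
Proof. by rewrite /q1 /quad !expE. Qed.
Lemma q2_quad a b c k : q2 (quad a b c k) = c.
Proof. by rewrite /q2 /quad !expE. Qed.
Lemma q3_quad a b c k : q3 (quad a b c k) = k.
Proof. by rewrite /q3 /quad !expE. Qed.
Definition quadE := (q0_quad, q1_quad, q2_quad, q3_quad).

Lemma mstep_eval e xs k : mstep (quad 0 e xs k) = eval_step e xs k.
Proof. by rewrite /mstep !quadE. Qed.
Lemma mstep_evals c xs k : mstep (quad 1 c xs k) = evals_step c xs k.
Proof. by rewrite /mstep !quadE. Qed.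
Lemma mstep_ret v k : mstep (ret_state v k) = ret_step v k.
Proof. by rewrite /mstep /ret_state !quadE. Qed.

Lemma ifzS n a b : 0 < n -> ifz n a b = b.
Proof. by case: n. Qed.

Lemma mpop_frame v t x y z k : ret_step v (pair (quad t x y z) k) =
  ifz t (quad 0 x v k)
  (ifz t.-1 (quad 0 (expo2 x) (pair y (pair v z)) k)
  (ifz t.-2
    (ifz v (ret_state y k)
      (quad 0 (expo1 x) (pair y.+1 z) (pair (quad 2 x y.+1 z) k)))
  (ifz t.-2.-1 (quad 1 (expo1 x) y (pair (quad 4 v 0 0) k))
    (ret_state (pair x v) k)))).
Proof. by rewrite /ret_step ifzS ?pair_gt0 // !expE !quadE. Qed.

Definition reach s s' := exists n, iter n mstep s = s'.

Lemma reach_refl s : reach s s. Proof. by exists 0. Qed.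
Lemma reach_trans s1 s2 s3 : reach s1 s2 -> reach s2 s3 -> reach s1 s3.
Proof. by move=> [n <-] [m <-]; exists (m + n); rewrite iterD. Qed.
Lemma reach_step s s' : reach (mstep s) s' -> reach s s'.
Proof. by move=> [n <-]; exists n.+1; rewrite iterSr. Qed.

Lemma nth_seqcode xs n : expo0 (iter n expo1 (seqcode xs)) = nth 0 xs n.
Proof.
have e0 : expo0 0 = 0 by rewrite /expo0 logn0.
have e1 : expo1 0 = 0 by rewrite /expo1 logn0.
elim: n xs => [|n IH] [|x xs]; rewrite ?iterSr /= ?expE ?e0 ?e1 //.
by rewrite (IH [::]) nth_nil.
Qed.

(** By induction on the evaluation, for all stacks at once: the machine
    simulates a subcomputation on top of the frames that wait for its value. *)
Lemma machine_correct e xs z : keval e xs z ->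
  forall k, reach (quad 0 e (seqcode xs) k) (ret_state z k).
Proof.
pose P e xs z & keval e xs z :=
  forall k, reach (quad 0 e (seqcode xs) k) (ret_state z k).
pose Ps c xs ys & kevals c xs ys :=
  forall k, reach (quad 1 c (seqcode xs) k) (ret_state (seqcode ys) k).
move: e xs z; apply: (keval_mut (P := P) (P0 := Ps)); rewrite /P /Ps.
- move=> e xs E k; apply: reach_step; rewrite mstep_eval /eval_step E.
  exact: reach_refl.
- move=> e x xs E k; apply: reach_step; rewrite mstep_eval /eval_step E /= expE.
  exact: reach_refl.
- move=> e xs E L k; apply: reach_step; rewrite mstep_eval /eval_step E /=.
  rewrite nth_seqcode; exact: reach_refl.
- move=> e xs ys z E _ IH1 _ IH2 k; apply: reach_step;
  rewrite mstep_eval /eval_step E /=.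
  apply: reach_trans (IH1 _) _; apply: reach_step;
    rewrite mstep_ret mpop_frame /=.
  exact: IH2.
- move=> e xs z E _ IH k; apply: reach_step;
  rewrite mstep_eval /eval_step E /= !expE.
  exact: IH.
- move=> e n xs y z E _ IH1 _ IH2 k; apply: reach_step;
  rewrite mstep_eval /eval_step E /= !expE /=.
  apply: reach_trans (IH1 _) _; apply: reach_step;
    rewrite mstep_ret mpop_frame /=.
  exact: IH2.
- move=> e xs z w E _ IH0 _ IH k; apply: reach_step;
  rewrite mstep_eval /eval_step E /=.
  (* The values of the argument are tried in increasing order up to [z]. *)
  suff H y : y <= z -> reach (quad 0 (expo1 e) (pair (z - y) (seqcode xs))
      (pair (quad 2 e (z - y) (seqcode xs)) k)) (ret_state z k).
    by have := H z (leqnn z); rewrite subnn.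
  elim: y => [_|y IHy Ly].
    rewrite subn0; apply: reach_trans (IH0 _) _; apply: reach_step.
    rewrite mstep_ret mpop_frame /=; exact: reach_refl.
  apply: reach_trans (IH (z - y.+1) _ _) _; first by lia.
  apply: reach_step; rewrite mstep_ret mpop_frame /=.
  have -> : (z - y.+1).+1 = z - y by lia.
  by apply: IHy; lia.
- move=> xs k; apply: reach_step; rewrite mstep_evals /evals_step /=;
  exact: reach_refl.
- move=> c xs y ys L _ IH1 _ IH2 k; apply: reach_step;
  rewrite mstep_evals /evals_step ifzS //.
  apply: reach_trans (IH1 _) _; apply: reach_step;
    rewrite mstep_ret mpop_frame /=.
  apply: reach_trans (IH2 _) _; apply: reach_step;
    rewrite mstep_ret mpop_frame /=.
  exact: reach_refl.
Qed.

(** The program searches for the number of steps after which the machine halts;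
    a halted machine no longer changes its value. *)
Lemma universal : exists u, forall e a z, kleene e a z -> kleene u (pair e a) z.
Proof.
pose s0 x := quad 0 (expo0 x) (pair (expo1 x) 0) 0.
pose s n x := iter n mstep (s0 x).
pose test n x := neqn (q0 (s n x)) 2 + q3 (s n x).
have Hs I (xs : I -> seq nat) N X : lcomputable xs N -> lcomputable xs X ->
    lcomputable xs (fun i => s (N i) (X i)).
  pose D (_ : nat * nat) := True; pose d (p : nat * nat) := pair p.1 p.2.
  have [e He] : computable D d (fun p => s p.1 p.2).
    have [e1 H1] := cmp_expo0 (cmp_id D d); have [e2 H2] :=
      cmp_expo1 (cmp_id D d).
    have d1 : computable D d fst by exists e1 => p T; have := H1 p T;
      rewrite expE.
    have d2 : computable D d snd by exists e2 => p T; have := H2 p T;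
      rewrite expE.
    by apply: (cmp_iter rec1_mstep) => //; rewrite /s0 /quad; cmp_auto.
  move=> HN HX; have [e' He'] := cml_rec2 rec2_pair HN HX.
  apply: (@cml_sub _ _ (fun i => [:: pair (N i) (X i)])).
    by apply: cmls_cons; [exists e' | exact: cmls_nil].
  by exists e => i; apply: (He (N i, X i)).
have [et Ht] : lcomputable (fun p : nat * nat => [:: p.1; p.2])
  (fun p => test p.1 p.2).
  have Hp : lcomputable (fun p : nat * nat => [:: p.1; p.2])
    (fun p => s p.1 p.2).
    by apply: Hs; [exact: (cml_var (k := 0)) | exact: (cml_var (k := 1))].
  apply: (cml_rec2 rec2_add); last by do 3!apply: (cml_rec1 rec1_expo1).
  by apply: (cml_rec2 rec2_neqn);
    [apply: (cml_rec1 rec1_expo0) | exact: cml_const].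
have [er Hr] : lcomputable (fun p : nat * nat => [:: p.1; p.2])
  (fun p => q1 (s p.1 p.2)).
  do 2!(apply: (cml_rec1 rec1_expo0) || apply: (cml_rec1 rec1_expo1)).
  by apply: Hs; [exact: (cml_var (k := 0)) | exact: (cml_var (k := 1))].
have [eN HN] : exists e, forall x n, test n x = 0 ->
    exists2 m, test m x = 0 & keval e [:: x] m.
  exists (mk 5 et 0) => x n H0.
  have ex : exists n, test n x == 0 by exists n; apply/eqP.
  case: (ex_minnP ex) => m /eqP Hm min; exists m => //.
  apply: (@keval_mu _ _ _ (fun y => (test y x).-1)); rewrite ?expE //.
    by rewrite -Hm; apply: (Ht (m, x)).
  move=> y Ly; rewrite prednK; first by apply: (Ht (y, x)).
  by rewrite lt0n; apply: contraTN Ly => /min; rewrite -leqNgt.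
have halt n S : q0 S = 2 -> q3 S = 0 -> q1 (iter n mstep S) = q1 S.
  elim: n S => // n IH S H2 H0; rewrite iterSr IH.
  - by rewrite /mstep H2 H0 /= /ret_state quadE.
  - by rewrite /mstep H2 H0 /= /ret_state quadE.
  - by rewrite /mstep H2 H0 /= /ret_state quadE.
have [c Hc] : exists c, forall x m, keval eN [:: x] m ->
  kevals c [:: x] [:: m; x].
  have [e0 H0] : lcomputable (fun a : nat => [:: a]) id
    by exact: (cml_var (k := 0)).
  exists (pair eN (pair e0 0)) => x m Hm.
  apply: kevals_cons; rewrite ?pair_gt0 ?expE //.
  apply: kevals_cons; rewrite ?pair_gt0 ?expE //; by [exact: H0 | constructor].
exists (mk 3 er c) => e a z H.
have [n Hn] : reach (s0 (pair e a)) (ret_state z 0).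
  by rewrite /s0 !expE; apply: (machine_correct H).
have [|m Hm Km] := HN (pair e a) n;
  first by rewrite /test /s Hn /ret_state !quadE.
apply: (@keval_comp _ _ [:: m; pair e a]); rewrite ?expE //; first exact: Hc.
suff <- : q1 (s m (pair e a)) = z by apply: (Hr (m, pair e a)).
rewrite -[LHS](halt n); [|by rewrite /test /neqn in Hm; lia..].
by rewrite /s -iterD addnC iterD Hn halt /ret_state ?quadE.
Qed.

(** * Rules for programs *)

Lemma sol_app I (D : I -> Prop) d X P A :
  solvable D d (fun i b => forall a, X i a -> exists c, kleene b a c /\ P i a c)
    ->
  computable D d A -> (forall i, D i -> X i (A i)) ->
    solvable D d (fun i => P i (A i)).
Proof.
move=> /sol_cmp [F [HF HP]] HA HX; have [u Hu] := universal.
have [h Hh] := kleene_comp u (cmp_pair HF HA).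
exists h => i Hi; have [c [Hc Pc]] := HP i Hi _ (HX i Hi).
by exists c; split=> //; apply: Hh => //; apply: Hu.
Qed.

(** The programs of both branches need not terminate everywhere, while the
    arguments of a composition are all evaluated.  So the case distinction
    selects a code, which is then run by the universal program. *)
Lemma sol_if I (D : I -> Prop) d P C : computable D d C ->
  solvable (fun i => D i /\ C i = 0) d P ->
    solvable (fun i => D i /\ C i <> 0) d P ->
  solvable D d P.
Proof.
move=> HC [e0 H0] [e1 H1]; have [u Hu] := universal.
have [h Hh] := kleene_comp u
  (cmp_pair (cmp_ifz HC (cmp_const _ _ e0) (cmp_const _ _ e1)) (cmp_id D d)).
exists h => i Hi; case E: (C i) => [|n].
  have [b [Hb Pb]] := H0 i (conj Hi E); exists b; split=> //.
  by apply: Hh => //; rewrite E; apply: Hu.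
have [|b [Hb Pb]] := H1 i; first by rewrite E.
by exists b; split=> //; apply: Hh => //; rewrite E; apply: Hu.
Qed.

Lemma sol_absurd I (D : I -> Prop) d P : (forall i, ~ D i) -> solvable D d P.
Proof. by move=> H; exists 0 => i /H. Qed.

Lemma sol_cases I (D : I -> Prop) d P X n : computable D d X ->
  (forall k, k < n -> solvable (fun i => D i /\ X i = k) d P) ->
  (forall i, D i -> X i < n) -> solvable D d P.
Proof.
elim: n D => [|n IH] D HX HP Hn; first by apply: sol_absurd => i /Hn.
have HC := cmp_rec2 rec2_neqn HX (cmp_const _ _ n).
apply: (sol_if HC).
  apply: sol_sub (HP n _) => // i [Hi Ei]; split=> //.
  by move: Ei; rewrite /neqn; lia.
apply: IH; first by apply: cmp_sub HX => i [].
  by move=> k Lk; apply: sol_sub (HP k _) => [i [[]]//|]; lia.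
by move=> i [/Hn Li]; rewrite /neqn; lia.
Qed.

(** A program that is run on the same data for all instances has the same value
    for all of them. *)
Lemma sol_const I (P : I -> nat -> Prop) :
  solvable (fun=> True) (fun=> 0) P -> exists b, forall i, P i b.
Proof.
move=> [e He].
case: (classic (inhabited I)) => [[i0]|H]; last by exists 0 => i; case: H.
have [b [Hb _]] := He i0 Logic.I; exists b => i.
by have [b' [Hb' Pb']] := He i Logic.I; rewrite -(keval_det Hb Hb').
Qed.

Lemma sol_some I (D : I -> Prop) d P b : (forall i, D i -> P i b) ->
  solvable D d P.
Proof. exact: cmp_sol (cmp_const _ _ b). Qed.

(** * Realizability over given meanings of the atoms *)

(** The meaning of the atoms.  Predicate constants and predicate variables are
    treated alike, so that one notion of realizability covers schemes
    ([sem_scheme]) and predicate formulas ([sem_predicate]). *)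
Record sem := Sem {
  sar : arsym -> seq nat -> nat -> Prop;
  spv : nat -> nat -> seq nat -> nat -> Prop
}.

(** Realizability over [J]; it differs from [realizes] in the atoms only. *)
Fixpoint rlz (J : sem) (v : nat -> nat) (p : form) (e : nat) : Prop :=
  match p with
  | Bot => False
  | Ar s t => sar J s (map v t) e
  | PV n i t => spv J n i (map v t) e
  | And p q => rlz J v p (expo0 e) /\ rlz J v q (expo1 e)
  | Or p q => expo0 e = 0 /\ rlz J v p (expo1 e) \/
              expo0 e = 1 /\ rlz J v q (expo1 e)
  | Imp p q => forall a, rlz J v p a -> exists b, kleene e a b /\ rlz J v q b
  | Neg p => forall a, rlz J v p a -> exists b, kleene e a b /\ False
  | All p => forall a, exists b, kleene e a b /\ rlz J (scons a v) p b
  | Ex p => rlz J (scons (expo0 e) v) p (expo1 e)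
  end.

Definition atrue (s : arsym) (l : seq nat) : Prop :=
  let a := nth 0 l in
  match s with
  | symZ => a 0 = 0
  | symE => a 0 = a 1
  | symS => (a 0).+1 = a 1
  | symA => a 0 + a 1 = a 2
  | symM => a 0 * a 1 = a 2
  end.

Definition pv_realizer (f : interpretation) n i (l : seq nat) e :=
  exists P (t : n.-tuple nat), [/\ f n i = Some P, val t = l & P t e].

Definition sem_scheme f :=
  Sem (fun s l e => e = 0 /\ atrue s l) (fun n i => pv_realizer f n i).
Definition sem_predicate f := Sem (fun s => pv_realizer f (arity s) (arindex s))
  (pv_realizer f).

Lemma patE f n i (t : n.-tuple nat) (v : nat -> nat) e :
  (if f n i is Some P then P (map_tuple v t) e else False) <->
  pv_realizer f n i (map v t) e.
Proof.
rewrite /pv_realizer; split.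
  by case E: (f n i) => [P|] // H; exists P, (map_tuple v t).
by move=> [P [t' [-> Et]]]; rewrite (_ : t' = map_tuple v t) //; apply: val_inj.
Qed.

Lemma iff_kleene e a (P R : nat -> Prop) : (forall b, P b <-> R b) ->
  (exists b, kleene e a b /\ P b) <-> (exists b, kleene e a b /\ R b).
Proof. by move=> H; split=> -[b [Hb /H]]; exists b. Qed.

Lemma rl_congr J J' p :
  (forall s l e, size l = arity s -> sar J s l e <-> sar J' s l e) ->
  (forall n i l e, (n, i) \in pvars p -> size l = n ->
     spv J n i l e <-> spv J' n i l e) ->
  forall v e, rlz J v p e <-> rlz J' v p e.
Proof.
move=> Har; elim: p => [|s t|n i t|p IHp q IHq|p IHp q IHq|p IHp q IHq|p IH|p
  IH|p IH] /= Hpv v e //.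
- by apply: Har; rewrite size_map size_tuple.
- by apply: Hpv; rewrite ?mem_head // size_map size_tuple.
- by rewrite IHp ?IHq // => n i l e' H; apply: Hpv; rewrite mem_cat H ?orbT.
- by rewrite IHp ?IHq // => n i l e' H; apply: Hpv; rewrite mem_cat H ?orbT.
- have Ip : forall v e, rlz J v p e <-> rlz J' v p e.
    by apply: IHp => n i l e' H; apply: Hpv; rewrite mem_cat H.
  have Iq : forall v e, rlz J v q e <-> rlz J' v q e.
    by apply: IHq => n i l e' H; apply: Hpv; rewrite mem_cat H orbT.
  by split=> H a /Ip /H; apply iff_kleene => b; rewrite Iq.
- by split=> H a /(IH Hpv) /H.
- by split=> H a; move: (H a); apply iff_kleene => b; rewrite IH.
- exact: IH.
Qed.

Lemma realizes_rl f v p e : realizes f v p e <-> rlz (sem_scheme f) v p e.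
Proof.
elim: p v e => [|s t|n i t|p IHp q IHq|p IHp q IHq|p IHp q IHq|p IH|p IH|p IH]
  /= v e //.
- exact: patE.
- by rewrite IHp IHq.
- by rewrite IHp IHq.
- by split=> H a /IHp /H; apply iff_kleene => b; rewrite IHq.
- by split=> H a /IH /H.
- by split=> H a; move: (H a); apply iff_kleene => b; rewrite IH.
Qed.

Lemma realizes_as_predicate f v p e :
  realizes f v (as_predicate p) e <-> rlz (sem_predicate f) v p e.
Proof.
elim: p v e => [|s t|n i t|p IHp q IHq|p IHp q IHq|p IHp q IHq|p IH|p IH|p IH]
  /= v e //.
- exact: patE.
- exact: patE.
- by rewrite IHp IHq.
- by rewrite IHp IHq.
- by split=> H a /IHp /H; apply iff_kleene => b; rewrite IHq.
- by split=> H a /IH /H.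
- by split=> H a; move: (H a); apply iff_kleene => b; rewrite IH.
Qed.

Lemma scons_ren (T : Type) (a : T) (v : nat -> T) r :
  (fun k => scons a v (scons 0 (succn \o r) k)) = scons a (fun k => v (r k)).
Proof. by apply: functional_extensionality => -[|k]. Qed.

(** Allows realizability of quantified formulas to be rewritten as an
    equation. *)
Lemma All_congr (F F' : nat -> nat -> Prop) : F = F' ->
  (fun e => forall a, exists b, kleene e a b /\ F a b) =
  (fun e => forall a, exists b, kleene e a b /\ F' a b).
Proof. by move->. Qed.

Lemma Ex_congr (F F' : nat -> nat -> Prop) : F = F' ->
  (fun e => F (expo0 e) (expo1 e)) = (fun e => F' (expo0 e) (expo1 e)).
Proof. by move->. Qed.

Lemma rl_ren J v r p : rlz J v (ren r p) = rlz J (fun k => v (r k)) p.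
Proof.
elim: p v r => [|s t|n i t|p IHp q IHq|p IHp q IHq|p IHp q IHq|p IH|p IH|p IH]
  /= v r //.
- by rewrite -map_comp.
- by rewrite -map_comp.
- by rewrite IHp IHq.
- by rewrite IHp IHq.
- by rewrite IHp IHq.
- by rewrite IH.
- apply: (@All_congr (fun a => rlz J (scons a v) _)
  (fun a => rlz J (scons a _) _)).
  by apply: functional_extensionality => a; rewrite IH scons_ren.
- apply: (@Ex_congr (fun a => rlz J (scons a v) _)
  (fun a => rlz J (scons a _) _)).
  by apply: functional_extensionality => a; rewrite IH scons_ren.
Qed.

Lemma rl_scoped J n v w p : scoped n p -> (forall k, k < n -> v k = w k) ->
  rlz J v p = rlz J w p.
Proof.
have S m x y : (forall k, k < m -> x k = y k) ->
    forall a k, k < m.+1 -> scons a x k = scons a y k :> nat.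
  by move=> H a [|k] //= /H.
elim: p n v w => [|s t|m i t|p IHp q IHq|p IHp q IHq|p IHp q IHq|p IH|p IH|p IH]
  /= n v w.
- by [].
- by move=> /allP Ht H; congr sar; apply/eq_in_map => k /Ht /H.
- by move=> /allP Ht H; congr spv; apply/eq_in_map => k /Ht /H.
- by move=> /andP [Hp Hq] H; rewrite (IHp _ _ _ Hp H) (IHq _ _ _ Hq H).
- by move=> /andP [Hp Hq] H; rewrite (IHp _ _ _ Hp H) (IHq _ _ _ Hq H).
- by move=> /andP [Hp Hq] H; rewrite (IHp _ _ _ Hp H) (IHq _ _ _ Hq H).
- by move=> Hp H; rewrite (IH _ _ _ Hp H).
- move=> Hp H.
  apply: (@All_congr (fun a => rlz J (scons a v) p)
    (fun a => rlz J (scons a w) p)).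
  apply: functional_extensionality => a.
  by apply: IH Hp _; apply: S.
- move=> Hp H.
  apply: (@Ex_congr (fun a => rlz J (scons a v) p)
    (fun a => rlz J (scons a w) p)).
  apply: functional_extensionality => a.
  by apply: IH Hp _; apply: S.
Qed.

Lemma sat_Ar v s (t : (arity s).-tuple nat) : sat v (Ar t) = atrue s (map v t).
Proof. by case: s t. Qed.

(** * The rules of intuitionistic logic *)

Section Rules.

Variables (I : Type) (D : I -> Prop) (d : I -> nat).
Implicit Types (J : I -> sem) (v : I -> nat -> nat) (p q : form).

Lemma sol_AndI J v p q : solvable D d (fun i => rlz (J i) (v i) p) ->
  solvable D d (fun i => rlz (J i) (v i) q) ->
    solvable D d (fun i => rlz (J i) (v i) (And p q)).
Proof.
move=> /sol_cmp [F [HF HP]] /sol_cmp [G [HG HQ]].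
by apply: (cmp_sol (cmp_pair HF HG)) => i Hi /=; rewrite !expE; auto.
Qed.

Lemma sol_AndE1 J v p q : solvable D d (fun i => rlz (J i) (v i) (And p q)) ->
  solvable D d (fun i => rlz (J i) (v i) p).
Proof.
by move=> /sol_cmp [F [HF HP]]; apply: (cmp_sol (cmp_expo0 HF)) => i /HP [].
Qed.

Lemma sol_AndE2 J v p q : solvable D d (fun i => rlz (J i) (v i) (And p q)) ->
  solvable D d (fun i => rlz (J i) (v i) q).
Proof.
by move=> /sol_cmp [F [HF HP]]; apply: (cmp_sol (cmp_expo1 HF)) => i /HP [].
Qed.

Lemma sol_OrI1 J v p q : solvable D d (fun i => rlz (J i) (v i) p) ->
  solvable D d (fun i => rlz (J i) (v i) (Or p q)).
Proof.
move=> /sol_cmp [F [HF HP]].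
apply: (cmp_sol (cmp_pair (cmp_const _ _ 0) HF)) => i Hi /=.
by rewrite !expE; left; auto.
Qed.

Lemma sol_OrI2 J v p q : solvable D d (fun i => rlz (J i) (v i) q) ->
  solvable D d (fun i => rlz (J i) (v i) (Or p q)).
Proof.
move=> /sol_cmp [F [HF HP]].
apply: (cmp_sol (cmp_pair (cmp_const _ _ 1) HF)) => i Hi /=.
by rewrite !expE; right; auto.
Qed.

(** Each case is treated on the subdomain of instances on which it occurs. *)
Lemma sol_OrE J v p q R : solvable D d (fun i => rlz (J i) (v i) (Or p q)) ->
  (forall D' : I -> Prop, (forall i, D' i -> D i) ->
     solvable D' d (fun i => rlz (J i) (v i) p) -> solvable D' d R) ->
  (forall D' : I -> Prop, (forall i, D' i -> D i) ->
     solvable D' d (fun i => rlz (J i) (v i) q) -> solvable D' d R) ->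
  solvable D d R.
Proof.
move=> /sol_cmp [F [HF HP]] Hp Hq.
have HC := cmp_expo1 HF.
apply: (sol_if (cmp_expo0 HF)).
  apply: Hp => [i []//|]; apply: (cmp_sol (cmp_sub _ HC)) => [i []//|i].
  by move=> [/HP [[]//|[-> _]]].
apply: Hq => [i []//|]; apply: (cmp_sol (cmp_sub _ HC)) => [i []//|i].
by move=> [/HP [[-> _]|[]//]].
Qed.

Lemma sol_ImpI J v p q :
  solvable (ext D (fun i => rlz (J i) (v i) p)) (dex d)
    (fun j => rlz (J j.1) (v j.1) q) ->
  solvable D d (fun i => rlz (J i) (v i) (Imp p q)).
Proof. by move=> /sol_lam H; apply: sol_imp H _. Qed.

Lemma sol_ImpE J v p q : solvable D d (fun i => rlz (J i) (v i) (Imp p q)) ->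
  solvable D d (fun i => rlz (J i) (v i) p) ->
    solvable D d (fun i => rlz (J i) (v i) q).
Proof.
move=> H /sol_cmp [F [HF HP]].
exact: (sol_app (X := fun i => rlz (J i) (v i) p)
  (P := fun i _ => rlz (J i) (v i) q)
  H HF HP).
Qed.

Lemma sol_NegI J v p : (forall i a, D i -> ~ rlz (J i) (v i) p a) ->
  solvable D d (fun i => rlz (J i) (v i) (Neg p)).
Proof. by move=> H; apply: (sol_some _ (b := 0)) => i Hi a /(H _ _ Hi). Qed.

Lemma sol_AllI J v p :
  solvable (ext D (fun _ _ => True)) (dex d)
    (fun j => rlz (J j.1) (scons j.2 (v j.1)) p) ->
  solvable D d (fun i => rlz (J i) (v i) (All p)).
Proof. by move=> /sol_lam H; apply: sol_imp H _ => i b _ H a; apply: H. Qed.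

Lemma sol_AllE J v p X : solvable D d (fun i => rlz (J i) (v i) (All p)) ->
  computable D d X -> solvable D d (fun i => rlz (J i) (scons (X i) (v i)) p).
Proof.
move=> H HX.
apply: (sol_app (X := fun _ _ => True)
  (P := fun i a => rlz (J i) (scons a (v i)) p) _ HX) => //.
by apply: sol_imp H _ => i b _ H a _; apply: H.
Qed.

Lemma sol_ExI J v p X : computable D d X ->
  solvable D d (fun i => rlz (J i) (scons (X i) (v i)) p) ->
  solvable D d (fun i => rlz (J i) (v i) (Ex p)).
Proof.
move=> HX /sol_cmp [F [HF HP]].
by apply: (cmp_sol (cmp_pair HX HF)) => i Hi /=; rewrite !expE; auto.
Qed.

Lemma sol_ExE J v p : solvable D d (fun i => rlz (J i) (v i) (Ex p)) ->
  exists X, computable D d X /\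
    solvable D d (fun i => rlz (J i) (scons (X i) (v i)) p).
Proof.
move=> /sol_cmp [F [HF HP]]; exists (fun i => expo0 (F i)); split.
  exact: cmp_expo0.
exact: (cmp_sol (cmp_expo1 HF)).
Qed.

Lemma sol_bigconj J v p ps q : List.In q (p :: ps) ->
  solvable D d (fun i => rlz (J i) (v i) (bigconj p ps)) ->
    solvable D d (fun i => rlz (J i) (v i) q).
Proof.
elim: ps p => [|p' ps IH] p /=; first by case=> // ->.
move=> H Hs; case: H => [<-|H]; first exact: sol_AndE1 Hs.
exact: IH H (sol_AndE2 Hs).
Qed.

Lemma sol_bigconjI J v p ps :
  (forall q, List.In q (p :: ps) -> solvable D d (fun i => rlz (J i) (v i) q))
    ->
  solvable D d (fun i => rlz (J i) (v i) (bigconj p ps)).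
Proof.
elim: ps p => [|p' ps IH] p /= H; first by apply: H; left.
apply: sol_AndI; first by apply: H; left.
by apply: IH => q Hq; apply: H; right.
Qed.

End Rules.

(** * The arithmetical premises *)

Definition arith : form := bigconj axA1 (behead basic_axioms).
Definition models (J : sem) (q : nat) := rlz J (fun=> 0) arith q.

Section Arithmetic.

Variables (I : Type) (D : I -> Prop) (d : I -> nat) (J : I -> sem)
  (q : I -> nat).
Hypothesis hq : computable D d q.
Hypothesis hJ : forall i, D i -> models (J i) (q i).

Notation sE X Y := (solvable D d (fun i => sar (J i) symE [:: X i; Y i])).
Notation sS X Y := (solvable D d (fun i => sar (J i) symS [:: X i; Y i])).
Notation sZ X := (solvable D d (fun i => sar (J i) symZ [:: X i])).
Notation sA X Y Z :=
  (solvable D d (fun i => sar (J i) symA [:: X i; Y i; Z i])).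
Notation sM X Y Z :=
  (solvable D d (fun i => sar (J i) symM [:: X i; Y i; Z i])).

Lemma basic_ax k : k < size basic_axioms ->
  solvable D d (fun i => rlz (J i) (fun=> 0) (nth Bot basic_axioms k)).
Proof.
move=> Hk; apply: (@sol_bigconj _ _ _ _ _ axA1 (behead basic_axioms)).
  move: Hk; rewrite -[axA1 :: _]/basic_axioms.
  elim: basic_axioms k => [|p ps IH] [|k] //= Hk; first by left.
  by right; apply: IH.
exact: cmp_sol hq hJ.
Qed.

Lemma inst2 v p X Y : solvable D d (fun i => rlz (J i) v (All (All p))) ->
  computable D d X -> computable D d Y ->
  solvable D d (fun i => rlz (J i) (scons (Y i) (scons (X i) v)) p).
Proof. by move=> H HX HY; apply: sol_AllE (sol_AllE H HX) HY. Qed.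

Lemma inst3 v p X Y Z : solvable D d (fun i => rlz (J i) v (All (All (All p))))
  ->
  computable D d X -> computable D d Y -> computable D d Z ->
  solvable D d (fun i => rlz (J i) (scons (Z i) (scons (Y i) (scons (X i) v)))
    p).
Proof. by move=> H HX HY HZ; apply: sol_AllE (inst2 H HX HY) HZ. Qed.

Lemma inst4 v p X Y Z U : solvable D d
  (fun i => rlz (J i) v (All (All (All (All p))))) ->
  computable D d X -> computable D d Y -> computable D d Z ->
    computable D d U ->
  solvable D d (fun i => rlz (J i)
    (scons (U i) (scons (Z i) (scons (Y i) (scons (X i) v)))) p).
Proof. by move=> H HX HY HZ HU; apply: sol_AllE (inst3 H HX HY HZ) HU. Qed.

Lemma inst5 v p X Y Z U V : solvable D d
  (fun i => rlz (J i) v (All (All (All (All (All p)))))) ->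
  computable D d X -> computable D d Y -> computable D d Z ->
    computable D d U -> computable D d V ->
  solvable D d (fun i => rlz (J i)
    (scons (V i) (scons (U i) (scons (Z i) (scons (Y i) (scons (X i) v))))) p).
Proof. by move=> H HX HY HZ HU HV;
  apply: sol_AllE (inst4 H HX HY HZ HU) HV. Qed.

Ltac use H := have := sol_ImpE H; apply; repeat apply: sol_AndI; assumption.

Section Computed.

Variables X Y Z U V : I -> nat.
Hypotheses (hX : computable D d X) (hY : computable D d Y)
  (hZ : computable D d Z) (hU : computable D d U)
  (hV : computable D d V).

Lemma succ_inj : sS X Z -> sS Y Z -> sE X Y.
Proof. by move=> H1 H2; use (inst3 (basic_ax (k := 0) erefl) hX hY hZ). Qed.

Lemma E_euclid : sE X Y -> sE X Z -> sE Y Z.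
Proof. by move=> H1 H2; use (inst3 (basic_ax (k := 2) erefl) hX hY hZ). Qed.

Lemma succ_congl : sE X Y -> sS X Z -> sS Y Z.
Proof. by move=> H1 H2; use (inst3 (basic_ax (k := 3) erefl) hX hY hZ). Qed.

Lemma add_zero : sZ Y -> sA X Y X.
Proof. by move=> H1; use (inst2 (basic_ax (k := 4) erefl) hX hY). Qed.

Lemma add_succ : sS Y Z -> sA X Y U -> sS U V -> sA X Z V.
Proof. by move=> H1 H2 H3; use (inst5 (basic_ax (k := 5) erefl) hX hY hZ hU hV).
  Qed.

Lemma mul_zero : sZ Y -> sM X Y Y.
Proof. by move=> H1; use (inst2 (basic_ax (k := 6) erefl) hX hY). Qed.

Lemma mul_succ : sS Y Z -> sM X Y U -> sA U X V -> sM X Z V.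
Proof. by move=> H1 H2 H3; use (inst5 (basic_ax (k := 7) erefl) hX hY hZ hU hV).
  Qed.

Lemma add_congl : sE X Y -> sA X Z U -> sA Y Z U.
Proof. by move=> H1 H2; use (inst4 (basic_ax (k := 8) erefl) hX hY hZ hU). Qed.

Lemma add_congr : sE Y Z -> sA X Y U -> sA X Z U.
Proof. by move=> H1 H2; use (inst4 (basic_ax (k := 9) erefl) hX hY hZ hU). Qed.

Lemma mul_congl : sE X Y -> sM X Z U -> sM Y Z U.
Proof. by move=> H1 H2; use (inst4 (basic_ax (k := 10) erefl) hX hY hZ hU). Qed.

Lemma mul_congr : sE Y Z -> sM X Y U -> sM X Z U.
Proof. by move=> H1 H2; use (inst4 (basic_ax (k := 11) erefl) hX hY hZ hU). Qed.

(** A realizer of this instance of A13 tells whether the element is zero and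
    provides a predecessor otherwise. *)
Lemma zero_or_succ v : solvable D d
  (fun i => rlz (J i) (scons (X i) v) (Or (fZ 0) (Ex (fS 0 1)))).
Proof. exact: (sol_AllE (basic_ax (k := 12) erefl) hX). Qed.

Lemma zero_unique : sZ X -> sZ Y -> sE X Y.
Proof. by move=> H1 H2; use (inst2 (basic_ax (k := 14) erefl) hX hY). Qed.

Lemma zero_congr : sE X Y -> sZ X -> sZ Y.
Proof. by move=> H1 H2; use (inst2 (basic_ax (k := 15) erefl) hX hY). Qed.

Lemma succ_functional : sS X Y -> sS X Z -> sE Y Z.
Proof. by move=> H1 H2; use (inst3 (basic_ax (k := 17) erefl) hX hY hZ). Qed.

Lemma succ_congr : sS X Y -> sE Y Z -> sS X Z.
Proof. by move=> H1 H2; use (inst3 (basic_ax (k := 18) erefl) hX hY hZ). Qed.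

Lemma add_functional : sA X Y Z -> sA X Y U -> sE Z U.
Proof. by move=> H1 H2; use (inst4 (basic_ax (k := 20) erefl) hX hY hZ hU). Qed.

Lemma add_congo : sA X Y Z -> sE Z U -> sA X Y U.
Proof. by move=> H1 H2; use (inst4 (basic_ax (k := 21) erefl) hX hY hZ hU). Qed.

Lemma mul_functional : sM X Y Z -> sM X Y U -> sE Z U.
Proof. by move=> H1 H2; use (inst4 (basic_ax (k := 23) erefl) hX hY hZ hU). Qed.

Lemma mul_congo : sM X Y Z -> sE Z U -> sM X Y U.
Proof. by move=> H1 H2; use (inst4 (basic_ax (k := 24) erefl) hX hY hZ hU). Qed.

Lemma succ_ex : exists W, computable D d W /\ sS X W.
Proof. exact: (sol_ExE (sol_AllE (basic_ax (k := 16) erefl) hX)). Qed.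

Lemma add_ex : exists W, computable D d W /\ sA X Y W.
Proof. exact: (sol_ExE (inst2 (basic_ax (k := 19) erefl) hX hY)). Qed.

End Computed.

Lemma zero_ex : exists W, computable D d W /\ sZ W.
Proof. exact: (sol_ExE (basic_ax (k := 13) erefl)). Qed.

Lemma E_refl X : computable D d X -> sE X X.
Proof.
move=> hX; have [W [hW H]] := succ_ex hX.
exact: (succ_inj hX hX hW H H).
Qed.

Lemma E_sym X Y : computable D d X -> computable D d Y -> sE X Y -> sE Y X.
Proof. by move=> hX hY H; apply: (E_euclid hX hY hX H (E_refl hX)). Qed.

Lemma E_trans X Y Z : computable D d X -> computable D d Y ->
  computable D d Z ->
  sE X Y -> sE Y Z -> sE X Z.
Proof.
by move=> hX hY hZ H1 H2; apply: (E_euclid hY hX hZ) => //; apply: E_sym.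
Qed.

End Arithmetic.

(** * Numerals *)

Notation ext0 D := (ext D (fun _ _ => True)).

Lemma sol_induction I (D : I -> Prop) d (P : I -> nat -> nat -> Prop) N :
  solvable D d (P^~ 0) ->
  solvable (ext (ext0 D) (fun j => P j.1 j.2)) (dex (dex d))
    (fun j => P j.1.1 j.1.2.+1) ->
  computable D d N -> solvable D d (fun i => P i (N i)).
Proof. by move=> H0 HS HN; apply: (sol_nat H0 _ HN);
  apply: sol_sub HS => j []. Qed.

(** For a single problem without data, uniformity is no restriction.  Thus
    facts about the mere existence of realizers, marked by the prefix T_,
    follow from uniform ones. *)
Lemma solT (P : nat -> Prop) :
  (exists e, P e) <-> solvable (fun _ : unit => True) (fun=> 0) (fun=> P).
Proof.
split=> [[e He]|]; first exact: (sol_some _ (b := e)).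
by move=> /sol_const [b Hb]; exists b; apply: Hb.
Qed.

(** A structure with a realizer of the arithmetical premises and an element. *)
Definition element_dom (k : sem * nat * nat) := models k.1.1 k.1.2.
Definition element_dat (k : sem * nat * nat) := pair k.2 k.1.2.

Lemma cmp_element_q : computable element_dom element_dat (fun k => k.1.2).
Proof.
have [e He] := cmp_expo1 (cmp_id element_dom element_dat).
by exists e => k /He; rewrite /element_dat !expE.
Qed.

Lemma cmp_element : computable element_dom element_dat (fun k => k.2).
Proof.
have [e He] := cmp_expo0 (cmp_id element_dom element_dat).
by exists e => k /He; rewrite /element_dat !expE.
Qed.

Lemma zero_exists : exists W, computable (fun k => models k.1 k.2) snd W /\
  solvable (fun k => models k.1 k.2) snd (fun k => sar k.1 symZ [:: W k]).
Proof. exact: (zero_ex (J := fst) (q := snd) (cmp_id _ _)). Qed.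

Lemma succ_exists : exists W, computable element_dom element_dat W /\
  solvable element_dom element_dat (fun k => sar k.1.1 symS [:: k.2; W k]).
Proof. exact: (succ_ex (J := fun k => k.1.1) cmp_element_q _ cmp_element). Qed.

Definition zero_of := proj1_sig
  (constructive_indefinite_description _ zero_exists).
Definition succ_of := proj1_sig
  (constructive_indefinite_description _ succ_exists).
Definition num (J : sem) (q n : nat) :=
  iter n (fun x => succ_of (J, q, x)) (zero_of (J, q)).

Section Numerals.

Variables (I : Type) (D : I -> Prop) (d : I -> nat) (J : I -> sem)
  (q : I -> nat).
Hypothesis hq : computable D d q.
Hypothesis hJ : forall i, D i -> models (J i) (q i).

Local Notation nm i n := (num (J i) (q i) n).

Lemma num_zero : solvable D d (fun i => sar (J i) symZ [:: nm i 0]).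
Proof.
have [_] := proj2_sig (constructive_indefinite_description _ zero_exists).
exact: (sol_pull (phi := fun i => (J i, q i)) hq hJ).
Qed.

Lemma succ_of_spec X : computable D d X ->
  computable D d (fun i => succ_of (J i, q i, X i)) /\
  solvable D d (fun i => sar (J i) symS [:: X i; succ_of (J i, q i, X i)]).
Proof.
move=> hX.
have [HF HP] := proj2_sig (constructive_indefinite_description _ succ_exists).
have hXq := cmp_pair hX hq.
split; first exact: (cmp_pull (phi := fun i => (J i, q i, X i)) hXq hJ HF).
exact: (sol_pull (phi := fun i => (J i, q i, X i)) hXq hJ HP).
Qed.

End Numerals.

Section NumeralFacts.

Variables (I : Type) (D : I -> Prop) (d : I -> nat) (J : I -> sem)
  (q : I -> nat).
Hypothesis hq : computable D d q.
Hypothesis hJ : forall i, D i -> models (J i) (q i).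

Local Notation nm i n := (num (J i) (q i) n).

Lemma cmp_num N : computable D d N -> computable D d (fun i => nm i (N i)).
Proof.
move=> HN; apply/cmp_solE.
apply: (sol_induction (P := fun i n b => b = nm i n) _ _ HN).
  have [HF _] := proj2_sig (constructive_indefinite_description _ zero_exists).
  by apply: (cmp_sol (cmp_pull (phi := fun i => (J i, q i)) hq hJ HF)).
set D' := ext _ _; set d' := dex _.
have hq' : computable D' d' (fun j => q j.1.1) := cmp_ext _ (cmp_ext _ hq).
have [|H _] := succ_of_spec (J := fun j => J j.1.1) hq' _ (cmp_snd _ _ _).
  by move=> j [[/hJ]].
by apply: (cmp_sol H) => j [_ /= ->].
Qed.

Lemma num_succ N : computable D d N ->
  solvable D d (fun i => sar (J i) symS [:: nm i (N i); nm i (N i).+1]).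
Proof. by move=> HN; have [] := succ_of_spec hq hJ (cmp_num HN). Qed.

End NumeralFacts.

Section NumeralOperations.

Variables (I : Type) (D : I -> Prop) (d : I -> nat) (J : I -> sem)
  (q : I -> nat).
Hypothesis hq : computable D d q.
Hypothesis hJ : forall i, D i -> models (J i) (q i).

Local Notation nm i n := (num (J i) (q i) n).

(** By recursion on the second summand, from A5 and A6. *)
Lemma num_add N M : computable D d N -> computable D d M ->
  solvable D d (fun i => sar (J i) symA
    [:: nm i (N i); nm i (M i); nm i (N i + M i)]).
Proof.
move=> HN HM.
apply: (sol_induction
  (P := fun i m => sar (J i) symA [:: nm i (N i); nm i m; nm i (N i + m)]) _ _
    HM).
  have E i : nm i (N i + 0) = nm i (N i) by rewrite addn0.
  apply: (sol_imp (P := fun i => sar (J i) symA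
    [:: nm i (N i); nm i 0; nm i (N i)])).
    by apply: (add_zero hq hJ);
      [apply: cmp_num | apply/cmp_num/cmp_const | apply: num_zero].
  by move=> i b _; rewrite E.
set D' := ext _ _; set d' := dex _.
have hq' : computable D' d' (fun j => q j.1.1) := cmp_ext _ (cmp_ext _ hq).
have hJ' j : D' j -> models (J j.1.1) (q j.1.1) by move=> [[/hJ]].
have hN : computable D' d' (fun j => N j.1.1) := cmp_ext _ (cmp_ext _ HN).
have hm : computable D' d' (fun j => j.1.2) := cmp_ext _ (cmp_snd _ _ _).
have hs : computable D' d' (fun j => N j.1.1 + j.1.2) by apply: cmp_rec2
  rec2_add _ _.
pose n' (j : I * nat * nat) k := num (J j.1.1) (q j.1.1) k.
have E i m : nm i (N i + m.+1) = nm i (N i + m).+1 by rewrite addnS.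
apply: (sol_imp (P := fun j => sar (J j.1.1) symA
  [:: n' j (N j.1.1); n' j (j.1.2.+1); n' j (N j.1.1 + j.1.2).+1])); last first.
  by move=> j b _; rewrite E.
apply: (add_succ hq' hJ' (Y := fun j => n' j j.1.2)
  (U := fun j => n' j (N j.1.1 + j.1.2))).
- exact: cmp_num.
- exact: cmp_num.
- by apply: (cmp_num hq' hJ' (N := fun j => j.1.2.+1)) => //; apply: cmp_succ.
- exact: cmp_num.
- by apply: (cmp_num hq' hJ' (N := fun j => (N j.1.1 + j.1.2).+1)) => //;
  apply: cmp_succ.
- exact: num_succ.
- by apply: (cmp_sol (cmp_snd _ _ _)) => j [].
- exact: num_succ.
Qed.

End NumeralOperations.

Section NumeralProducts.

Variables (I : Type) (D : I -> Prop) (d : I -> nat) (J : I -> sem)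
  (q : I -> nat).
Hypothesis hq : computable D d q.
Hypothesis hJ : forall i, D i -> models (J i) (q i).

Local Notation nm i n := (num (J i) (q i) n).

(** By recursion on the second factor, from A7 and A8. *)
Lemma num_mul N M : computable D d N -> computable D d M ->
  solvable D d (fun i => sar (J i) symM
    [:: nm i (N i); nm i (M i); nm i (N i * M i)]).
Proof.
move=> HN HM.
apply: (sol_induction
  (P := fun i m => sar (J i) symM [:: nm i (N i); nm i m; nm i (N i * m)]) _ _
    HM).
  have E i : nm i (N i * 0) = nm i 0 by rewrite muln0.
  apply: (sol_imp (P := fun i => sar (J i) symM
    [:: nm i (N i); nm i 0; nm i 0])).
    by apply: (mul_zero hq hJ);
      [apply: cmp_num | apply/cmp_num/cmp_const | apply: num_zero].
  by move=> i b _; rewrite E.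
set D' := ext _ _; set d' := dex _.
have hq' : computable D' d' (fun j => q j.1.1) := cmp_ext _ (cmp_ext _ hq).
have hJ' j : D' j -> models (J j.1.1) (q j.1.1) by move=> [[/hJ]].
have hN : computable D' d' (fun j => N j.1.1) := cmp_ext _ (cmp_ext _ HN).
have hm : computable D' d' (fun j => j.1.2) := cmp_ext _ (cmp_snd _ _ _).
have hs : computable D' d' (fun j => N j.1.1 * j.1.2) by apply: cmp_rec2
  rec2_mul _ _.
pose n' (j : I * nat * nat) k := num (J j.1.1) (q j.1.1) k.
have E i m : nm i (N i * m.+1) = nm i (N i * m + N i) by rewrite mulnSr.
apply: (sol_imp (P := fun j => sar (J j.1.1) symM
  [:: n' j (N j.1.1); n' j (j.1.2.+1); n' j (N j.1.1 * j.1.2 + N j.1.1)]));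
    last first.
  by move=> j b _; rewrite E.
apply: (mul_succ hq' hJ' (Y := fun j => n' j j.1.2)
  (U := fun j => n' j (N j.1.1 * j.1.2))).
- exact: cmp_num.
- exact: cmp_num.
- by apply: (cmp_num hq' hJ' (N := fun j => j.1.2.+1)) => //; apply: cmp_succ.
- exact: cmp_num.
- apply: (cmp_num hq' hJ' (N := fun j => N j.1.1 * j.1.2 + N j.1.1)) => //.
  exact: cmp_rec2 rec2_add hs hN.
- exact: num_succ.
- by apply: (cmp_sol (cmp_snd _ _ _)) => j [].
- exact: (num_add hq' hJ' hs hN).
Qed.

End NumeralProducts.

(** * Facts about the existence of realizers *)

Section Truth.

Variables (J : sem) (q : nat).
Hypothesis hJ : models J q.

Local Notation TZ x := (exists e, sar J symZ [:: x] e).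
Local Notation TE x y := (exists e, sar J symE [:: x; y] e).
Local Notation TS x y := (exists e, sar J symS [:: x; y] e).
Local Notation TA x y z := (exists e, sar J symA [:: x; y; z] e).
Local Notation TM x y z := (exists e, sar J symM [:: x; y; z] e).
Local Notation nm n := (num J q n).

Let I := unit.
Let D (_ : I) := True.
Let d (_ : I) := 0.
Let hq : computable D d (fun=> q) := cmp_const D d q.
Let hM : forall i : I, D i -> models J q := fun _ _ => hJ.
Let c x : computable D d (fun=> x) := cmp_const D d x.

Lemma T_succ_inj x y z : TS x z -> TS y z -> TE x y.
Proof.
by move=> /solT H1 /solT H2; apply/solT;
  exact: (succ_inj hq hM (c _) (c _) (c _) H1 H2).
Qed.
Lemma T_refl x : TE x x.
Proof. by apply/solT; apply: (E_refl hq hM (c _)). Qed.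
Lemma T_sym x y : TE x y -> TE y x.
Proof. by move=> /solT H1; apply/solT; apply: (E_sym hq hM (c _) (c _) H1). Qed.
Lemma T_trans x y z : TE x y -> TE y z -> TE x z.
Proof.
by move=> /solT H1 /solT H2; apply/solT;
  exact: (E_trans hq hM (c _) (c _) (c _) H1 H2).
Qed.
Lemma T_succ_congl x y z : TE x y -> TS x z -> TS y z.
Proof.
by move=> /solT H1 /solT H2; apply/solT;
  exact: (succ_congl hq hM (c _) (c _) (c _) H1 H2).
Qed.
Lemma T_succ_congr x y z : TS x y -> TE y z -> TS x z.
Proof.
by move=> /solT H1 /solT H2; apply/solT;
  exact: (succ_congr hq hM (c _) (c _) (c _) H1 H2).
Qed.
Lemma T_succ_functional x y z : TS x y -> TS x z -> TE y z.
Proof.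
by move=> /solT H1 /solT H2; apply/solT;
  exact: (succ_functional hq hM (c _) (c _) (c _) H1 H2).
Qed.
Lemma T_zero_unique x y : TZ x -> TZ y -> TE x y.
Proof.
by move=> /solT H1 /solT H2; apply/solT;
  exact: (zero_unique hq hM (c _) (c _) H1 H2).
Qed.
Lemma T_zero_congr x y : TE x y -> TZ x -> TZ y.
Proof.
by move=> /solT H1 /solT H2; apply/solT;
  exact: (zero_congr hq hM (c _) (c _) H1 H2).
Qed.
Lemma T_succ_neq0 x y : TS x y -> ~ TZ y.
Proof.
move=> /solT H1 [e He].
have := sol_ImpE (inst2 (basic_ax hq hM (k := 1) erefl) (c x) (c y)) => /(_ H1).
by move=> [f /(_ tt Logic.I) [b [_ /(_ e He) [? []]]]].
Qed.
Lemma T_zero_or_succ x : TZ x \/ exists y, TS y x.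
Proof.
have [e] := (solT _).2 (zero_or_succ hq hM (c x) (fun=> 0)).
case=> /= -[_ H]; first by left; exists (expo1 e).
by right; exists (expo0 (expo1 e)), (expo1 (expo1 e)).
Qed.
Lemma T_succ_ex x : exists y, TS x y.
Proof.
have [W [_ H]] := succ_ex hq hM (c x).
by exists (W tt); case: H => e /(_ tt Logic.I) [b [_ H]]; exists b.
Qed.
Lemma T_add_ex x y : exists z, TA x y z.
Proof.
have [W [_ H]] := add_ex hq hM (c x) (c y).
by exists (W tt); case: H => e /(_ tt Logic.I) [b [_ H]]; exists b.
Qed.
Lemma T_add_zero x y : TZ y -> TA x y x.
Proof.
by move=> /solT H1; apply/solT; exact: (add_zero hq hM (c _) (c _) H1).
Qed.
Lemma T_add_succ x y z u v : TS y z -> TA x y u -> TS u v -> TA x z v.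
Proof.
move=> /solT H1 /solT H2 /solT H3; apply/solT.
exact: (add_succ hq hM (c _) (c _) (c _) (c _) (c _) H1 H2 H3).
Qed.
Lemma T_add_functional x y z u : TA x y z -> TA x y u -> TE z u.
Proof.
move=> /solT H1 /solT H2; apply/solT.
exact: (add_functional hq hM (c _) (c _) (c _) (c _) H1 H2).
Qed.
Lemma T_add_congl x y z u : TE x y -> TA x z u -> TA y z u.
Proof.
move=> /solT H1 /solT H2; apply/solT.
exact: (add_congl hq hM (c _) (c _) (c _) (c _) H1 H2).
Qed.
Lemma T_add_congr x y z u : TE y z -> TA x y u -> TA x z u.
Proof.
move=> /solT H1 /solT H2; apply/solT.
exact: (add_congr hq hM (c _) (c _) (c _) (c _) H1 H2).
Qed.
Lemma T_mul_functional x y z u : TM x y z -> TM x y u -> TE z u.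
Proof.
move=> /solT H1 /solT H2; apply/solT.
exact: (mul_functional hq hM (c _) (c _) (c _) (c _) H1 H2).
Qed.
Lemma T_mul_congl x y z u : TE x y -> TM x z u -> TM y z u.
Proof.
move=> /solT H1 /solT H2; apply/solT.
exact: (mul_congl hq hM (c _) (c _) (c _) (c _) H1 H2).
Qed.
Lemma T_mul_congr x y z u : TE y z -> TM x y u -> TM x z u.
Proof.
move=> /solT H1 /solT H2; apply/solT.
exact: (mul_congr hq hM (c _) (c _) (c _) (c _) H1 H2).
Qed.

Lemma T_num_zero : TZ (nm 0).
Proof. by apply/solT; apply: (num_zero hq hM). Qed.
Lemma T_num_succ n : TS (nm n) (nm n.+1).
Proof. by apply/solT; apply: (num_succ hq hM (c n)). Qed.
Lemma T_num_add n m : TA (nm n) (nm m) (nm (n + m)).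
Proof. by apply/solT; apply: (num_add hq hM (c n) (c m)). Qed.
Lemma T_num_mul n m : TM (nm n) (nm m) (nm (n * m)).
Proof. by apply/solT; apply: (num_mul hq hM (c n) (c m)). Qed.

(** Equal successors have equal predecessors by A1, and zero is no successor by
    A2. *)
Lemma T_num_inj n m : TE (nm n) (nm m) -> n = m.
Proof.
elim: n m => [|n IH] [|m] // H.
- by case: (T_succ_neq0 (T_num_succ m)); apply: T_zero_congr H T_num_zero.
- by case: (T_succ_neq0 (T_num_succ n));
  apply: T_zero_congr (T_sym H) T_num_zero.
- congr _.+1; apply: IH; apply: T_succ_inj (T_num_succ m).
  exact: T_succ_congr (T_num_succ n) H.
Qed.

Definition standard x n := TE x (nm n).

Lemma standard_pred x y n : TS y x -> standard x n ->
  exists2 m, n = m.+1 & standard y m.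
Proof.
move=> H1; case: n => [|n] H2.
  by case: (T_succ_neq0 H1); apply: T_zero_congr (T_sym H2) T_num_zero.
exists n => //; apply: T_succ_inj (T_num_succ n).
exact: T_succ_congr H1 H2.
Qed.

Lemma standard_succ x y n : TS y x -> standard y n -> standard x n.+1.
Proof.
move=> H1 H2; apply: T_succ_functional (T_num_succ n).
exact: T_succ_congl H2 H1.
Qed.

(** If x is a successor, then t is one by A6, and the predecessor of x is below
    that of t. *)
Lemma le_standard n x t : standard t n -> (exists z, TA z x t) ->
  exists2 m, m <= n & standard x m.
Proof.
elim: n x t => [|n IH] x t Ht [z Hz].
all: have [Zx|[y Sy]] := T_zero_or_succ x;
  first by exists 0 => //; apply: T_zero_unique Zx T_num_zero.
all: have [u Hu] := T_add_ex z y; have [v Sv] := T_succ_ex u.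
all: have Ev := T_add_functional (T_add_succ Sy Hu Sv) Hz.
all: have [m E Hm] := standard_pred (T_succ_congr Sv Ev) Ht => //.
case: E => E; rewrite -{}E in Hm.
have [k Lk Hk] := IH y u Hm (ex_intro _ z Hu).
by exists k.+1 => //; apply: standard_succ Sy Hk.
Qed.

(** A nonstandard element is not zero, and its predecessor is nonstandard
    again. *)
Lemma num_le_nonstandard x : (forall n, ~ standard x n) ->
  forall n, exists w, TA w (nm n) x.
Proof.
move=> + n; elim: n x => [|n IH] x Hx.
  by exists x; apply: T_add_zero T_num_zero.
have [Zx|[y Sy]] := T_zero_or_succ x.
  by case: (Hx 0); apply: T_zero_unique Zx T_num_zero.
have [|w Hw] := IH y; first by move=> m /(standard_succ Sy)/Hx.
by exists w; apply: T_add_succ (T_num_succ n) Hw Sy.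
Qed.

End Truth.

(** * The standard part of an element *)

(** A13 is applied to the element and, if it is a successor, the program calls
    itself on the predecessor.  This terminates since the predecessor of an
    element that equals the numeral of n equals the numeral of n - 1.  The
    solution [b] is a pair of the standard part and a realizer of the
    equation. *)
Lemma standard_part_closed :
  solvable (fun k : sem * nat * nat => element_dom k /\
    exists n, standard k.1.1 k.1.2 k.2 n) element_dat
    (fun k b => sar k.1.1 symE [:: k.2; num k.1.1 k.1.2 (expo0 b)] (expo1 b)).
Proof.
pose D (k : sem * nat * nat * nat) := element_dom k.1 /\
  standard k.1.1.1 k.1.1.2 k.1.2 k.2.
pose P (k : sem * nat * nat) b :=
  sar k.1.1 symE [:: k.2; num k.1.1 k.1.2 (expo0 b)] (expo1 b).
suff [e He] : solvable D (fun k => element_dat k.1) (fun k => P k.1).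
  by exists e => k [Hk [n Hn]]; have [] := He (k, n) (conj Hk Hn); eauto.
apply: (sol_fix (m := snd)).
set X := (X in ext D X); pose d (k : sem * nat * nat * nat) := element_dat k.1;
  rewrite -/d.
have hD' j : ext D X j -> element_dom j.1.1 by case=> -[].
have hd : computable (ext D X) (dex d) (fun j => element_dat j.1.1)
  by exact: (cmp_dfst D d X).
have hq : computable (ext D X) (dex d) (fun j => j.1.1.1.2).
  exact: (cmp_pull (phi := fun j : sem * nat * nat * nat * nat => j.1.1) hd hD'
    cmp_element_q).
have ha : computable (ext D X) (dex d) (fun j => j.1.1.2).
  exact: (cmp_pull (phi := fun j : sem * nat * nat * nat * nat => j.1.1) hd hD'
    cmp_element).
have hr : computable (ext D X) (dex d) snd by apply: cmp_snd.
have := zero_or_succ (J := fun j => j.1.1.1.1) hq hD' ha (fun=> 0).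
move=> /sol_OrE; apply=> D' HD' H.
  have hJ j : D' j -> models j.1.1.1.1 j.1.1.1.2 by move=> /HD' /hD'.
  have sq := cmp_sub HD' hq; have sa := cmp_sub HD' ha.
  have h0 := cmp_num (J := fun j => j.1.1.1.1) sq hJ (cmp_const _ _ 0).
  have := zero_unique (J := fun j => j.1.1.1.1) sq hJ sa h0 H (num_zero sq hJ).
  move=> /sol_cmp [F [HF HP]].
  apply: (cmp_sol (cmp_pair (cmp_const _ _ 0) HF)) => j Hj.
  by rewrite /P !expE; apply: HP.
have hJ j : D' j -> models j.1.1.1.1 j.1.1.1.2 by move=> /HD' /hD'.
have sq := cmp_sub HD' hq; have sa := cmp_sub HD' ha.
have [Y [hY sY]] := sol_ExE H.
have {}sY : solvable D' (dex d) (fun j => sar j.1.1.1.1 symS [:: Y j; j.1.1.2])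
  by exact: sY.
have : solvable D' (dex d) (fun j b =>
    sar j.1.1.1.1 symE [:: Y j; num j.1.1.1.1 j.1.1.1.2 (expo0 b)] (expo1 b)).
  apply: (sol_app (X := fun j a => a = pair (Y j) j.1.1.1.2) (P := fun j _ b =>
    sar j.1.1.1.1 symE [:: Y j; num j.1.1.1.1 j.1.1.1.2 (expo0 b)] (expo1 b))
    _ (cmp_pair hY sq)) => //.
  apply: (cmp_sol (cmp_sub HD' hr)) => j Hj _ ->.
  have [[_ Hst] Hr] := HD' j Hj; have Hs :
    exists e, sar j.1.1.1.1 symS [:: Y j; j.1.1.2] e.
    by have [e He] := sY; have [b [_ Hb]] := He j Hj; exists b.
  have [m Em Hm] := standard_pred (hJ _ Hj) Hs Hst.
  apply: (Hr (j.1.1.1, Y j, m)); last by rewrite /= Em.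
  by split=> //; apply: hJ.
move=> /sol_cmp [F [hF HF]].
have hN := cmp_expo0 hF.
have hn := cmp_num (J := fun j => j.1.1.1.1) sq hJ hN.
have hn' := cmp_num (J := fun j => j.1.1.1.1) sq hJ (cmp_succ hN).
have HE : solvable D' (dex d) (fun j =>
    sar j.1.1.1.1 symE [:: Y j; num j.1.1.1.1 j.1.1.1.2 (expo0 (F j))]).
  exact: (cmp_sol (cmp_expo1 hF)).
have H1 := succ_congl (J := fun j => j.1.1.1.1) sq hJ hY hn sa HE sY.
have := succ_functional (J := fun j => j.1.1.1.1) sq hJ hn sa hn' H1
  (num_succ sq hJ hN).
move=> /sol_cmp [G [hG HG]].
apply: (cmp_sol (cmp_pair (cmp_succ hN) hG)) => j Hj.
by rewrite /P !expE; apply: HG.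
Qed.

Section Atoms.

Variables (I : Type) (D : I -> Prop) (d : I -> nat) (J : I -> sem)
  (q : I -> nat).
Hypothesis hq : computable D d q.
Hypothesis hJ : forall i, D i -> models (J i) (q i).

Local Notation nm i n := (num (J i) (q i) n).

Lemma standard_part A : computable D d A ->
  (forall i, D i -> exists n, standard (J i) (q i) (A i) n) ->
  exists N, computable D d N /\
    solvable D d (fun i => sar (J i) symE [:: A i; nm i (N i)]).
Proof.
move=> hA HA.
have HD i : D i -> element_dom (J i, q i, A i) /\
    exists n, standard (J i, q i, A i).1.1 (J i, q i, A i).1.2 (J i, q i, A i).2
      n.
  by move=> Hi; split; [apply: hJ | apply: HA].
have /sol_cmp [F [hF HF]] :=
  sol_pull (phi := fun i => (J i, q i, A i)) (cmp_pair hA hq) HD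
    standard_part_closed.
exists (fun i => expo0 (F i)); split; first exact: cmp_expo0.
exact: (cmp_sol (cmp_expo1 hF)).
Qed.

(** The elements [a i k] and the numbers [w i k] correspond, with everything
    computed from the data. *)
Definition tracks (a w : I -> nat -> nat) k :=
  [/\ computable D d (fun i => a i k), computable D d (fun i => w i k) &
      solvable D d (fun i => sar (J i) symE [:: a i k; nm i (w i k)])].

(** True atoms are realized for numerals, and the equality premises of the
    symbol carry this over to equal elements. *)
Lemma atom_up a w s (t : (arity s).-tuple nat) :
  (forall k, k \in val t -> tracks a w k) ->
  (forall i, D i -> atrue s (map (w i) t)) ->
  solvable D d (fun i => sar (J i) s (map (a i) t)).
Proof.
have sym k : tracks a w k ->
    [/\ computable D d (fun i => a i k), computable D d (fun i => w i k),
      computable D d (fun i => nm i (w i k)) &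
      solvable D d (fun i => sar (J i) symE [:: nm i (w i k); a i k])].
  case=> hA hW HE; have hn := cmp_num hq hJ hW; split=> //.
  exact: (E_sym hq hJ hA hn HE).
case: s t => -[].
- case=> [|x []] //= Hs Ht; case: (sym x); first by apply: Ht; rewrite inE.
  move=> hA hW hn HE Hw; apply: (zero_congr hq hJ hn hA HE).
  by apply: sol_imp (num_zero hq hJ) _ => i b /Hw ->.
- case=> [|x [|y []]] //= Hs Ht; case: (sym x); first by apply: Ht;
  rewrite inE eqxx.
  case: (sym y); first by apply: Ht; rewrite !inE eqxx orbT.
  move=> hY hWy hny HEy hX hWx hnx HEx Hw.
  apply: (E_euclid hq hJ hnx hX hY HEx).
  by apply: sol_imp HEy _ => i b /Hw ->.
- case=> [|x [|y []]] //= Hs Ht; case: (sym x); first by apply: Ht;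
  rewrite inE eqxx.
  case: (sym y); first by apply: Ht; rewrite !inE eqxx orbT.
  move=> hY hWy hny HEy hX hWx hnx HEx Hw.
  apply: (succ_congl hq hJ hnx hX hY HEx);
    apply: (succ_congr hq hJ hnx hny hY _ HEy).
  by apply: sol_imp (num_succ hq hJ hWx) _ => i b /Hw /= <-.
- case=> [|x [|y [|z []]]] //= Hs Ht.
  case: (sym x); first by apply: Ht; rewrite inE eqxx.
  case: (sym y); first by apply: Ht; rewrite !inE eqxx orbT.
  case: (sym z); first by apply: Ht; rewrite !inE eqxx !orbT.
  move=> hZ hWz hnz HEz hY hWy hny HEy hX hWx hnx HEx Hw.
  apply: (add_congl hq hJ hnx hX hY hZ HEx);
    apply: (add_congr hq hJ hnx hny hY hZ HEy).
  apply: (add_congo hq hJ hnx hny hnz hZ _ HEz).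
  by apply: sol_imp (num_add hq hJ hWx hWy) _ => i b /Hw /= <-.
- case=> [|x [|y [|z []]]] //= Hs Ht.
  case: (sym x); first by apply: Ht; rewrite inE eqxx.
  case: (sym y); first by apply: Ht; rewrite !inE eqxx orbT.
  case: (sym z); first by apply: Ht; rewrite !inE eqxx !orbT.
  move=> hZ hWz hnz HEz hY hWy hny HEy hX hWx hnx HEx Hw.
  apply: (mul_congl hq hJ hnx hX hY hZ HEx);
    apply: (mul_congr hq hJ hnx hny hY hZ HEy).
  apply: (mul_congo hq hJ hnx hny hnz hZ _ HEz).
  by apply: sol_imp (num_mul hq hJ hWx hWy) _ => i b /Hw /= <-.
Qed.

End Atoms.

(** By the premises on functionality an atom that is realized for elements
    yields an equation between numerals, and different numerals are not
    equal. *)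
Lemma atom_down J q a w s (t : (arity s).-tuple nat) e : models J q ->
  (forall k, k \in val t -> standard J q (a k) (w k)) ->
  sar J s (map a t) e -> atrue s (map w t).
Proof.
move=> hJ; case: s t => -[].
- case=> [|x []] //= Hs Ht He.
  have Hx : standard J q (a x) (w x) by apply: Ht; rewrite inE.
  apply: (T_num_inj hJ); apply: (T_zero_unique hJ) (T_num_zero hJ).
  by apply: (T_zero_congr hJ) Hx _; exists e.
- case=> [|x [|y []]] //= Hs Ht He.
  have Hx : standard J q (a x) (w x) by apply: Ht; rewrite inE eqxx.
  have Hy : standard J q (a y) (w y) by apply: Ht; rewrite !inE eqxx orbT.
  apply: (T_num_inj hJ); apply: (T_trans hJ) Hy;
    apply: (T_trans hJ) (T_sym hJ Hx) _.
  by exists e.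
- case=> [|x [|y []]] //= Hs Ht He.
  have Hx : standard J q (a x) (w x) by apply: Ht; rewrite inE eqxx.
  have Hy : standard J q (a y) (w y) by apply: Ht; rewrite !inE eqxx orbT.
  apply: (T_num_inj hJ); apply: (T_succ_functional hJ) (T_num_succ hJ _) _.
  by apply: (T_succ_congr hJ) Hy; apply: (T_succ_congl hJ Hx); exists e.
- case=> [|x [|y [|z []]]] //= Hs Ht He.
  have Hx : standard J q (a x) (w x) by apply: Ht; rewrite inE eqxx.
  have Hy : standard J q (a y) (w y) by apply: Ht; rewrite !inE eqxx orbT.
  have Hz : standard J q (a z) (w z) by apply: Ht; rewrite !inE eqxx !orbT.
  apply: (T_num_inj hJ); apply: (T_trans hJ) Hz.
  apply: (T_add_functional hJ) (T_num_add hJ _ _) _.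
  by apply: (T_add_congl hJ Hx); apply: (T_add_congr hJ Hy); exists e.
- case=> [|x [|y [|z []]]] //= Hs Ht He.
  have Hx : standard J q (a x) (w x) by apply: Ht; rewrite inE eqxx.
  have Hy : standard J q (a y) (w y) by apply: Ht; rewrite !inE eqxx orbT.
  have Hz : standard J q (a z) (w z) by apply: Ht; rewrite !inE eqxx !orbT.
  apply: (T_num_inj hJ); apply: (T_trans hJ) Hz.
  apply: (T_mul_functional hJ) (T_num_mul hJ _ _) _.
  by apply: (T_mul_congl hJ Hx); apply: (T_mul_congr hJ Hy); exists e.
Qed.

(** * Sigma-completeness *)

Lemma sat_fle n x y : sat n (fle x y) <-> n x <= n y.
Proof.
split; first by move=> [z /= <-]; apply: leq_addl.
by move=> H; exists (n y - n x); apply: subnK.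
Qed.

Lemma scoped_bEx K t p : scoped K (bEx t p) = (t < K) && scoped K.+1 p.
Proof. by rewrite /= !ltnS andbT. Qed.

Lemma scoped_bAll K t p : scoped K (bAll t p) = (t < K) && scoped K.+1 p.
Proof. exact: scoped_bEx. Qed.

Section Completeness.

Variables (J : sem) (q : nat).
Hypothesis hJ : models J q.

(** In contrast to [tracks], the numbers do not vary with the instance, and
    only the elements are computed. *)
Definition elements K I (D : I -> Prop) d (a : I -> nat -> nat)
  (n : nat -> nat) :=
  forall k, k < K ->
    computable D d (fun i => a i k) /\ forall i, D i ->
      standard J q (a i k) (n k).

(** The formula [p] is realized at all elements that name the numbers [n].  The
    realizer may depend on the numbers but not on the elements, which is what
    the proof for bounded universal quantifiers needs. *)
Definition complete K n p := forall I (D : I -> Prop) d a,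
  elements K D d a n -> solvable D d (fun i => rlz J (a i) p).

Lemma elements_sub K I (D D' : I -> Prop) d a n : (forall i, D' i -> D i) ->
  elements K D d a n -> elements K D' d a n.
Proof.
by move=> HD H k /H [h1 h2]; split; [apply: cmp_sub h1 | move=> i /HD /h2].
Qed.

Lemma elements_ext K I (D : I -> Prop) d X a n :
  elements K D d a n -> elements K (ext D X) (dex d) (fun j => a j.1) n.
Proof.
move=> H k /H [h1 h2]; split; first by apply: (cmp_ext _ h1).
by move=> j [/h2].
Qed.

Lemma elements_scons K I (D : I -> Prop) d a n x k : elements K D d a n ->
  computable D d x -> (forall i, D i -> standard J q (x i) k) ->
  elements K.+1 D d (fun i => scons (x i) (a i)) (scons k n).
Proof. by move=> H hx Hx [|m] //= /H. Qed.

Lemma standard_num k : standard J q (num J q k) k.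
Proof. exact: (T_refl hJ). Qed.

Lemma complete_Ar K n s (t : (arity s).-tuple nat) :
  scoped K (Ar t) -> atrue s (map n t) -> complete K n (Ar t).
Proof.
move=> /= /allP Ht Hs I D d a Ha.
apply: (@atom_up _ D d (fun=> J) (fun=> q) (cmp_const _ _ q) _
  a (fun=> n)) => //.
move=> k /Ht Hk; have [h1 h2] := Ha k Hk; split=> //; first exact: cmp_const.
have [|N [hN HN]] := @standard_part _ D d (fun=> J) (fun=> q) (cmp_const _ _ q)
  (fun _ _ => hJ) _ h1.
  by move=> i /h2 Hi; exists (n k).
move: HN => /sol_cmp [F [hF HF]].
apply: (cmp_sol hF) => i Hi; have := HF i Hi; suff -> : N i = n k by [].
apply: (T_num_inj hJ); apply: (T_trans hJ) (h2 i Hi); apply: (T_sym hJ).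
by exists (F i); apply: HF.
Qed.

Lemma complete_And K n p p' : complete K n p -> complete K n p' ->
  complete K n (And p p').
Proof.
move=> H1 H2 I D d a Ha.
exact: (sol_AndI (J := fun=> J) (H1 _ _ _ _ Ha) (H2 _ _ _ _ Ha)).
Qed.

Lemma complete_Or1 K n p p' : complete K n p -> complete K n (Or p p').
Proof. by move=> H1 I D d a Ha;
  apply: (sol_OrI1 (J := fun=> J) _ (H1 _ _ _ _ Ha)). Qed.

Lemma complete_Or2 K n p p' : complete K n p' -> complete K n (Or p p').
Proof. by move=> H1 I D d a Ha;
  apply: (sol_OrI2 (J := fun=> J) _ (H1 _ _ _ _ Ha)). Qed.

Lemma complete_Ex K n k p : complete K.+1 (scons k n) p -> complete K n (Ex p).
Proof.
move=> H I D d a Ha.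
apply: (sol_ExI (J := fun=> J) (cmp_const D d (num J q k))).
by apply: H; apply: elements_scons => //;
  [exact: cmp_const | move=> *; exact: standard_num].
Qed.

Lemma complete_fle K n x y : x < K -> y < K -> n x <= n y ->
  complete K n (fle x y).
Proof.
move=> hx hy H; apply: (complete_Ex (k := n y - n x)); apply: complete_Ar => /=.
  by rewrite !ltnS hx hy.
exact: subnK.
Qed.

Lemma fle_standard (a n : nat -> nat) x t e : standard J q (a t) (n t) ->
  rlz J (scons x a) (fle 0 t.+1) e -> exists2 k, k <= n t & standard J q x k.
Proof.
move=> Ht He; apply: (le_standard hJ Ht).
by exists (expo0 e), (expo1 e).
Qed.

Lemma complete_bEx K n t k p : t < K -> k <= n t ->
  complete K.+1 (scons k n) p ->
  complete K n (bEx t p).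
Proof.
move=> Ht Hk Hp; apply: (complete_Ex (k := k)); apply: complete_And => //.
by apply: complete_fle.
Qed.

(** An element x below t names one of finitely many numbers k.  The standard
    part of x is computed, and it selects the realizer for k. *)
Lemma complete_bAll K n t p : t < K ->
  (forall k, k <= n t -> complete K.+1 (scons k n) p) ->
    complete K n (bAll t p).
Proof.
move=> Ht Hp I D d a Ha.
apply: (sol_AllI (J := fun=> J)); apply: (sol_ImpI (J := fun=> J)).
set D' := ext _ _; set d' := dex _.
have hx : computable D' d' (fun j => j.1.2)
  by exact: (cmp_ext _ (cmp_snd _ _ _)).
have Hx j : D' j -> exists2 k, k <= n t & standard J q j.1.2 k.
  by move=> [[Hj _] /= /fle_standard]; apply; apply: (Ha t Ht).2.
have [|N [hN HN]] := @standard_part _ D' d' (fun=> J) (fun=> q)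
  (cmp_const _ _ q) (fun _ _ => hJ) _ hx.
  by move=> j /Hx [k _ Hk]; exists k.
have sN j : D' j -> standard J q j.1.2 (N j).
  by case: HN => e He /He [b [_ Hb]]; exists b.
apply: (sol_cases (n := (n t).+1) hN) => [k Lk|j Hj]; last first.
  have [k Lk Hk] := Hx j Hj; rewrite ltnS (_ : N j = k) //.
  by apply: (T_num_inj hJ); apply: (T_trans hJ) Hk; apply: (T_sym hJ);
    apply: sN.
apply: (Hp k Lk _ _ _ (fun j => scons j.1.2 (a j.1.1))).
apply: elements_scons; last by move=> j [Hj <-]; apply: sN.
  apply: (elements_sub (D := D')) => [j []//|].
  exact: (elements_ext _ (elements_ext _ Ha)).
by apply: cmp_sub hx => j [].
Qed.

(** Negation and implication interchange the two claims, so that they are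
    proved together. *)
Lemma Delta0_complete p : Delta0 p -> forall K n, scoped K p ->
  (sat n p -> complete K n p) /\
  (~ sat n p -> forall a, (forall k, k < K -> standard J q (a k) (n k)) ->
     forall e, ~ rlz J a p e).
Proof.
elim=> {p} [|s t|p _ IH|p p' _ IH _ IH'|p p' _ IH _ IH'|p p' _ IH _ IH'|t p _
  IH|t p _ IH] K n.
- by [].
- rewrite sat_Ar => Hs; split; first exact: complete_Ar.
  move=> H a Ha e He; apply: H; apply: (atom_down hJ) He => k Hk; apply: Ha.
  by move: Hs => /= /allP; apply.
- move=> /= /IH Hp; split=> H.
    move=> I D d a Ha; apply: sol_NegI => i e Hi.
    by have [_] := Hp n; move=> /(_ H); apply=> k Hk; apply: (Ha k Hk).2.
  move=> a Ha e; have {}H := NNPP _ H.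
  have [/(_ H) Hc _] := Hp n.
  have [b Hb] : exists b, rlz J a p b.
    apply/solT; apply: (Hc _ _ _ (fun=> a)) => k Hk; split;
      first exact: cmp_const.
    by move=> _ _; apply: Ha.
  by move=> /(_ b Hb) [? []].
- move=> /= /andP [/(IH K n) [Hp np] /(IH' K n) [Hp' np']]; split.
    by case=> [/Hp|/Hp']; [apply: complete_Or1 | apply: complete_Or2].
  move=> H a Ha e [[_]|[_]]; first by apply: np => // S; apply: H; left.
  by apply: np' => // S; apply: H; right.
- move=> /= /andP [/(IH K n) [Hp np] /(IH' K n) [Hp' np']]; split.
    by move=> [S S']; apply: complete_And; [apply: Hp | apply: Hp'].
  move=> H a Ha e [H1 H2]; case: (classic (sat n p)) => S;
    last exact: (np S a Ha _ H1).
  by case: (classic (sat n p')) => S'; [apply: H | apply: (np' S' a Ha _ H2)].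
- move=> /= /andP [/(IH K n) [Hp np] /(IH' K n) [Hp' np']]; split=> H.
    move=> I D d a Ha; apply: (sol_ImpI (J := fun=> J)).
    case: (classic (sat n p)) => S.
      by have := Hp' (H S) _ _ _ _ (elements_ext (fun i => rlz J (a i) p) Ha).
    apply: sol_absurd => j [Hj]; apply: np => // k Hk; exact: (Ha k Hk).2.
  have [S S'] : sat n p /\ ~ sat n p' by apply: NNPP => C; apply: H => S;
    apply: NNPP => S'; apply: C.
  move=> a Ha e.
  have [b Hb] : exists b, rlz J a p b.
    apply/solT; apply: (Hp S _ _ _ (fun=> a)) => k Hk; split;
      first exact: cmp_const.
    by move=> _ _; apply: Ha.
  by move=> /(_ b Hb) [c [_]]; apply: np'.
- rewrite scoped_bEx => /andP [Ht /IH Hp]; split.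
    case=> k [] /sat_fle /= Hk S; apply: (complete_bEx (k := k)) => //.
    by case: (Hp (scons k n)) => + _; apply.
  move=> H a Ha e [/(fle_standard (Ha t Ht)) [k Hk Hx]].
  case: (Hp (scons k n)) => _; apply=> [S|[|m] //=]; last exact: Ha.
  by apply: H; exists k; split=> //; apply/sat_fle.
- rewrite scoped_bAll => /andP [Ht /IH Hp]; split.
    move=> H; apply: complete_bAll => // k Hk.
    by case: (Hp (scons k n)) => + _; apply; apply: H; apply/sat_fle.
  move=> H a Ha e He; apply: H => k /sat_fle /= Hk; apply: NNPP => S.
  have [b [_ Hb]] := He (num J q k).
  have Ha' m : m < K.+1 -> standard J q (scons (num J q k) a m) (scons k n m).
    by case: m => [_|m] //=; [exact: standard_num | exact: Ha].
  have [c Hc] : exists c, rlz J (scons (num J q k) a) (fle 0 t.+1) c.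
    apply/solT; apply: (complete_fle (K := K.+1) (n := scons k n) _ _ _
      (a := fun=> _)) => //.
    by move=> m Hm; split; [exact: cmp_const | move=> _ _; apply: Ha'].
  have [c' [_]] := Hb c Hc.
  by case: (Hp (scons k n)) => _; apply.
Qed.

Lemma Sigma_complete p : Sigma p -> forall K n, scoped K p -> sat n p ->
  complete K n p.
Proof.
elim=> {p} [p Hp|p p' _ IH _ IH'|p p' _ IH _ IH'|t p _ IH|t p _ IH|p _ IH] K n.
- by move=> Hs; case: (Delta0_complete Hp n Hs).
- move=> /= /andP [Hp Hp'] [S|S]; [apply: complete_Or1 | apply: complete_Or2].
    exact: IH.
  exact: IH'.
- by move=> /= /andP [Hp Hp'] [S S']; apply: complete_And;
  [apply: IH | apply: IH'].
- rewrite scoped_bEx => /andP [Ht Hp] [k [] /sat_fle /= Hk S].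
  by apply: (complete_bEx (k := k)) => //; apply: IH.
- rewrite scoped_bAll => /andP [Ht Hp] H.
  by apply: complete_bAll => // k Hk; apply: IH => //; apply: H; apply/sat_fle.
- by move=> /= Hp [k S]; apply: (complete_Ex (k := k)); apply: IH.
Qed.

Lemma complete_realized K n p a : complete K n p ->
  (forall k, k < K -> standard J q (a k) (n k)) -> exists e, rlz J a p e.
Proof.
move=> H Ha; apply/solT; apply: (H _ _ _ (fun=> a)) => k Hk.
by split; [exact: cmp_const | move=> _ _; apply: Ha].
Qed.

End Completeness.

(** * Soundness of intuitionistic arithmetic *)

(** Arithmetic with 0 as the only realizer of a true atom; [R] is the meaning
    of the predicate variables. *)
Definition std (R : nat -> nat -> seq nat -> nat -> Prop) : sem :=
  Sem (fun s l e => e = 0 /\ atrue s l) R.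

Lemma sol_ren I (D : I -> Prop) d J v w r p :
  (forall i k, v i (r k) = w i k) ->
  solvable D d (fun i => rlz (J i) (v i) (ren r p)) <->
    solvable D d (fun i => rlz (J i) (w i) p).
Proof.
move=> H; have E i : (fun k => v i (r k)) = w i.
  by apply: functional_extensionality => k.
by split; move=> /sol_imp; apply=> i b _; rewrite rl_ren E.
Qed.

Arguments sol_ren {I D d J v} w {r p}.

Lemma sol_true I (D : I -> Prop) d R v s (t : (arity s).-tuple nat) :
  (forall i, D i -> atrue s (map (v i) t)) ->
  solvable D d (fun i => rlz (std (R i)) (v i) (Ar t)).
Proof. by move=> H; apply: (sol_some _ (b := 0)) => i /H. Qed.

(* Proves universally quantified implications between atoms. *)
Ltac horn := repeat apply: sol_AllI; apply: sol_ImpI; apply: sol_true;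
  rewrite /ext /=; lia.

(** Realizers of true atoms are known in advance, so that only the existential
    quantifiers and A13 require a computation. *)
Lemma std_basic p I (D : I -> Prop) d R v : List.In p basic_axioms ->
  solvable D d (fun i => rlz (std (R i)) (v i) p).
Proof.
rewrite /basic_axioms /=.
case=> [<-|]; first by horn.
case=> [<-|].
  repeat apply: sol_AllI; apply: sol_ImpI;
    apply: sol_NegI => j a [_ /= [_ H]] [_].
  by rewrite /= -H.
do 10![case=> [<-|]; first by horn].
case=> [<-|].
  apply: sol_AllI; apply: (sol_if (cmp_snd _ _ _)).
    by apply: sol_OrI1; apply: sol_true => j [].
  apply: sol_OrI2; apply: (sol_ExI (X := fun j => j.2.-1)).
    by apply: (cmp_sub _ (cmp_pred (cmp_snd D d (fun _ _ => True)))) => j [].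
  by apply: sol_true => j [_ /=]; lia.
case=> [<-|]; first by apply: (sol_ExI (cmp_const _ _ 0)); apply: sol_true.
do 2![case=> [<-|]; first by horn].
case=> [<-|].
  apply: sol_AllI; apply: (sol_ExI (X := fun j => j.2.+1));
    last by apply: sol_true.
  exact: cmp_succ (cmp_snd _ _ _).
do 2![case=> [<-|]; first by horn].
case=> [<-|].
  do 2!apply: sol_AllI; apply: (sol_ExI (X := fun j => j.1.2 + j.2));
    last by apply: sol_true.
  exact: cmp_rec2 rec2_add (cmp_ext _ (cmp_snd _ _ _)) (cmp_snd _ _ _).
do 2![case=> [<-|]; first by horn].
case=> [<-|].
  do 2!apply: sol_AllI; apply: (sol_ExI (X := fun j => j.1.2 * j.2));
    last by apply: sol_true.
  exact: cmp_rec2 rec2_mul (cmp_ext _ (cmp_snd _ _ _)) (cmp_snd _ _ _).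
do 2![case=> [<-|]; first by horn].
by [].
Qed.

(** By induction on derivations.  The rules are closure properties of
    [solvable], and the induction scheme is realized by primitive recursion. *)
Lemma HA_sound H p : HA H p -> forall I (D : I -> Prop) d R v,
  (forall k, computable D d (fun i => v i k)) ->
  (forall h, List.In h H -> solvable D d (fun i => rlz (std (R i)) (v i) h)) ->
  solvable D d (fun i => rlz (std (R i)) (v i) p).
Proof.
elim=> {H p}.
- by move=> H p Hp I D d R v _ _; apply: std_basic.
- move=> H p _ I D d R v Hv _; apply: sol_ImpI; apply: sol_AllI.
  set D' := ext _ _; set d' := dex _.
  pose P (j : I * nat * nat) n := rlz (std (R j.1.1)) (scons n (v j.1.1)) p.
  suff : solvable D' d' (fun j => P j j.2) by [].
  have Hyp : solvable D' d' (fun j => rlz (std (R j.1.1)) (v j.1.1)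
      (All (fZ 0 ⟶ p) ∧ All (All (ren succn p ∧ fS 1 0 ⟶
        ren (scons 0 (succn \o succn)) p)))).
    by apply: (cmp_sol (cmp_ext _ (cmp_snd _ _ _))) => j [[_ Hj] _].
  apply: (sol_induction (P := P) _ _ (cmp_snd _ _ _)).
    apply: (sol_ImpE (sol_AllE (sol_AndE1 Hyp) (cmp_const _ _ 0))).
    exact: sol_true.
  set D'' := ext _ _; set d'' := dex _.
  have {}Hyp := sol_ext (fun j => P j.1 j.2)
    (sol_ext (fun _ _ => True) (sol_AndE2 Hyp)).
  have hn : computable D'' d'' (fun j => j.1.2) := cmp_ext _ (cmp_snd _ _ _).
  have Hstep := sol_ImpE (sol_AllE (sol_AllE Hyp hn) (cmp_succ hn)).
  have : solvable D'' d'' (fun j => rlz (std (R j.1.1.1.1))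
      (scons j.1.2.+1 (scons j.1.2 (v j.1.1.1.1)))
        (ren (scons 0 (succn \o succn)) p)).
    apply: Hstep; apply: sol_AndI; last exact: sol_true.
    apply/(sol_ren (fun j => scons j.1.2 (v j.1.1.1.1))); first by move=> j [].
    by apply: (cmp_sol (cmp_snd _ _ _)) => j [].
  by move/(sol_ren (fun j => scons j.1.2.+1 (v j.1.1.1.1))); apply=> j [].
- by move=> H p Hp I D d R v _; apply.
- by move=> H p _ IH I D d R v Hv /IH => /(_ Hv) HB; apply: sol_imp HB _.
- by move=> H p p' _ IH _ IH' I D d R v Hv HH; apply: sol_AndI;
  [apply: IH | apply: IH'].
- by move=> H p p' _ IH I D d R v Hv HH; apply: sol_AndE1 (IH _ _ _ _ _ Hv HH).
- by move=> H p p' _ IH I D d R v Hv HH; apply: sol_AndE2 (IH _ _ _ _ _ Hv HH).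
- by move=> H p p' _ IH I D d R v Hv HH; apply: sol_OrI1 (IH _ _ _ _ _ Hv HH).
- by move=> H p p' _ IH I D d R v Hv HH; apply: sol_OrI2 (IH _ _ _ _ _ Hv HH).
- move=> H p p' r _ IH _ IHp _ IHp' I D d R v Hv HH.
  apply: (sol_OrE (IH _ _ _ _ _ Hv HH)) => D' HD Hp.
    apply: IHp => [k|h /= [<-|/HH Hh]] //; first exact: cmp_sub HD (Hv k).
    exact: sol_sub HD Hh.
  apply: IHp' => [k|h /= [<-|/HH Hh]] //; first exact: cmp_sub HD (Hv k).
  exact: sol_sub HD Hh.
- move=> H p p' _ IH I D d R v Hv HH; apply: sol_ImpI.
  apply: (IH _ _ _ _ (fun j => v j.1)) => [k|h /= [<-|/HH Hh]].
  + exact: cmp_ext (Hv k).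
  + by apply: (cmp_sol (cmp_snd _ _ _)) => j [].
  + exact: sol_ext Hh.
- move=> H p p' _ IH _ IH' I D d R v Hv HH.
  exact: sol_ImpE (IH _ _ _ _ _ Hv HH) (IH' _ _ _ _ _ Hv HH).
- move=> H p _ IH I D d R v Hv HH.
  suff : solvable D d (fun i => rlz (std (R i)) (v i) (p ⟶ Bot)) by [].
  apply: sol_ImpI.
  apply: (IH _ _ _ _ (fun j => v j.1)) => [k|h /= [<-|/HH Hh]].
  + exact: cmp_ext (Hv k).
  + by apply: (cmp_sol (cmp_snd _ _ _)) => j [].
  + exact: sol_ext Hh.
- move=> H p _ IH _ IH' I D d R v Hv HH.
  have {}IH : solvable D d (fun i => rlz (std (R i)) (v i) (p ⟶ Bot))
    by exact: IH.
  exact: sol_ImpE IH (IH' _ _ _ _ _ Hv HH).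
- move=> H p _ IH I D d R v Hv HH; apply: sol_AllI.
  apply: (IH _ _ _ _ (fun j => scons j.2 (v j.1))) => [[|k]|h].
  + exact: cmp_snd.
  + exact: cmp_ext (Hv k).
  + move=> /List.in_map_iff [h' [<- /HH Hh]].
    by apply/(sol_ren (fun j => v j.1)) => //; apply: sol_ext Hh.
- move=> H p x _ IH I D d R v Hv HH.
  apply/(sol_ren (fun i => scons (v i x) (v i))); first by move=> i [].
  exact: sol_AllE (IH _ _ _ _ _ Hv HH) (Hv x).
- move=> H p x _ IH I D d R v Hv HH; apply: (sol_ExI (Hv x)).
  apply/(@sol_ren _ _ _ _ v _ (scons x id)); first by move=> i [].
  exact: IH.
- move=> H p p' _ IH _ IH' I D d R v Hv HH.
  have [X [hX HX]] := sol_ExE (IH _ _ _ _ _ Hv HH).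
  apply/(@sol_ren _ _ _ _ (fun i => scons (X i) (v i)) _ succn) => //.
  apply: IH' => [[|k]|h /= [<-|]] //; first exact: Hv.
  move=> /List.in_map_iff [h' [<- /HH Hh]].
  by apply/(sol_ren v).
Qed.

(** * The standard structure *)

Lemma std_model : exists q, forall R, models (std R) q.
Proof.
apply: sol_const; apply: (sol_bigconjI (J := std)) => p Hp.
exact: (@std_basic p _ _ _ id).
Qed.

Section StandardStructure.

Variable R : nat -> nat -> seq nat -> nat -> Prop.

Lemma std_num q n : models (std R) q -> num (std R) q n = n.
Proof.
move=> hq; elim: n => [|n IH]; first by have [e [_]] := T_num_zero hq.
by have [e [_ /= <-]] := T_num_succ hq n; rewrite IH.
Qed.

Lemma std_standard q n : models (std R) q -> standard (std R) q n n.
Proof. by move=> hq; exists 0; rewrite std_num. Qed.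

(** A false Delta0-formula has no realizer by [Delta0_complete], and
    Sigma-formulas are built from these positively, apart from the bounds of
    universal quantifiers, which have realizers when they are true. *)
Lemma std_Sigma_sound p : Sigma p -> forall K v e, scoped K p ->
  rlz (std R) v p e -> sat v p.
Proof.
have [q /(_ R) hq] := std_model.
have D0 p' : Delta0 p' -> forall K v e, scoped K p' -> rlz (std R) v p' e ->
  sat v p'.
  move=> Hp K v e HK He; apply: NNPP => S.
  case: (Delta0_complete hq Hp v HK) => _ /(_ S v) H; apply: H He => k _.
  exact: std_standard.
elim=> {p} [p Hp|p p' _ IH _ IH'|p p' _ IH _ IH'|t p _ IH|t p _ IH|p _ IH] K v
  e.
- exact: D0.
- move=> /= /andP [HK HK'] [[_ H]|[_ H]];
  [left; exact: (IH _ _ _ HK H) | right; exact: (IH' _ _ _ HK' H)].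
- by move=> /= /andP [HK HK'] [H H']; split;
  [exact: (IH _ _ _ HK H) | exact: (IH' _ _ _ HK' H')].
- rewrite scoped_bEx => /andP [Ht Hp] [H1 H2].
  exists (expo0 e); split; last exact: (IH _ _ _ Hp H2).
  by case: H1 => _ /= H1; exists (expo0 (expo0 (expo1 e))).
- rewrite scoped_bAll => /andP [Ht Hp] H k [z Hz].
  have [b [_ Hb]] := H k; have [|c [_ Hc]] := Hb (pair z 0);
    last exact: (IH _ _ _ Hp Hc).
  by rewrite /= !expE.
- by move=> HK H; exists (expo0 e); exact: (IH _ _ _ HK H).
Qed.

Lemma std_Sigma_complete p K v : Sigma p -> scoped K p -> sat v p ->
  exists e, rlz (std R) v p e.
Proof.
have [q /(_ R) hq] := std_model => Hp HK S.
apply: (complete_realized (Sigma_complete hq Hp HK S)) => k _.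
exact: std_standard.
Qed.

End StandardStructure.

Lemma rl_inst3 J v F x y z : scoped 3 F ->
  rlz J v (inst F [:: x; y; z]) = rlz J (nth 0 [:: v x; v y; v z]) F.
Proof. by move=> HF; rewrite rl_ren; apply: (rl_scoped _ HF) => -[|[|[|]]]. Qed.

Section SigmaPredicates.

Variables (R : nat -> nat -> seq nat -> nat -> Prop) (F : form).
Hypotheses (F_Sigma : Sigma F) (F_scoped : scoped 3 F).

Lemma std_inst3 v x y z :
  (exists e, rlz (std R) v (inst F [:: x; y; z]) e) <->
    sat (nth 0 [:: v x; v y; v z]) F.
Proof.
rewrite rl_inst3 //; split=> [[e]|]; first exact: std_Sigma_sound F_scoped.
exact: std_Sigma_complete F_scoped.
Qed.

End SigmaPredicates.

Lemma std_formH R G v x y : kleene_formula G ->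
  (exists e, rlz (std R) v (formH G x y) e) <-> kleene (v x) (v y) 0.
Proof.
move=> [GS Gs Gd _]; split.
  move=> [e [[_ /= E] H]]; apply/Gd.
  have /(std_inst3 R GS Gs) : exists e', rlz (std R) (scons (expo0 e) v)
    (inst G [:: x.+1; y.+1; 0]) e'.
    by exists (expo1 (expo1 e)).
  by rewrite /= E.
move=> /Gd /= S.
have [e He] := (std_inst3 R GS Gs (scons 0 v) x.+1 y.+1 0).2 S.
by exists (pair 0 (pair 0 e)); rewrite /formH /= !expE.
Qed.

Lemma std_formB R Fg v x y : represents2 Fg gseq ->
  (exists e, rlz (std R) v (formB Fg x y) e) <-> gseq (v x) (v y) = 1.
Proof.
move=> [FS Fs Fd _ _]; split.
  move=> [e [H [[_ /= E1] [_ /= E2]]]]; apply/Fd.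
  have /(std_inst3 R FS Fs) : exists e', rlz (std R) (scons (expo0 e) v)
    (inst Fg [:: x.+1; y.+1; 0]) e'.
    by eexists; exact: H.
  by rewrite /= -E2 E1.
move=> /Fd /= S.
have [e He] := (std_inst3 R FS Fs (scons 1 v) x.+1 y.+1 0).2 S.
by exists (pair 1 (pair e (pair 0 (pair 0 0)))); rewrite /formB /= !expE.
Qed.

(** The triangular number t without division. *)
Lemma cpairE x y : exists2 t, cpair x y = t + x & t * 2 = (x + y) * (x + y + 1).
Proof.
exists ((x + y) * (x + y + 1) %/ 2) => //; apply: divnK.
by rewrite dvdn2 oddM addn1 oddS andbN.
Qed.

Lemma cpair_inj x y x' y' : cpair x y = cpair x' y' -> x = x' /\ y = y'.
Proof.
have [t -> Et] := cpairE x y; have [t' -> Et'] := cpairE x' y' => E.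
suff : x + y = x' + y' by nia.
move: Et Et'; set s := x + y; set s' := x' + y' => Et Et'.
have Lx : x <= s by apply: leq_addr.
have Lx' : x' <= s' by apply: leq_addr.
by case: (ltngtP s s') => // L; nia.
Qed.

Lemma cunpairK x y : cunpair (cpair x y) = (x, y).
Proof.
have [t Ec Et] := cpairE x y.
have Lx : x < (cpair x y).+1 by lia.
have Ly : y < (cpair x y).+1 by nia.
rewrite /cunpair; case: pickP => [p /eqP /cpair_inj [-> ->] //|].
by move=> /(_ (Ordinal Lx, Ordinal Ly)); rewrite eqxx.
Qed.

(** * The premise of the predicate formula in the standard structure *)

(** The projections l and r undo c, so that iterated pairing codes any finite
    sequence of truth values. *)
Lemma gseq_surj z (P : nat -> Prop) :
  exists v, forall x, x <= z -> gseq v x = 1 <-> P x.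
Proof.
have gseq0 u b : gseq (cpair u b) 0 = b by rewrite /gseq /cright cunpairK.
have gseqS u b x : gseq (cpair u b) x.+1 = gseq u x.
  by rewrite /gseq /lstar iterSr /cleft cunpairK.
have bit (A : Prop) : exists b, b = 1 <-> A.
  by case: (classic A) => H; [exists 1 | exists 0].
elim: z P => [|z IH] P; have [b Hb] := bit (P 0).
  by exists (cpair 0 b) => -[|x] //; rewrite gseq0.
have [u Hu] := IH (fun x => P x.+1).
by exists (cpair u b) => -[_|x Hx]; rewrite ?gseq0 ?gseqS //; apply: Hu.
Qed.

Section FormulaQ.

Variables (G Fc Fl Fr Fls Fg : form).
Hypotheses (hG : kleene_formula G) (hF : pairing_formulas Fc Fl Fr Fls Fg).

Section Instances.

Variables (I : Type) (D : I -> Prop) (d : I -> nat).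
Variable R : I -> nat -> nat -> seq nat -> nat -> Prop.

(** A Sigma-formula with a realizer is true, and G defines a functional
    relation. *)
Lemma std_A26 v : solvable D d (fun i => rlz (std (R i)) (v i) (axA26 G)).
Proof.
case: hG => GS Gs Gd _.
do 4!apply: sol_AllI; apply: sol_ImpI.
apply: sol_true => -[[[[[i x] y] z1] z2] a] [_ /= [H1 H2]].
have /(std_inst3 (R i) GS Gs)/Gd H1' := ex_intro _ _ H1.
have /(std_inst3 (R i) GS Gs)/Gd H2' := ex_intro _ _ H2.
by rewrite /= in H1' H2' *; rewrite (keval_det H1' H2').
Qed.

(** Classically a code v exists.  Since a doubly negated formula is realized by
    any number as soon as the formula is realizable, it suffices to realize the
    equivalences for the numbers x up to z, one by one. *)
Lemma std_A27 v : solvable D d (fun i => rlz (std (R i)) (v i) (axA27 G Fg)).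
Proof.
do 2!apply: sol_AllI; apply: sol_NegI.
move=> [[i y] z] a _ /= H; pose w := scons z (scons y (v i)).
suff [b Hb] : exists b, rlz (std (R i)) w
  (Ex (bAll 1 (formB Fg 1 0 ⟷ formH G 3 0))) b.
  by have [c [_ []]] := H b Hb.
have [u Hu] := gseq_surj z (fun x => kleene y x 0).
suff [b Hb] : exists b, rlz (std (R i)) (scons u w)
  (bAll 1 (formB Fg 1 0 ⟷ formH G 3 0)) b.
  by exists (pair u b); rewrite /= !expE.
apply/solT; apply: sol_AllI; apply: sol_ImpI.
set D' := ext _ _; set d' := dex _.
have hx : computable D' d' (fun j => j.1.2) := cmp_ext _ (cmp_snd _ _ _).
apply: (sol_cases (n := z.+1) hx) => [x|j [_ /= [_ /=]]]; last by lia.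
rewrite ltnS => Lx.
suff [b Hb] : exists b, rlz (std (R i)) (scons x (scons u w))
  (formB Fg 1 0 ⟷ formH G 3 0) b.
  by apply: (sol_some _ (b := b)) => j [_ ->].
have [_ _ _ _ hg _ _ _ _ _] := hF.
have HB : _ <-> gseq u x = 1 := std_formB (R i) (scons x (scons u w)) 1 0 hg.
have HH : _ <-> kleene y x 0 := std_formH (R i) (scons x (scons u w)) 3 0 hG.
have {}Hu := Hu x Lx.
apply/solT; apply: sol_AndI; apply: sol_ImpI.
  case: (classic (kleene y x 0)) => K.
    by case: HH => _ /(_ K) [b Hb]; apply: (sol_some _ (b := b)).
  by apply: sol_absurd => j [_ Hj]; apply/K/Hu/HB; exists j.2.
case: (classic (kleene y x 0)) => K.
  by case: HB => _ /(_ (Hu.2 K)) [b Hb]; apply: (sol_some _ (b := b)).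
by apply: sol_absurd => j [_ Hj]; apply/K/HH; exists j.2.
Qed.

(** Soundness of the proof that g is total yields the value of g with a
    realizer; comparing it with 1 decides B.  In the negative case B is false,
    hence it is not realizable. *)
Lemma std_A28 : solvable D d (fun i => rlz (std (R i)) (fun=> 0) (axA28 Fg)).
Proof.
have [_ _ _ _ hg _ _ _ _ _] := hF; have [FS Fs Fd Ft _] := hg.
have /sol_cmp [T [hT HT]] : solvable D d
  (fun i => rlz (std (R i)) (fun=> 0) (total2 Fg)).
  by apply: (HA_sound Ft) => // k; apply: cmp_const.
do 2!apply: sol_AllI.
set D' := ext _ _; set d' := dex _.
have hx : computable D' d' (fun j => j.1.2) := cmp_ext _ (cmp_snd _ _ _).
have hy : computable D' d' (fun j => j.2) := cmp_snd _ _ _.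
have Tot : solvable D' d' (fun j => rlz (std (R j.1.1)) (fun=> 0)
    (All (All (Ex (inst Fg [:: 2; 1; 0]))))).
  by apply: (cmp_sol (cmp_ext _ (cmp_ext _ hT))) => j [[/HT]].
have [Z [hZ sZ]] := sol_ExE (sol_AllE (sol_AllE Tot hx) hy).
have HZ j : D' j -> gseq j.1.2 j.2 = Z j.
  move=> Hj; case: sZ => e /(_ j Hj) [b [_ Hb]]; apply/Fd.
  by have /(std_inst3 (R j.1.1) FS Fs) := ex_intro _ _ Hb.
apply: (sol_if (cmp_rec2 rec2_neqn hZ (cmp_const _ _ 1))).
  apply: sol_OrI1; apply: (sol_ExI (X := Z));
    first by apply: cmp_sub hZ => j [].
  apply: sol_AndI; first by apply: sol_sub sZ => j [].
  apply: (sol_ExI (cmp_const _ _ 0)); by apply: sol_AndI;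
    apply: sol_true => // j [_] /=; rewrite /neqn; lia.
apply: sol_OrI2; apply: sol_NegI => j a [Hj Zj] Ha.
have /= := (std_formB (R j.1.1) _ 1 0 hg).1 (ex_intro _ _ Ha).
by rewrite HZ // => E; apply: Zj; rewrite E.
Qed.

Lemma std_formQ : solvable D d
  (fun i => rlz (std (R i)) (fun=> 0) (formQ G Fg)).
Proof.
apply: sol_bigconjI => p.
move/(List.in_app_or basic_axioms [:: axA26 G; axA27 G Fg; axA28 Fg]) => [H|].
  exact: std_basic.
case=> [<-|[<-|[<-|[]]]]; [exact: std_A26 | exact: std_A27 | exact: std_A28].
Qed.

End Instances.

End FormulaQ.

Lemma rl_bigconj J v p ps e : rlz J v (bigconj p ps) e ->
  forall p', List.In p' (p :: ps) -> exists e', rlz J v p' e'.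
Proof.
elim: ps p e => [|p1 ps IH] p e /=; first by move=> H p' [<-|[]]; exists e.
move=> [H1 H2] p' [<-|]; first by exists (expo0 e).
exact: IH H2 p'.
Qed.

Notation pvsem := (nat -> nat -> seq nat -> nat -> Prop).

Lemma sol_iter_All m p :
  (forall I (D : I -> Prop) d (v : I -> nat -> nat) (R : I -> pvsem),
     solvable D d (fun i => rlz (std (R i)) (v i) p)) ->
  forall I (D : I -> Prop) d (v : I -> nat -> nat) (R : I -> pvsem),
    solvable D d (fun i => rlz (std (R i)) (v i) (iter m All p)).
Proof.
move=> H; elim: m => [|m IH] //= I D d v R.
apply: sol_AllI; exact: (IH _ _ _ _ (fun j => R j.1)).
Qed.

Lemma In_mem (T : eqType) (x : T) s : x \in s -> List.In x s.
Proof. by elim: s => //= y s IH; rewrite inE => /orP [/eqP ->|/IH]; auto. Qed.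

(** Realized equations are true, so that the two lists of arguments agree and
    the identity realizes the conclusion. *)
Lemma std_equality_axiom P I (D : I -> Prop) d (v : I -> nat -> nat)
  (R : I -> pvsem) :
  solvable D d (fun i => rlz (std (R i)) (v i) (equality_axiom P)).
Proof.
case: P => n k; rewrite /equality_axiom.
apply: sol_iter_All => {v R} {}I {}D {}d v R.
set x := (fun j => n + n - j.+1); set y := (fun j => n - j.+1).
have Hp I' (D' : I' -> Prop) d' (w : I' -> nat -> nat) (S : I' -> pvsem) :
    (forall i, D' i -> forall j, j < n -> w i (x j) = w i (y j)) ->
    solvable D' d' (fun i => rlz (std (S i)) (w i)
      (PV k [tuple x (val j) | j < n] ⟶ PV k [tuple y (val j) | j < n])).
  move=> H; apply: sol_ImpI; apply: (cmp_sol (cmp_snd _ _ _)) => j [Hj] /=.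
  suff <- : map (w j.1) [seq x (val l) | l <- enum 'I_n] =
    map (w j.1) [seq y (val l) | l <- enum 'I_n] by [].
  by rewrite -!map_comp; apply: eq_map => l /=; apply: H.
case E: [seq fE (x j) (y j) | j <- iota 0 n] => [|q qs].
  by apply: Hp => i _ j Lj; have := congr1 size E;
    rewrite size_map size_iota => En; rewrite En in Lj.
apply: sol_ImpI; apply: (Hp _ _ _ (fun j => v j.1) (fun j => R j.1)) => j
  [_ /rl_bigconj Hj] l Ll.
have [|e [_ /=] //] := Hj (fE (x l) (y l)).
rewrite -E; apply/List.in_map_iff; exists l; split=> //; apply: In_mem.
by rewrite mem_iota.
Qed.

(** * From the predicate formula to the scheme *)

(** Under this interpretation Phi* speaks about arithmetic, and Phi keeps its
    meaning. *)
Definition extend_std (f : interpretation) : interpretation := fun n i =>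
  match [pick s : 'I_5 | nth (0, 0) reserved s == (n, i)] with
  | Some s => Some (fun (t : n.-tuple nat) e =>
      e = 0 /\ atrue (nth symZ [:: symZ; symE; symS; symA; symM] s) (val t))
  | None => if f n i is Some P then Some P else Some (fun _ _ => False)
  end.

Lemma extend_std_ar f s l e : size l = arity s ->
  pv_realizer (extend_std f) (arity s) (arindex s) l e <-> e = 0 /\ atrue s l.
Proof.
move=> Hl; have Ht : size l == arity s by apply/eqP.
pose P0 (t : (arity s).-tuple nat) e := e = 0 /\ atrue s (val t).
suff E : extend_std f (arity s) (arindex s) = Some P0.
  rewrite /pv_realizer E; split=> [[P [t [[<-] <-]]]//|H].
  by exists P0, (Tuple Ht).
rewrite /extend_std; case: pickP => [j|].
  by case: s {Hl Ht} @P0 => /=; case: j => -[|[|[|[|[|]]]]].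
have k5 k : k < 5 -> k < 5 by [].
by case: s {Hl Ht} @P0 => /= H;
  [have := H (Ordinal (k5 0 isT)) | have := H (Ordinal (k5 1 isT)) |
   have := H (Ordinal (k5 2 isT)) | have := H (Ordinal (k5 3 isT)) |
   have := H (Ordinal (k5 4 isT))].
Qed.

Lemma extend_std_pv f n i l e : (n, i) \notin reserved -> f n i <> None ->
  pv_realizer (extend_std f) n i l e <-> pv_realizer f n i l e.
Proof.
move=> Hr Hf; suff E : extend_std f n i = f n i by rewrite /pv_realizer E.
rewrite /extend_std; case: pickP => [j /eqP E|_]; last by case: (f n i) Hf.
by move: Hr; rewrite -E mem_nth.
Qed.

Section StarToScheme.

Variables (G Fc Fl Fr Fls Fg : form).
Hypotheses (hG : kleene_formula G) (hF : pairing_formulas Fc Fl Fr Fls Fg).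
Variables (Phi : form) (Ps : seq (nat * nat)).
Hypotheses (hPs : {subset pvars Phi <= Ps}).
Hypotheses (hreserved : forall P, P \in Ps -> P \notin reserved).

(** The premise of Phi*, before its symbols are read as predicate variables. *)
Definition star_premise :=
  if [seq equality_axiom P | P <- Ps] is q :: qs
  then formQ G Fg ∧ bigconj q qs else formQ G Fg.

Lemma starE : star G Fg Ps Phi = as_predicate (star_premise ⟶ Phi).
Proof. by rewrite /star /star_premise; case: [seq _ | P <- Ps]. Qed.

Lemma std_premise I (D : I -> Prop) d (R : I -> pvsem) :
  solvable D d (fun i => rlz (std (R i)) (fun=> 0) star_premise).
Proof.
have HQ := std_formQ hG hF D d R.
rewrite /star_premise; case E: [seq _ | P <- Ps] => [|p ps] //.
apply: sol_AndI => //; apply: sol_bigconjI => p'; rewrite -E.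
by move=> /List.in_map_iff [P [<- _]]; apply: std_equality_axiom.
Qed.

(** A realizer of Phi* is applied to the realizer of the premise that does not
    depend on the interpretation; the value does not depend on it either. *)
Lemma star_to_scheme :
  absolutely_realizable (star G Fg Ps Phi) -> absolutely_realizable Phi.
Proof.
rewrite starE => -[e He].
have [a Ha] := sol_const (std_premise (fun _ : interpretation => True) (fun=> 0)
  (fun f => pv_realizer (extend_std f))).
have {}Ha f : exists b, kleene e a b /\
  rlz (std (pv_realizer (extend_std f))) (fun=> 0) Phi b.
  have std_mod p v c : rlz (sem_predicate (extend_std f)) v p c <->
    rlz (std (pv_realizer (extend_std f))) v p c.
    by apply: rl_congr => // s l c'; apply: extend_std_ar.
  have : interprets (extend_std f) (as_predicate (star_premise ⟶ Phi)).
    move=> n i _; rewrite /extend_std; case: pickP => [//|_].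
    by case: (f n i).
  move=> /He /realizes_as_predicate /= /(_ a) [|b [Hb HP]]; first exact/std_mod.
  by exists b; split=> //; apply/std_mod.
have [b [Hb _]] := Ha (fun _ _ => None); exists b => f Hf.
have [b' [Hb' HP]] := Ha f; rewrite -(keval_det Hb Hb').
apply/realizes_rl.
suff E : rlz (std (pv_realizer (extend_std f))) (fun=> 0) Phi b' <->
  rlz (sem_scheme f) (fun=> 0) Phi b'.
  exact: E.1 HP.
apply: rl_congr => // n i l c Hn _ /=.
by apply: extend_std_pv; [apply/hreserved/hPs | apply: Hf].
Qed.

End StarToScheme.

(** * There are no nonstandard elements *)

Section Tennenbaum.

Variables (G Fc Fl Fr Fls Fg : form).
Hypotheses (hG : kleene_formula G) (hF : pairing_formulas Fc Fl Fr Fls Fg).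
Variables (J : sem) (q : nat).
Hypothesis hJ : models J q.
Hypothesis h26 : exists e, rlz J (fun=> 0) (axA26 G) e.
Hypothesis h27 : exists e, rlz J (fun=> 0) (axA27 G Fg) e.
Hypothesis h28 : exists e, rlz J (fun=> 0) (axA28 Fg) e.

Local Notation nm n := (num J q n).
Local Notation val3 x y z := (nth 0 [:: x; y; z]).

Lemma realized_kleene x y z : kleene x y z ->
  exists e, rlz J (val3 (nm x) (nm y) (nm z)) G e.
Proof.
case: hG => GS Gs Gd _ /Gd S.
apply: (complete_realized (Sigma_complete hJ GS Gs S)).
by move=> [|[|[|]]] //= _; apply: standard_num.
Qed.

(** A26, for the mere existence of realizers. *)
Lemma realized_functional x y z1 z2 :
  (exists e, rlz J (val3 x y z1) G e) -> (exists e, rlz J (val3 x y z2) G e) ->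
  exists e, sar J symE [:: z1; z2] e.
Proof.
case: hG => _ Gs _ _ /solT H1 /solT H2; move: h26 => /solT H.
have c n : computable (fun _ : unit => True) (fun=> 0) (fun=> n) :=
  cmp_const _ _ n.
apply/solT; have := sol_ImpE (inst4 H (c x) (c y) (c z1) (c z2)); apply.
by apply: sol_AndI; [apply: sol_imp H1 _ | apply: sol_imp H2 _] => i b _ /=;
  rewrite rl_inst3.
Qed.

Lemma rl_formB v v' x y x' y' e : v x = v' x' -> v y = v' y' ->
  rlz J v (formB Fg x y) e <-> rlz J v' (formB Fg x' y') e.
Proof.
have [_ _ _ _ [_ Fs _ _ _] _ _ _ _ _] := hF.
by move=> Ex Ey; rewrite /formB /= !rl_inst3 //= Ex Ey.
Qed.

Lemma rl_formH v x y : (exists e, rlz J v (formH G x y) e) <->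
  exists z, (exists e, sar J symZ [:: z] e) /\
    exists e, rlz J (val3 (v x) (v y) z) G e.
Proof.
case: hG => _ Gs _ _; split.
  move=> [e /= [He1]]; rewrite rl_inst3 //= => He2.
  by exists (expo0 e); split;
    [exists (expo0 (expo1 e)) | exists (expo1 (expo1 e))].
move=> [z [[e1 H1] [e2 H2]]]; exists (pair z (pair e1 e2)).
by rewrite /formH /= rl_inst3 //= !expE.
Qed.

(** Below a nonstandard element A27 provides a code for the numbers n such that
    H(y, n) is realizable, where {y}(n) = {n}(n).  These include all n with
    {n}(n) = 0 and no n with {n}(n) = 1, and A28 decides them; but no decidable
    set separates the two. *)
Lemma all_standard x : exists n, standard J q x n.
Proof.
apply: NNPP => Hx; have {}Hx n : ~ standard J q x n by move=> H; apply: Hx;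
  exists n.
have Hle := num_le_nonstandard hJ Hx.
have [u Hu] := universal.
have [y Hy] := kleene_comp u
  (cmp_pair (cmp_id (fun _ : nat => True) id) (cmp_id _ _)).
have {}Hy n z : kleene n n z -> kleene y n z by move=> H; apply: Hy => //;
  apply: Hu.
(* By A27 some [v] codes, below [x], the set of all n such that H(y, n). *)
pose w := scons x (scons (nm y) (fun=> 0)).
have [v [c Hv]] : exists v c, rlz J (scons v w)
  (bAll 1 (formB Fg 1 0 ⟷ formH G 3 0)) c.
  apply: NNPP => C; have [e He] := h27.
  have [e1 [_ He1]] := He (nm y); have [e2 [_ He2]] := He1 x.
  have [|b [_ []]] := He2 0; move=> b Hb; case: C.
  by exists (expo0 b), (expo1 b).
have HB n : (exists e, rlz J (scons (nm n) (scons v w)) (formB Fg 1 0) e) <->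
    exists z, (exists e, sar J symZ [:: z] e) /\
      exists e, rlz J (val3 (nm y) (nm n) z) G e.
  rewrite -(rl_formH (scons (nm n) (scons v w)) 3 0).
  have [t [e1 H1]] := Hle n; have [b [_ Hb]] := Hv (nm n).
  have [|b' [_ [H2 H3]]] := Hb (pair t e1); first by rewrite /= !expE.
  by split=> -[e He]; [have [b1 [_]] := H2 e He | have [b1 [_]] := H3 e He];
    exists b1.
have /sol_cmp [F [hF' HF]] : solvable (fun _ : nat => True) id (fun n =>
    rlz J (scons (nm n) (scons v (fun=> 0))) (formB Fg 1 0 ∨ ¬ formB Fg 1 0)).
  have [e He] := h28.
  have H : solvable (fun _ : nat => True) id (fun=> rlz J (fun=> 0) (axA28 Fg)).
    by apply: (sol_some _ (b := e)).
  apply: (inst2 H (cmp_const _ _ v)).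
  exact: (@cmp_num _ _ _ (fun=> J) (fun=> q) (cmp_const _ _ q) (fun _ _ => hJ) _
    (cmp_id _ _)).
have [d Hd] := cmp_rec2 rec2_sub (cmp_const _ _ 1) (cmp_expo0 hF').
(* [d] reverses the decision of A28, and its value at [d] itself is refuted. *)
have {}Hd := Hd d Logic.I; case: (HF d Logic.I) => -[E H]; rewrite E in Hd.
  have [] := (HB d).1.
    by exists (expo1 (F d)); apply: (rl_formB _ _ _).1 H.
  move=> z [Zz Gz]; have E1 :=
    realized_functional Gz (realized_kleene (Hy _ _ Hd)).
  by case: (T_succ_neq0 hJ (T_num_succ hJ 0)); apply: (T_zero_congr hJ E1).
have [] := (HB d).2.
  exists (nm 0); split; first exact: (T_num_zero hJ).
  exact: realized_kleene (Hy _ _ Hd).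
move=> e He; have [|b [_ []]] := H e.
by apply: (rl_formB _ _ _).1 He.
Qed.

End Tennenbaum.

(** * Equality of arguments *)

(** Variables count quantifiers outwards, so that the last element has index
    0. *)
Lemma foldl_scons (l : seq nat) u k :
  foldl (fun u x => scons x u) u l k =
  if k < size l then nth 0 l (size l - k.+1) else u (k - size l).
Proof.
elim: l u k => [|x l IH] u k /=; first by rewrite subn0.
rewrite IH; case: (ltnP k (size l)) => H.
  by rewrite ifT ?subSn //; lia.
case: (ltnP (size l) k) => H'; first by rewrite ifF -?(subnSK H') //; lia.
by rewrite ifT (_ : k = size l) ?subnn //; lia.
Qed.

Lemma sol_iter_AllE I (D : I -> Prop) d (J : I -> sem) (v : I -> nat -> nat) p
  (xs : seq (I -> nat)) : (forall X, List.In X xs -> computable D d X) ->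
  solvable D d (fun i => rlz (J i) (v i) (iter (size xs) All p)) ->
  solvable D d (fun i => rlz (J i)
    (foldl (fun u x => scons x u) (v i) [seq X i | X <- xs]) p).
Proof.
elim: xs v => [|X xs IH] //= v HX H.
apply: (IH (fun i => scons (X i) (v i))); first by move=> Y HY; apply: HX;
  right.
by apply: sol_AllE => //; apply: HX; left.
Qed.

Lemma mem_In (T : eqType) (x : T) s : List.In x s -> x \in s.
Proof. by elim: s => //= y s IH [->|/IH]; rewrite inE ?eqxx // orbC => ->. Qed.

Lemma sol_equality I (D : I -> Prop) d (J : I -> sem) n k
  (X Y : nat -> I -> nat) :
  solvable D d (fun i => rlz (J i) (fun=> 0) (equality_axiom (n, k))) ->
  (forall j, j < n -> [/\ computable D d (X j), computable D d (Y j) &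
      solvable D d (fun i => sar (J i) symE [:: X j i; Y j i])]) ->
  solvable D d (fun i => spv (J i) n k [seq X j i | j <- iota 0 n]) ->
  solvable D d (fun i => spv (J i) n k [seq Y j i | j <- iota 0 n]).
Proof.
move=> Hax HXY HX.
pose xs := [seq X j | j <- iota 0 n] ++ [seq Y j | j <- iota 0 n].
have sxs : size xs = n + n by rewrite size_cat !size_map !size_iota.
have Hxs Z : List.In Z xs -> computable D d Z.
  move=> /List.in_app_iff [] /List.in_map_iff [j [<- /mem_In]];
    by rewrite mem_iota => /andP [_ /HXY []].
move: Hax; rewrite /equality_axiom -sxs => /(sol_iter_AllE Hxs).
set x := (fun j => size xs - j.+1); set y := (fun j => n - j.+1).
pose u i := foldl (fun u x => scons x u) (fun=> 0) [seq Z i | Z <- xs].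
have ux i j : j < n -> u i (x j) = X j i.
  move=> Hj; rewrite /u foldl_scons size_map /x ifT; last by lia.
  rewrite (_ : size xs - _ = j); last by lia.
  rewrite (nth_map (fun=> 0)); last by lia.
  by rewrite nth_cat size_map size_iota Hj (nth_map 0) ?size_iota // nth_iota.
have uy i j : j < n -> u i (y j) = Y j i.
  move=> Hj; rewrite /u foldl_scons size_map /y ifT; last by lia.
  rewrite (_ : size xs - _ = n + j); last by lia.
  rewrite (nth_map (fun=> 0)); last by lia.
  rewrite nth_cat size_map size_iota ifF; last by lia.
  by rewrite addKn (nth_map 0) ?size_iota // nth_iota.
have Hp : solvable D d (fun i => rlz (J i) (u i)
    (PV k [tuple x (val j) | j < n] ⟶ PV k [tuple y (val j) | j < n])) ->
    solvable D d (fun i => spv (J i) n k [seq Y j i | j <- iota 0 n]).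
  have ex i : map (u i) [seq x (val l) | l <- enum 'I_n] =
    [seq X j i | j <- iota 0 n].
    by rewrite -val_enum_ord -!map_comp; apply: eq_map => l /=; apply: ux.
  have ey i : map (u i) [seq y (val l) | l <- enum 'I_n] =
    [seq Y j i | j <- iota 0 n].
    by rewrite -val_enum_ord -!map_comp; apply: eq_map => l /=; apply: uy.
  move=> /sol_ImpE H.
  have {}H : solvable D d
    (fun i => spv (J i) n k (map (u i) [seq y (val l) | l <- enum 'I_n])).
    by apply: H; apply: sol_imp HX _ => i b _ /=; rewrite ex.
  by apply: sol_imp H _ => i b _; rewrite ey.
case E: [seq fE (x j) (y j) | j <- iota 0 n] => [|p ps] // /sol_ImpE H.
apply: Hp; apply: H; apply: sol_bigconjI => p'; rewrite -E.
move=> /List.in_map_iff [j [<- /mem_In]];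
  rewrite mem_iota add0n => /andP [_ Hj].
have [_ _ HE] := HXY j Hj; apply: sol_imp HE _ => i b _ /=.
by rewrite -/(u i) ux // uy.
Qed.

(** * Translation between an interpretation and its restriction to numerals *)

(** Numbers in place of the elements that their numerals denote: arithmetic is
    standard, and predicate variables are evaluated at numerals. *)
Definition reduct (J : sem) (q : nat) : sem :=
  std (fun n i l => spv J n i (map (num J q) l)).

Section Translation.

Variable Ps : seq (nat * nat).

(** The hypotheses of the translation: the premises of Phi* are realized, all
    elements are standard, and the elements [a] correspond to the numbers
    [w]. *)
Record setting I (D : I -> Prop) d (J : I -> sem) q (a w : I -> nat -> nat) :
  Prop :=
  Setting {
    set_q : computable D d q;
    set_models : forall i, D i -> models (J i) (q i);
    set_standard : forall i, D i ->
      forall x, exists n, standard (J i) (q i) x n;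
    set_equality : forall P, P \in Ps ->
      solvable D d (fun i => rlz (J i) (fun=> 0) (equality_axiom P));
    set_tracks : forall k, tracks D d J q a w k
  }.

Lemma tracks_ext I (D : I -> Prop) d J q a w k X : tracks D d J q a w k ->
  tracks (ext D X) (dex d) (fun j => J j.1) (fun j => q j.1)
    (fun j => a j.1) (fun j => w j.1) k.
Proof.
case=> h1 h2 h3; split.
- exact: (cmp_ext _ h1).
- exact: (cmp_ext _ h2).
- exact: (sol_ext _ h3).
Qed.

Lemma setting_ext I (D : I -> Prop) d J q a w X : setting D d J q a w ->
  setting (ext D X) (dex d) (fun j => J j.1) (fun j => q j.1)
    (fun j => a j.1) (fun j => w j.1).
Proof.
case=> h1 h2 h3 h4 h5; split.
- exact: (cmp_ext _ h1).
- by move=> j [/h2].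
- by move=> j [/h3].
- by move=> P /h4 H; apply: (sol_ext _ H).
- by move=> k; apply: tracks_ext.
Qed.

Lemma setting_sub I (D D' : I -> Prop) d J q a w : (forall i, D' i -> D i) ->
  setting D d J q a w -> setting D' d J q a w.
Proof.
move=> HD [h1 h2 h3 h4 h5]; split.
- exact: cmp_sub HD h1.
- by move=> j /HD /h2.
- by move=> j /HD /h3.
- by move=> P /h4; apply: sol_sub HD.
- move=> k; have [t1 t2 t3] := h5 k.
  by split; [apply: cmp_sub HD t1 | apply: cmp_sub HD t2 | apply: sol_sub HD
    t3].
Qed.

Lemma setting_scons I (D : I -> Prop) d J q a w x n : setting D d J q a w ->
  computable D d x -> computable D d n ->
  solvable D d (fun i => sar (J i) symE [:: x i; num (J i) (q i) (n i)]) ->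
  setting D d J q (fun i => scons (x i) (a i)) (fun i => scons (n i) (w i)).
Proof.
by case=> h1 h2 h3 h4 h5 hx hn HE; split=> // -[|k]; [split | exact: (h5 k)].
Qed.

Lemma setting_num I (D : I -> Prop) d J q a w n : setting D d J q a w ->
  computable D d n -> computable D d (fun i => num (J i) (q i) (n i)) /\
  setting D d J q (fun i => scons (num (J i) (q i) (n i)) (a i))
    (fun i => scons (n i) (w i)).
Proof.
move=> S hn; have hx := cmp_num (set_q S) (set_models S) hn; split=> //.
by apply: setting_scons => //; apply: (E_refl (set_q S) (set_models S)).
Qed.

(** A new element comes with its standard part. *)
Lemma setting_element I (D : I -> Prop) d J q a w x : setting D d J q a w ->
  computable D d x -> exists n, computable D d n /\
  setting D d J q (fun i => scons (x i) (a i)) (fun i => scons (n i) (w i)).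
Proof.
move=> S hx.
have [i Hi|n [hn HE]] := standard_part (set_q S) (set_models S) hx.
  exact: (set_standard S).
by exists n; split=> //; apply: setting_scons.
Qed.

Definition translates p := forall I (D : I -> Prop) d J q a w,
  setting D d J q a w ->
  (solvable D d (fun i => rlz (reduct (J i) (q i)) (w i) p) ->
   solvable D d (fun i => rlz (J i) (a i) p)) /\
  (solvable D d (fun i => rlz (J i) (a i) p) ->
   solvable D d (fun i => rlz (reduct (J i) (q i)) (w i) p)).

Lemma translates_Imp p p' : translates p -> translates p' ->
  translates (p ⟶ p').
Proof.
move=> Hp Hp' I D d J q a w S.
split=> H; apply: sol_ImpI.
  have S' := setting_ext (fun i => rlz (J i) (a i) p) S.
  apply: (Hp' _ _ _ _ _ _ _ S').1; apply: (sol_ImpE (sol_ext _ H)).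
  by apply: (Hp _ _ _ _ _ _ _ S').2; apply: (cmp_sol (cmp_snd _ _ _)) => j [].
have S' := setting_ext (fun i => rlz (reduct (J i) (q i)) (w i) p) S.
apply: (Hp' _ _ _ _ _ _ _ S').2; apply: (sol_ImpE (sol_ext _ H)).
by apply: (Hp _ _ _ _ _ _ _ S').1; apply: (cmp_sol (cmp_snd _ _ _)) => j [].
Qed.

(** The equality axiom for P transports realizers between numerals and equal
    elements, in both directions. *)
Lemma translates_PV n k (t : n.-tuple nat) : (n, k) \in Ps ->
  translates (PV k t).
Proof.
move=> HP I D d J q a w S; have HE := set_equality S HP.
have st : size t = n by rewrite size_tuple.
have mE (f : nat -> nat) : [seq f (nth 0 t j) | j <- iota 0 n] = map f t.
  by rewrite -[in RHS](mkseq_nth 0 t) /mkseq st -map_comp.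
have tr j : [/\ computable D d (fun i => a i (nth 0 t j)),
    computable D d (fun i => num (J i) (q i) (w i (nth 0 t j))) &
    solvable D d (fun i => sar (J i) symE
      [:: a i (nth 0 t j); num (J i) (q i) (w i (nth 0 t j))])].
  by have [t1 t2 t3] := set_tracks S (nth 0 t j); split=> //;
    apply: (cmp_num (set_q S) (set_models S)).
have rE i : map (num (J i) (q i)) (map (w i) t) =
    [seq num (J i) (q i) (w i (nth 0 t j)) | j <- iota 0 n].
  by rewrite -map_comp -mE.
pose A j i := a i (nth 0 t j).
pose N j i := num (J i) (q i) (w i (nth 0 t j)).
split=> H.
  have HN : solvable D d (fun i => spv (J i) n k [seq N j i | j <- iota 0 n]).
    by apply: sol_imp H _ => i b _ /=; rewrite rE.
  apply: sol_imp (@sol_equality _ D d J n k N A HE _ HN) _ => [j _|i b _].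
    have [t1 t2 t3] := tr j; split=> //.
    exact: (E_sym (set_q S) (set_models S) t1 t2 t3).
  by rewrite /= -mE.
have HA : solvable D d (fun i => spv (J i) n k [seq A j i | j <- iota 0 n]).
  by apply: sol_imp H _ => i b _ /=; rewrite -mE.
apply: sol_imp (@sol_equality _ D d J n k A N HE _ HA) _ => [j _|i b _].
  exact: tr.
by rewrite /= rE.
Qed.

(** A quantifier over elements is translated by standard parts, a quantifier
    over numbers by numerals; implication uses both directions. *)
Lemma translation p : {subset pvars p <= Ps} -> translates p.
Proof.
elim: p => [|s t|n k t|p IH p' IH'|p IH p' IH'|p IH p' IH'|p IH|p IH|p IH] Hp.
- by move=> I D d J q a w S; split=> H; apply: sol_imp H _.
- move=> I D d J q a w S; split=> H.
    apply: (atom_up (set_q S) (set_models S)); first by move=> k _;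
      apply: (set_tracks S).
    by have [F [_ HF]] := sol_cmp H; move=> i /HF [].
  apply: sol_true => i Hi; have [F [_ HF]] := sol_cmp H.
  apply: (atom_down (set_models S Hi)) (HF i Hi) => k _.
  by have [_ _ [e /(_ i Hi) [b [_ Hb]]]] := set_tracks S k; exists b.
- by apply: translates_PV; apply: Hp; rewrite mem_head.
- have {}IH : translates p by apply: IH => P HP; apply: Hp; rewrite mem_cat HP.
  have {}IH' : translates p' by apply: IH' => P HP; apply: Hp;
    rewrite mem_cat HP orbT.
  move=> I D d J q a w S.
  have [u1 d1] := IH _ _ _ _ _ _ _ S; have [u2 d2] := IH' _ _ _ _ _ _ _ S.
  split=> H; apply: sol_AndI.
  + exact: u1 (sol_AndE1 H).
  + exact: u2 (sol_AndE2 H).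
  + exact: d1 (sol_AndE1 H).
  + exact: d2 (sol_AndE2 H).
- have {}IH : translates p by apply: IH => P HP; apply: Hp; rewrite mem_cat HP.
  have {}IH' : translates p' by apply: IH' => P HP; apply: Hp;
    rewrite mem_cat HP orbT.
  move=> I D d J q a w S.
  split=> H; apply: (sol_OrE H) => D' HD HH; have S' := setting_sub HD S.
  + by apply: sol_OrI1; apply: (IH _ _ _ _ _ _ _ S').1.
  + by apply: sol_OrI2; apply: (IH' _ _ _ _ _ _ _ S').1.
  + by apply: sol_OrI1; apply: (IH _ _ _ _ _ _ _ S').2.
  + by apply: sol_OrI2; apply: (IH' _ _ _ _ _ _ _ S').2.
- have {}IH : translates p by apply: IH => P HP; apply: Hp; rewrite mem_cat HP.
  have {}IH' : translates p' by apply: IH' => P HP; apply: Hp;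
    rewrite mem_cat HP orbT.
  exact: translates_Imp.
- have H : translates (p ⟶ Bot).
    apply: translates_Imp; first exact: IH.
    by move=> I D d J q a w S; split=> H; apply: sol_imp H _.
  by move=> I D d J q a w S; apply: (H _ _ _ _ _ _ _ S).
- move=> I D d J q a w S; have S' := setting_ext (fun _ _ => True) S.
  have hx := cmp_snd D d (fun _ _ => True).
  split=> H; apply: sol_AllI.
    have [n [hn S'']] := setting_element S' hx.
    by apply: (IH Hp _ _ _ _ _ _ _ S'').1; apply: (sol_AllE (sol_ext _ H)).
  have [hn S''] := setting_num S' hx.
  by apply: (IH Hp _ _ _ _ _ _ _ S'').2; apply: (sol_AllE (sol_ext _ H)).
- move=> I D d J q a w S; split=> /sol_ExE [x [hx H]].
    have [hn S'] := setting_num S hx.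
    by apply: (sol_ExI hn); apply: (IH Hp _ _ _ _ _ _ _ S').1.
  have [n [hn S']] := setting_element S hx.
  by apply: (sol_ExI hn); apply: (IH Hp _ _ _ _ _ _ _ S').2.
Qed.

End Translation.

(** * From the scheme to the predicate formula *)

Section SchemeToStar.

Variables (G Fc Fl Fr Fls Fg : form).
Hypotheses (hG : kleene_formula G) (hF : pairing_formulas Fc Fl Fr Fls Fg).
Variables (Phi : form) (Ps : seq (nat * nat)).
Hypotheses (hclosed : is_closed Phi) (hPs : {subset pvars Phi <= Ps}).

Definition reduct_interpretation (J : sem) q : interpretation := fun n i =>
  Some (fun (t : n.-tuple nat) e => spv J n i (map (num J q) t) e).

Lemma reduct_interpretationP J q v p e :
  rlz (sem_scheme (reduct_interpretation J q)) v p e <-> rlz (reduct J q) v p e.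
Proof.
apply: rl_congr => // n i l c _ /eqP Hl /=; split.
  by move=> [P [t [[<-] <-]]].
move=> H; exists (fun (t : n.-tuple nat) e => spv J n i (map (num J q) t) e),
  (Tuple Hl).
by split.
Qed.

(** The realizer of the premise gives the program access to numerals and
    standard parts; a realizer of Phi for the reduct is known in advance. *)
Lemma scheme_to_star :
  absolutely_realizable Phi -> absolutely_realizable (star G Fg Ps Phi).
Proof.
rewrite starE => -[e He].
suff /sol_const [b Hb] : solvable (fun _ : interpretation => True) (fun=> 0)
    (fun f => rlz (sem_predicate f) (fun=> 0) (star_premise G Fg Ps ⟶ Phi)).
  by exists b => f _; apply/realizes_as_predicate; apply: Hb.
apply: sol_ImpI; set D := ext _ _; set d := dex _.
pose J (j : interpretation * nat) := sem_predicate j.1.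
have Hant : solvable D d (fun j => rlz (J j) (fun=> 0) (star_premise G Fg Ps)).
  by apply: (cmp_sol (cmp_snd _ _ _)) => j [].
have [HQ HE] : solvable D d (fun j => rlz (J j) (fun=> 0) (formQ G Fg)) /\
    forall P, P \in Ps -> solvable D d
      (fun j => rlz (J j) (fun=> 0) (equality_axiom P)).
  move: Hant; rewrite /star_premise; case E: [seq _ | P <- Ps] => [|p ps].
    by move=> H; split=> // P; case: Ps E.
  move=> H; split=> [|P HP]; first exact: sol_AndE1 H.
  apply: sol_bigconj (sol_AndE2 H); rewrite -E.
  by apply/List.in_map_iff; exists P; split=> //; apply: In_mem.
have {}HQ p : List.In p (basic_axioms ++ [:: axA26 G; axA27 G Fg; axA28 Fg]) ->
    solvable D d (fun j => rlz (J j) (fun=> 0) p).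
  by move=> Hp; apply: sol_bigconj HQ.
have [q [hq hJ]] : exists q, computable D d q /\ forall j, D j ->
  models (J j) (q j).
  apply: (@sol_cmp _ D d (fun j => models (J j))).
  apply: sol_bigconjI => p Hp; apply: HQ.
  by apply: (List.in_or_app basic_axioms); left.
have ex p j : List.In p [:: axA26 G; axA27 G Fg; axA28 Fg] -> D j ->
    exists e, rlz (J j) (fun=> 0) p e.
  move=> Hp Hj; have [|c /(_ j Hj) [b [_ Hb]]] := HQ p; last by exists b.
  by apply: (List.in_or_app basic_axioms); right.
have S : setting Ps D d J q (fun j _ => num (J j) (q j) 0) (fun _ _ => 0).
  split=> // [j Hj x|k].
    by apply: (all_standard hG hF (hJ j Hj)); apply: ex => //=; auto.
  have h0 := cmp_num hq hJ (cmp_const _ _ 0).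
  by split=> //; [exact: cmp_const | apply: (E_refl hq hJ)].
have : solvable D d (fun j => rlz (J j) (fun=> num (J j) (q j) 0) Phi).
  apply: (translation hPs S).1; apply: (sol_some _ (b := e)) => j Hj.
  by apply/reduct_interpretationP/realizes_rl; apply: He.
by move/sol_imp; apply=> j b _; rewrite (rl_scoped _ hclosed (w := fun=> 0)).
Qed.

End SchemeToStar.

(* [Ps] is the list P_1, ..., P_m of predicate variables in Phi(P_1, ..., P_m). *)
Theorem theorem4p25 (G Fc Fl Fr Fls Fg : form)
    (hG : kleene_formula G)
    (hF : pairing_formulas Fc Fl Fr Fls Fg)
    (Phi : form) (Ps : seq (nat * nat))
    (hclosed : is_closed Phi)
    (huniq : uniq Ps)
    (hPs : {subset pvars Phi <= Ps})
    (hreserved : forall P, P \in Ps -> P \notin reserved) :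
  absolutely_realizable (star G Fg Ps Phi) <-> absolutely_realizable Phi.
Proof.
split; first exact: (star_to_scheme hG hF hPs hreserved).
exact: (scheme_to_star hG hF hclosed hPs).
Qed.
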